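(* Let $\mu \in \mathscr{W}(\mathbb{R}^n)$ with distribution function $f$. If $U \subset \mathbb{R}^n$ is open and $g \in BV_{\mu}(U) \cap L^\infty(U)$, then there is a family of smooth functions $\{g_\varepsilon\}_{\varepsilon > 0} \subset BV_{\mu}(U)$ such that (1) $g_\varepsilon \rightarrow g$ in $L^1_{\mathrm{loc}}(\mu, U)$ as $\varepsilon \rightarrow 0$, and $\|g_\varepsilon\|_{\infty} \le \|g\|_{\infty} (1+2\varepsilon)$ for all $\varepsilon>0$. (2) $\limsup_{\varepsilon \rightarrow 0}\|Dg_\varepsilon\|(U) \le \|Dg\|(U) + C(n)\|g\|_{\infty}\|\nabla f\|_{L^1(U)}$, where $C(n)$ is a constant depending only on $n$. In fact, if $U$ is bounded, then $g_\varepsilon \rightarrow g$ in $L^1(\mu, U)$. (If $U$ is unbounded, the estimate in (2) may be entirely vacuous when $f \notin W^{1,1}(\mathbb{R}^n)$.)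
   Context: $\mathscr{W}(\mathbb{R}^n)$ is the class of measures $\mu=f\mathcal{L}^n$ whose distribution function (density) $f$ is non-negative and in $L^1(\mathbb{R}^n)\cap W^{1,1}_{\mathrm{loc}}(\mathbb{R}^n)$; $f$ is always taken to be its precise representative. $L^1(\mu,U)$ is the $L^1$ space on $U$ with respect to $\mu$, and $L^1_{\mathrm{loc}}(\mu,U)$ its local version; $\|\cdot\|_\infty$ is the $L^\infty$-norm with respect to Lebesgue measure; $\|\nabla f\|_{L^1(U)}$ is with respect to Lebesgue measure. For a function $g$ and open $U$, $$\|g\|_{BV_\mu(U)}:=\sup\left\{\int_{U}g\big(\operatorname{div}(\phi)f+\phi\cdot\nabla f\big)\,dx:\ \phi\in C^1_c(U;\mathbb{R}^n),\ \|\phi\|_\infty\le 1\right\}\in[0,\infty],$$ and $g\in BV_\mu(U)$ iff this quantity is finite. $\|Dg\|(U)$ denotes $\|g\|_{BV_\mu(U)}$ (it is the total mass on $U$ of the variation measure $\|Dg\|_\mu$ of $g$). *)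

(* Defs.v *)
From HB Require Import structures.
From mathcomp Require Import all_boot all_order all_algebra.
From mathcomp Require Import all_classical all_reals all_analysis.

Set Implicit Arguments.
Unset Strict Implicit.
Unset Printing Implicit Defensive.

Import Order.TTheory GRing.Theory Num.Theory.
Import numFieldNormedType.Exports.

Local Open Scope classical_set_scope.
Local Open Scope ring_scope.

(** * Lebesgue measure on R^n

R^n is ['rV[R]_n], with the product topology of the library and the
sigma-algebra generated by the coordinates (as the library does for
[n.-tuple]), which is the Borel sigma-algebra.  As with the library's
[lebesgue_measure], functions are thus Borel functions; classes of
Lebesgue-measurable functions modulo null sets all have such a member. *)

Definition rV_display : measure_display -> measure_display.
Proof. exact. Qed.

Section measurable_rV.
Context (R : realType) (n : nat).

Definition rVcoord (i : 'I_n) (v : 'rV[R]_n) : R := v ord0 i.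

Let rV_set0 : g_sigma_preimage rVcoord set0.
Proof. exact: sigma_algebra0. Qed.

Let rV_setC A : g_sigma_preimage rVcoord A -> g_sigma_preimage rVcoord (~` A).
Proof. exact: sigma_algebraC. Qed.

Let rV_bigcup (F : _^nat) : (forall i, g_sigma_preimage rVcoord (F i)) ->
  g_sigma_preimage rVcoord (\bigcup_i (F i)).
Proof. exact: sigma_algebra_bigcup. Qed.

HB.instance Definition _ := @isMeasurable.Build (rV_display default_measure_display)
  'rV[R]_n (g_sigma_preimage rVcoord) rV_set0 rV_setC rV_bigcup.

Lemma measurable_rVcoord i : measurable_fun [set: 'rV[R]_n] (rVcoord i).
Proof.
move=> _ Y mY; rewrite setTI; apply: sub_sigma_algebra => /=.
rewrite -bigcup_seq/=; exists i => /=; first by rewrite mem_index_enum.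
by exists Y => //; rewrite setTI.
Qed.

Lemma measurable_fun_rVP d (T : measurableType d) (f : T -> 'rV[R]_n) :
  (forall i, measurable_fun [set: T] (rVcoord i \o f)) ->
  measurable_fun [set: T] f.
Proof.
move=> mf _ A mA; rewrite setTI.
have : preimage_set_system setT f (g_sigma_preimage rVcoord) (f @^-1` A).
  by exists A => //; rewrite setTI.
rewrite -g_sigma_preimageE.
apply: smallest_sub; first exact: sigma_algebra_measurable.
move=> _ [B + <-]; rewrite -bigcup_seq => -[i _ [C mC <-]].
by rewrite !setTI -comp_preimage -[X in measurable X]setTI; exact: mf.
Qed.

End measurable_rV.

Section lebesgue_rV.
Context (R : realType).

Definition rVcons n (p : measurableTypeR R * 'rV[R]_n) : 'rV[R]_n.+1 :=
  \row_j if unlift ord0 j is Some k then p.2 ord0 k else p.1.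

Definition rVuncons n (v : 'rV[R]_n.+1) : measurableTypeR R * 'rV[R]_n :=
  (v ord0 ord0, \row_k v ord0 (lift ord0 k)).

Lemma rVconsK n : cancel (@rVcons n) (@rVuncons n).
Proof.
move=> [x v]; rewrite /rVuncons !mxE unlift_none; congr (_, _).
by apply/rowP => k; rewrite !mxE liftK.
Qed.

Lemma measurable_rVcons n : measurable_fun [set: measurableTypeR R * 'rV[R]_n] (@rVcons n).
Proof.
apply: measurable_fun_rVP => i.
rewrite (_ : _ \o _ = fun p : measurableTypeR R * 'rV[R]_n =>
    if unlift ord0 i is Some k then rVcoord k p.2 else p.1); last first.
  by apply/funext => p; rewrite /rVcoord/= mxE.
case: unliftP => [k _|_]; last exact: measurable_fst.
by apply: measurableT_comp (measurable_rVcoord k) _.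
Qed.

Lemma measurable_rVuncons n : measurable_fun [set: 'rV[R]_n.+1] (@rVuncons n).
Proof.
apply/measurable_fun_pair; first exact: (measurable_rVcoord ord0).
apply: measurable_fun_rVP => i.
rewrite (_ : _ \o _ = rVcoord (lift ord0 i)); first exact: measurable_rVcoord.
by apply/funext => v; rewrite /rVcoord/= mxE.
Qed.

Section step.
Context (n : nat) (m : {sigma_finite_measure set 'rV[R]_n -> \bar R}).

Definition lebesgue_rV_step : set 'rV[R]_n.+1 -> \bar R :=
  pushforward (@lebesgue_measure R \x m)%E (@rVcons n).

HB.instance Definition _ := Measure.copy lebesgue_rV_step
  (measure_function_pushforward__canonical__measure_function_Measure
     (@lebesgue_measure R \x m)%E (@measurable_rVcons n)).

Let lebesgue_rV_step_sigma_finite : sigma_finite setT lebesgue_rV_step.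
Proof.
have /sigma_finiteP[F [TF ndF Foo]] := sigma_finiteT (@lebesgue_measure R).
have /sigma_finiteP[G [TG ndG Goo]] := sigma_finiteT m.
exists (fun k => @rVuncons n @^-1` (F k `*` G k)).
  rewrite -preimage_bigcup [X in _ @^-1` X](_ : _ = setT) ?preimage_setT//.
  apply/seteqP; split => // -[x y] _.
  have [i _ Fi] : (\bigcup_i F i) x by rewrite -TF.
  have [j _ Gj] : (\bigcup_i G i) y by rewrite -TG.
  exists (maxn i j) => //; split => /=.
    by move: x Fi; exact/subsetPset/ndF/leq_maxl.
  by move: y Gj; exact/subsetPset/ndG/leq_maxr.
move=> k; have [mFk Fkoo] := Foo k; have [mGk Gkoo] := Goo k; split.
  rewrite -[X in measurable X]setTI; apply: measurable_rVuncons => //.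
  exact: measurableX.
rewrite /lebesgue_rV_step /pushforward -comp_preimage.
rewrite (_ : _ \o _ = id); last by apply/funext => p /=; exact: rVconsK.
by rewrite preimage_id product_measure1E// lte_mul_pinfty// ge0_fin_numE.
Qed.

HB.instance Definition _ := Measure_isSigmaFinite.Build _ _ _ lebesgue_rV_step
  lebesgue_rV_step_sigma_finite.

End step.

(** Lebesgue measure on R^n, as the n-fold product of [lebesgue_measure]. *)
Fixpoint lebesgue_rV (n : nat) : {sigma_finite_measure set 'rV[R]_n -> \bar R} :=
  if n is k.+1 then lebesgue_rV_step (lebesgue_rV k) else \d_(0 : 'rV[R]_0).

Lemma measurable_rV_box n (A : 'I_n -> set R) : (forall i, measurable (A i)) ->
  measurable [set v : 'rV[R]_n | forall i, A i (v ord0 i)].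
Proof.
move=> mA; rewrite (_ : [set _ | _] = \big[setI/setT]_(i < n)
    (rVcoord i @^-1` A i)).
  apply: bigsetI_measurable => i _.
  by rewrite -[X in measurable X]setTI; exact: measurable_rVcoord.
apply/seteqP; split => [v h|v]; rewrite -bigcap_seq /=.
  by move=> i _; exact: h.
by move=> h i; apply: h => /=; rewrite mem_index_enum.
Qed.

Lemma lebesgue_rV_box n (A : 'I_n -> set R) : (forall i, measurable (A i)) ->
  lebesgue_rV n [set v | forall i, A i (v ord0 i)] =
  (\prod_(i < n) lebesgue_measure (A i))%E.
Proof.
elim: n A => [A _|n IH A mA].
  by rewrite big_ord0 /= diracE mem_set//=; case.
rewrite big_ord_recl/= /lebesgue_rV_step /pushforward.
rewrite (_ : _ @^-1` _ = A ord0 `*`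
    [set v : 'rV_n | forall i, A (lift ord0 i) (v ord0 i)]); last first.
  apply/seteqP; split => [[x v]/= h|[x v]/= [Ax Av] i].
    split => [|i]; first by have := h ord0; rewrite mxE unlift_none.
    by have := h (lift ord0 i); rewrite mxE liftK.
  by rewrite mxE; case: unliftP => [j ->|->].
have mA' i : measurable (A (lift ord0 i)) by exact: mA.
have mA0 : measurable (A ord0 : set (measurableTypeR R)) by exact: mA.
rewrite product_measure1E//=; last first.
  exact: (@measurable_rV_box _ (fun i => A (lift ord0 i))).
by congr (_ * _)%E; exact: (IH (fun i => A (lift ord0 i))).
Qed.

End lebesgue_rV.

(** * Euclidean norm, L^oo and L^1_loc

The norm [`|v|] of ['rV[R]_n] in the library is the sup norm. *)

Section euclidean.
Context (R : realType) (n : nat).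
Implicit Types (v x : 'rV[R]_n) (U : set 'rV[R]_n).

Definition enorm v : R := Num.sqrt (\sum_(i < n) v ord0 i ^+ 2).

Definition eball x (r : R) : set 'rV[R]_n := [set y | enorm (y - x) < r].

Definition normLinf U (h : 'rV[R]_n -> R) : \bar R :=
  ('N[lebesgue_rV R n]_+oo[EFin \o (h \_ U)])%E.

Definition Linf U (h : 'rV[R]_n -> R) : Prop :=
  measurable_fun U h /\ (normLinf U h < +oo)%E.

Definition L1loc (mu : {measure set 'rV[R]_n -> \bar R}) U
    (h : 'rV[R]_n -> R) : Prop :=
  forall K, compact K -> K `<=` U -> mu.-integrable K (EFin \o h).

(** Convergence of a family [(h_ e)_(e > 0)] as [e -> 0]. *)
Definition cvg_L1 (mu : {measure set 'rV[R]_n -> \bar R}) U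
    (h_ : R -> 'rV[R]_n -> R) (h : 'rV[R]_n -> R) : Prop :=
  [/\ forall e, 0 < e -> mu.-integrable U (EFin \o h_ e),
      mu.-integrable U (EFin \o h) &
      (\int[mu]_(x in U) `|h_ e x - h x|%:E)%E @[e --> 0^'+] --> 0%E].

Definition cvg_L1loc (mu : {measure set 'rV[R]_n -> \bar R}) U
    (h_ : R -> 'rV[R]_n -> R) (h : 'rV[R]_n -> R) : Prop :=
  forall K, compact K -> K `<=` U -> cvg_L1 mu K h_ h.

End euclidean.

(** * Differentiability classes on an open set *)

Section smoothness.
Context (R : realType) (n : nat).
Implicit Types U : set 'rV[R]_n.

Definition ebase (i : 'I_n) : 'rV[R]_n := delta_mx ord0 i.

(** [C^k(U)] for open [U], through iterated partial derivatives. *)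
Fixpoint Ck (W : normedModType R) (k : nat) U (h : 'rV[R]_n -> W) : Prop :=
  (forall x, U x -> {for x, continuous h}) /\
  if k is k'.+1 then
    forall i, (forall x, U x -> derivable h x (ebase i)) /\
      Ck k' U ('D_(ebase i) h)
  else True.

Definition smooth (W : normedModType R) U (h : 'rV[R]_n -> W) : Prop :=
  forall k, Ck k U h.

(** [C^1_c(U; W)], the functions being extended by [0] outside [U]. *)
Definition C1c (W : normedModType R) U (h : 'rV[R]_n -> W) : Prop :=
  [/\ Ck 1%N setT h, compact (closure [set x | h x != 0]) &
      closure [set x | h x != 0] `<=` U].

Definition divergence (phi : 'rV[R]_n -> 'rV[R]_n) (x : 'rV[R]_n) : R :=
  \sum_(i < n) 'D_(ebase i) phi x ord0 i.

End smoothness.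
Arguments ebase {R n} i.

(** * Sobolev functions and the class W(R^n) *)

Section sobolev.
Context (R : realType) (n : nat).
Implicit Types (f : 'rV[R]_n -> R) (G : 'rV[R]_n -> 'rV[R]_n).
Local Notation leb := (lebesgue_rV R n).

Definition is_weak_grad f G : Prop :=
  (forall i, L1loc leb setT (fun x => G x ord0 i)) /\
  forall i (psi : 'rV[R]_n -> R), C1c setT psi ->
    (\int[leb]_x (f x * 'D_(ebase i) psi x)%:E =
     - \int[leb]_x (G x ord0 i * psi x)%:E)%E.

Definition W11loc f : Prop := L1loc leb setT f /\ exists G, is_weak_grad f G.

(** A weak gradient of [f] if there is one; it is unique up to a null set, and
the notions below only depend on its almost-everywhere class. *)
Definition weak_grad f : 'rV[R]_n -> 'rV[R]_n :=
  xget (fun=> 0) [set G | is_weak_grad f G].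

Definition ball_avg f x (r : R) : R :=
  (fine (leb (eball x r)))^-1 * \int[leb]_(y in eball x r) f y.

Definition precise_rep f (x : 'rV[R]_n) : R :=
  if `[< cvg (ball_avg f x r @[r --> 0^'+]) >]
  then lim (ball_avg f x r @[r --> 0^'+]) else 0.

Definition in_W (mu : {measure set 'rV[R]_n -> \bar R}) f : Prop :=
  [/\ forall A, measurable A -> mu A = (\int[leb]_(x in A) (f x)%:E)%E,
      forall x, 0 <= f x,
      leb.-integrable setT (EFin \o f),
      W11loc f &
      forall x, f x = precise_rep f x].

End sobolev.

(** * Weighted functions of bounded variation *)

Section weighted_BV.
Context (R : realType) (n : nat).
Implicit Types (f g : 'rV[R]_n -> R) (U : set 'rV[R]_n).
Local Notation leb := (lebesgue_rV R n).

Definition BVnorm f U g : \bar R :=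
  ereal_sup [set (\int[leb]_(x in U)
      (g x * (divergence phi x * f x +
              \sum_(i < n) phi x ord0 i * weak_grad f x ord0 i))%:E)%E |
    phi in [set phi : 'rV[R]_n -> 'rV[R]_n |
      C1c U phi /\ (normLinf U (fun x => enorm (phi x)) <= 1)%E]].

Definition BV f U g : Prop := measurable_fun U g /\ (BVnorm f U g < +oo)%E.

End weighted_BV.

(* Main.v *)
Require Import Defs.
From mathcomp Require Import all_boot all_order all_algebra.
From mathcomp Require Import all_classical all_reals all_analysis.
From mathcomp Require Import measurable_realfun ess_sup_inf.
From mathcomp Require Import ring lra.

(** The approximation is a mollification whose scale shrinks towards the boundary of U.  Write
g = sum_j zeta_j g, where the zeta_j form a smooth partition of unity of U (times a cutoff near
infinity) whose j-th member lives at distance about 4^-j from the complement of U, and set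
h = sum_j rho_j * (zeta_j g) with mollifiers rho_j of scale d_j.  Near every point of U only
finitely many terms are nonzero, so that h is smooth; and every kind of error is made smaller
than tau 2^-j by taking d_j small enough.

For the variation let phi be an admissible field, L_k = d_k phi_k f + phi_k G_k with G the weak
gradient of f, and T_j = rho_j * _.  The kernel is even, so
int h (f div phi + G . phi) = sum_(j,k) int zeta_j g T_j L_k.  Since G is a weak gradient,
integrating by parts inside the convolution gives T_j L_k = f d_k (T_j phi_k) + Q_(j,k), with
Q_(j,k) (y) = int d_k rho_j (y - x) phi_k (x) (f x - f y) dx.  With psi_(j,k) = zeta_j T_j phi_k,
  zeta_j f d_k (T_j phi_k) =
    (f d_k psi_(j,k) + psi_(j,k) G_k) - f d_k zeta_j T_j phi_k - psi_(j,k) G_k,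
and the terms are estimated as follows, M being a bound of |g|.
- The field sum_j psi_(j, _) is compactly supported in U and of length at most 1, by convexity of
  the square, so the first bracket contributes at most the weighted variation of g.
- In the second term T_j phi_k may be replaced by phi_k up to small errors, by moving T_j onto the
  integrable function g f d_k zeta_j.  Then the sum over j of d_k zeta_j telescopes to the
  derivative of the cutoff at infinity, where f has little mass.
- The third term is at most M int zeta_j |G_k|.
- The commutator Q costs a constant times M sum_i int zeta_j |G_i|: the total mass of |d_k rho_j|
  is at most C / d_j, while the difference of f and its translate by |z| <= d_j, integrated
  against a bounded function, is of size d_j times an integral of |G|.
Summing over j, the last two terms give C(n) M int_U |G|.

[mollified_piece] is the identity for one pair (j, k), [sobolev_diff] the estimate on translates,
[approx_variation] the sum over j and k, and [smooth_approximation] adds the choice of the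
constants.  The theorem then follows by passing from measurable functions bounded almost
everywhere, and fields bounded almost everywhere, to functions and fields bounded everywhere. *)

Set Implicit Arguments.
Unset Strict Implicit.
Unset Printing Implicit Defensive.

Import Order.TTheory GRing.Theory Num.Theory.
Import numFieldNormedType.Exports.

Local Open Scope classical_set_scope.
Local Open Scope ring_scope.

(** * Borel sets and Lebesgue measure of R^n *)

Section borel.
Context (R : realType) (n : nat).

Lemma coord_le_norm (v : 'rV[R]_n) i : `|v ord0 i| <= `|v|.
Proof.
rewrite [leRHS]/Num.Def.normr/= mx_normrE.
by apply: le_trans; last exact: (le_bigmax _ (fun ij : 'I_1 * 'I_n => `|v ij.1 ij.2|) (ord0, i)).
Qed.

Lemma norm_le_coord (v : 'rV[R]_n) r : 0 <= r ->
  (forall i, `|v ord0 i| <= r) -> `|v| <= r.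
Proof.
move=> r0 h; rewrite [leLHS]/Num.Def.normr/= mx_normrE.
by apply: bigmax_le => // -[i j] _ /=; rewrite (ord1 i).
Qed.

Definition cube (r : R) : set 'rV[R]_n := [set v | forall i, `|v ord0 i| <= r].

Lemma measurable_fun_rV_comp d (T : measurableType d) (p q : T -> 'rV[R]_n) :
  measurable_fun setT p -> measurable_fun setT q ->
  measurable_fun setT (fun t => p t - q t) /\
  measurable_fun setT (fun t => p t + q t).
Proof.
move=> mp mq; split; apply: measurable_fun_rVP => i.
  rewrite (_ : _ \o _ = (rVcoord i \o p) \- (rVcoord i \o q)); last first.
    by apply/funext => t; rewrite /rVcoord/= !mxE.
  by apply: measurable_funB; apply: measurableT_comp => //;
    exact: measurable_rVcoord.
rewrite (_ : _ \o _ = (rVcoord i \o p) \+ (rVcoord i \o q)); last first.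
  by apply/funext => t; rewrite /rVcoord/= !mxE.
by apply: measurable_funD; apply: measurableT_comp => //;
  exact: measurable_rVcoord.
Qed.

(** The sigma-algebra is generated by the coordinates, so openness is turned into measurability
through a countable base: the sup-norm balls with rational centres and radii 1 / (k + 1). *)
Lemma open_measurable_rV (U : set 'rV[R]_n) : open U -> measurable U.
Proof.
move=> oU.
pose B (p : 'rV[rat]_n * nat) : set 'rV[R]_n :=
  [set v | forall i, ball (ratr (p.1 ord0 i) : R) p.2.+1%:R^-1 (v ord0 i)].
have mB p : measurable (B p).
  apply: (@measurable_rV_box _ _ (fun i => ball (ratr (p.1 ord0 i) : R) _)).
  by move=> i; exact: measurable_ball.
have -> : U = \bigcup_p (if `[< B p `<=` U >] then B p else set0).
  apply/seteqP; split => [x Ux|x [p _]]; last by case: asboolP => // pU; exact: pU.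
  have /nbhs_ballP[e /= e0 eU] := oU _ Ux.
  have [k ke] : exists k : nat, 2 * k.+1%:R^-1 < e.
    have [k _ /(_ k (leqnn k)) kP] :=
      near_infty_natSinv_lt (PosNum (divr_gt0 e0 (ltr0n R 2))).
    by exists k; rewrite mulrC -ltr_pdivlMr//; exact: kP.
  have k0 : (0 : R) < k.+1%:R^-1 by rewrite invr_gt0.
  move: ke k0; rewrite /B/=; set d := (k.+1%:R^-1 : R) => ke k0.
  have /choice[q qP] (i : 'I_n) : exists q : rat,
      ball (ratr q : R) d (x ord0 i).
    have xd : x ord0 i - d < x ord0 i + d by lra.
    have [q] := rat_in_itvoo xd.
    rewrite in_itv/= => /andP[q1 q2]; exists q.
    by rewrite /ball/= ltr_norml; lra.
  exists (\row_i q i, k) => //; rewrite asboolT => [i /=|y /= yB]; first by rewrite mxE; exact: qP.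
  apply: eU; rewrite mx_norm_ball/=.
  apply: le_lt_trans ke; apply: norm_le_coord; first by rewrite mulr_ge0// ltW.
  move=> i; rewrite !mxE.
  have := yB i; have := qP i; rewrite /ball/= mxE => h1 h2.
  move: h1 h2; rewrite ltr_norml [`|_| < _]ltr_norml -/d => /andP[h1 h2] /andP[h3 h4].
  by rewrite ler_norml; apply/andP; split; lra.
apply: countable_bigcupT_measurable; first exact: countableP.
by move=> p; case: asboolP => _; [exact: mB|exact: measurable0].
Qed.

Lemma continuous_measurable_rV (h : 'rV[R]_n -> R) :
  continuous h -> measurable_fun setT h.
Proof.
move=> ch; apply: (measurability _ (RGenOInfty.measurableE R)).
move=> /= _ [_ [a ->]] <-; rewrite setTI; apply: open_measurable_rV.
by apply: open_comp => // x _; exact: ch.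
Qed.

End borel.

Section translation1.
Context (R : realType).
Local Open Scope ereal_scope.

(** The push-forward of Lebesgue measure by a translation agrees with Lebesgue measure on
intervals, hence everywhere by uniqueness. *)
Lemma ge0_integral_translation1 (F : measurableTypeR R -> \bar R) (a : R) :
  measurable_fun setT F -> (forall x, 0 <= F x) ->
  \int[lebesgue_measure]_x F (x + a)%R = \int[lebesgue_measure]_x F x.
Proof.
move=> mF F0.
have mt : measurable_fun [set: measurableTypeR R] (fun x : measurableTypeR R => (x + a)%R : measurableTypeR R).
  by apply: measurable_funD => //; exact: measurable_id.
pose nu := pushforward (@lebesgue_measure R) (fun x : measurableTypeR R => (x + a)%R : measurableTypeR R).
transitivity (\int[nu]_x F x).
  by rewrite ge0_integral_pushforward.
apply: eq_measure_integral => A mA _; apply/esym/lebesgue_measure_unique => //.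
move=> X /ocitvP[->|[[u v]/= uv ->]]; first by rewrite !measure0.
rewrite /pushforward lebesgue_measure_itv/= lte_fin uv.
rewrite (_ : _ @^-1` _ = `](u - a)%R, (v - a)%R]%classic); last first.
  by apply/seteqP; split => x /=; rewrite !in_itv/= => /andP[h1 h2]; lra.
rewrite lebesgue_measure_itv/= lte_fin ltrD2r uv -!EFinD; congr (_%:E); lra.
Qed.

End translation1.

Section translation.
Context (R : realType).
Local Open Scope ereal_scope.

(** Tonelli along the first coordinate, which is how the measure on R^(n+1) is built; it allows
induction on the dimension. *)
Lemma ge0_integral_rVS n (F : 'rV[R]_n.+1 -> \bar R) :
  measurable_fun setT F -> (forall x, 0 <= F x) ->
  \int[lebesgue_rV R n.+1]_w F w =
  \int[lebesgue_measure]_x \int[lebesgue_rV R n]_v F (rVcons (x, v)).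
Proof.
move=> mF F0.
transitivity (\int[(@lebesgue_measure R \x lebesgue_rV R n)]_p F (rVcons p)).
  rewrite -[RHS](@ge0_integral_pushforward _ _ _ _ _ _ (@measurable_rVcons R n) _ setT F)//.
rewrite fubini_tonelli1//.
by apply: measurableT_comp => //; exact: measurable_rVcons.
Qed.

Lemma measurable_rVconsr n x : measurable_fun setT (fun v : 'rV[R]_n => rVcons (x, v)).
Proof. by apply: measurableT_comp; [exact: measurable_rVcons|exact: measurable_pair1]. Qed.

Lemma measurable_addrV n (a : 'rV[R]_n) : measurable_fun setT (fun v : 'rV[R]_n => (v + a)%R).
Proof. by apply: (measurable_fun_rV_comp _ _).2; [exact: measurable_id|exact: measurable_cst]. Qed.

Lemma ge0_integral_translation n (F : 'rV[R]_n -> \bar R) (a : 'rV[R]_n) :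
  measurable_fun setT F -> (forall x, 0 <= F x) ->
  \int[lebesgue_rV R n]_x F (x + a)%R = \int[lebesgue_rV R n]_x F x.
Proof.
elim: n F a => [F a _ _|n IH F a mF F0].
  by apply: eq_integral => x _; congr (F _); apply/rowP => -[].
have mFa : measurable_fun setT (fun w : 'rV[R]_n.+1 => F (w + a)%R).
  by apply: measurableT_comp => //; exact: measurable_addrV.
rewrite (ge0_integral_rVS mFa); last by [].
rewrite (ge0_integral_rVS mF); last by [].
rewrite -[RHS](@ge0_integral_translation1 _ _ (a ord0 ord0)); last 2 first.
- apply: (@measurable_fun_fubini_tonelli_F _ _ _ _ _ (lebesgue_rV R n) (F \o @rVcons R n)) => //=.
  by apply: measurableT_comp => //; exact: measurable_rVcons.
- by move=> x; apply: integral_ge0.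
apply: eq_integral => x _.
rewrite -[RHS](IH _ (\row_k a ord0 (lift ord0 k))%R); last 2 first.
- by apply: measurableT_comp => //; exact: measurable_rVconsr.
- by [].
apply: eq_integral => v _; congr (F _); apply/rowP => j; rewrite !mxE.
by case: unliftP => [k ->|->]//; rewrite !mxE.
Qed.

Lemma integral_translation n (F : 'rV[R]_n -> \bar R) (a : 'rV[R]_n) :
  (lebesgue_rV R n).-integrable setT F ->
  \int[lebesgue_rV R n]_x F (x + a)%R = \int[lebesgue_rV R n]_x F x /\
  (lebesgue_rV R n).-integrable setT (fun x => F (x + a)%R).
Proof.
move=> iF; have mF : measurable_fun setT F by exact: measurable_int iF.
have mta := measurable_addrV a; split.
  rewrite integralE [RHS]integralE; congr (_ - _).
    rewrite -(@ge0_integral_translation _ (F^\+)%E a)//; last exact: measurable_funepos.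
    by apply: eq_integral => x _; rewrite (funepos_comp F (fun x => x + a)%R).
  rewrite -(@ge0_integral_translation _ (F^\-)%E a)//; last exact: measurable_funeneg.
  by apply: eq_integral => x _; rewrite (funeneg_comp F (fun x => x + a)%R).
apply/integrableP; split; first exact: measurableT_comp.
rewrite (@ge0_integral_translation _ (abse \o F)); [by case/integrableP: iF|by apply: measurableT_comp|by move=> x; exact: abse_ge0].
Qed.

Lemma lebesgue_rV_cube n (r : R) : (0 <= r)%R ->
  lebesgue_rV R n (@cube R n r) = ((2 * r) ^+ n)%:E.
Proof.
move=> r0; rewrite (lebesgue_rV_box (A := fun=> [set x | `|x| <= r]%R)); last first.
  move=> i; rewrite (_ : [set _ | _] = `[(-r)%R, r]%classic) ?measurable_itv//.
  by apply/seteqP; split => x /=; rewrite in_itv/= ler_norml.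
rewrite (eq_bigr (fun=> (2 * r)%:E)); last first.
  move=> i _; rewrite (_ : [set _ | _] = `[(-r)%R, r]%classic); last first.
    by apply/seteqP; split => x /=; rewrite in_itv/= ler_norml.
  rewrite lebesgue_measure_itv/= lte_fin.
  case: ltP => h; first by rewrite -EFinD; congr (_%:E); lra.
  by congr (_%:E); lra.
by rewrite prodEFin prodr_const card_ord.
Qed.

Lemma measurable_cube n (r : R) : measurable (@cube R n r).
Proof.
apply: (measurable_rV_box (A := fun=> [set x | `|x| <= r]%R)) => i.
rewrite (_ : [set _ | _] = `[(-r)%R, r]%classic) ?measurable_itv//.
by apply/seteqP; split => x /=; rewrite in_itv/= ler_norml.
Qed.

End translation.

(** * Integrable real functions on R^n *)

Section L1.
Context (R : realType) (n : nat).
Local Notation leb := (lebesgue_rV R n).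
Local Notation E := 'rV[R]_n.
Implicit Types b v w : E -> R.

Definition L1 w : Prop := leb.-integrable setT (EFin \o w).

Definition intR w : R := (\int[leb]_x w x)%R.

Lemma L1_measurable w : L1 w -> measurable_fun setT w.
Proof. by move=> /(measurable_int leb)/measurable_EFinP. Qed.

Lemma L1_EFin w : L1 w -> (\int[leb]_x (w x)%:E)%E = (intR w)%:E.
Proof. by move=> iw; rewrite /intR /Rintegral fineK//; exact: integrable_fin_num. Qed.

Lemma L1_0 : L1 (fun=> 0). Proof. exact: integrable0. Qed.

Lemma L1D v w : L1 v -> L1 w -> L1 (fun x => v x + w x).
Proof. by move=> iv iw; apply: (integrableD measurableT iv iw). Qed.

Lemma L1B v w : L1 v -> L1 w -> L1 (fun x => v x - w x).
Proof. by move=> iv iw; apply: (integrableB measurableT iv iw). Qed.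

Lemma L1Z (a : R) w : L1 w -> L1 (fun x => a * w x).
Proof. by move=> iw; apply: (integrableZl measurableT a iw). Qed.

Lemma L1N w : L1 w -> L1 (fun x => - w x).
Proof. by move=> iw; apply: (integrableN iw). Qed.

Lemma L1_norm w : L1 w -> L1 (fun x => `|w x|).
Proof. exact: integrable_norm. Qed.

Lemma L1_sum I (s : seq I) (w : I -> E -> R) :
  (forall i, L1 (w i)) -> L1 (fun x => \sum_(i <- s) w i x).
Proof.
move=> iw; elim: s => [|i s IH].
  rewrite (_ : (fun _ => _) = fun=> 0); first exact: L1_0.
  by apply/funext => x; rewrite big_nil.
rewrite (_ : (fun _ => _) = fun x => w i x + \sum_(i <- s) w i x).
  exact: L1D.
by apply/funext => x; rewrite big_cons.
Qed.

Lemma L1_le (v w : E -> R) : measurable_fun setT v -> (forall x, `|v x| <= w x) ->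
  L1 w -> L1 v.
Proof.
move=> mv vw; apply: le_integrable => //; first exact/measurable_EFinP.
by move=> x _; rewrite /= lee_fin (le_trans (vw x))// ler_norm.
Qed.

Lemma L1M (B : R) (b w : E -> R) : measurable_fun setT b -> (forall x, `|b x| <= B) ->
  L1 w -> L1 (fun x => b x * w x).
Proof.
move=> mb bB iw; apply: (@L1_le _ (fun x => B * `|w x|)); last exact/L1Z/L1_norm.
  by apply: measurable_funM => //; exact: L1_measurable.
by move=> x; rewrite normrM ler_wpM2r.
Qed.

Lemma eq_intR v w : v =1 w -> intR v = intR w.
Proof. by move=> /funext ->. Qed.

Lemma intR0 : intR (fun=> 0) = 0.
Proof. by rewrite /intR Rintegral_cst// mul0r. Qed.

Lemma intRD v w : L1 v -> L1 w -> intR (fun x => v x + w x) = intR v + intR w.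
Proof. by move=> iv iw; rewrite /intR RintegralD. Qed.

Lemma intRB v w : L1 v -> L1 w -> intR (fun x => v x - w x) = intR v - intR w.
Proof. by move=> iv iw; rewrite /intR RintegralB. Qed.

Lemma intRZ (a : R) w : L1 w -> intR (fun x => a * w x) = a * intR w.
Proof. by move=> iw; rewrite /intR RintegralZl. Qed.

Lemma intRN w : L1 w -> intR (fun x => - w x) = - intR w.
Proof.
move=> iw; rewrite -mulN1r -intRZ//; apply: eq_intR => x; exact/esym/mulN1r.
Qed.

Lemma intR_sum I (s : seq I) (w : I -> E -> R) : (forall i, L1 (w i)) ->
  intR (fun x => \sum_(i <- s) w i x) = \sum_(i <- s) intR (w i).
Proof.
move=> iw; elim: s => [|i s IH].
  by rewrite big_nil -[RHS]intR0; apply: eq_intR => x; rewrite big_nil.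
rewrite big_cons -IH -intRD//; last exact: L1_sum.
by apply: eq_intR => x; rewrite big_cons.
Qed.

Lemma le_intR v w : L1 v -> L1 w -> (forall x, v x <= w x) -> intR v <= intR w.
Proof. by move=> iv iw vw; apply: le_Rintegral. Qed.

Lemma intR_ge0 w : (forall x, 0 <= w x) -> 0 <= intR w.
Proof. by move=> w0; apply: Rintegral_ge0. Qed.

Lemma le_norm_intR w : L1 w -> `|intR w| <= intR (fun x => `|w x|).
Proof. by move=> iw; apply: le_normr_Rintegral. Qed.

Lemma norm_intR_le v w : L1 v -> L1 w -> (forall x, `|v x| <= w x) ->
  `|intR v| <= intR w.
Proof.
by move=> iv iw vw; apply: (le_trans (le_norm_intR iv)); apply: le_intR => //; exact: L1_norm.
Qed.

Lemma L1_translation w (a : E) : L1 w -> L1 (fun x => w (x + a)).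
Proof. by move=> iw; exact: (integral_translation a iw).2. Qed.

Lemma intR_translation w (a : E) : L1 w -> intR (fun x => w (x + a)) = intR w.
Proof.
by move=> iw; rewrite /intR /Rintegral (integral_translation a iw).1.
Qed.

Lemma L1_cube r : L1 (\1_(@cube R n r)).
Proof.
apply/integrableP; split.
  by apply/measurable_EFinP/measurable_indic; exact: measurable_cube.
rewrite (eq_integral (EFin \o \1_(@cube R n r))); last first.
  by move=> x _ /=; rewrite ger0_norm.
rewrite integral_indic ?setIT//; last exact: measurable_cube.
have [r0|r0] := leP 0 r.
  by rewrite -[X in (X < _)%E]/(lebesgue_rV R n (cube r)) lebesgue_rV_cube ?ltry.
case: n => [|m]; first by rewrite /= diracE; case: (_ \in _); rewrite ltry.
rewrite (_ : cube r = set0) ?measure0//.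
apply/seteqP; split => // v /(_ ord0); rewrite leNgt => /negP; apply.
exact: lt_le_trans r0 _.
Qed.

Lemma intR_cube r : 0 <= r -> intR (\1_(@cube R n r)) = (2 * r) ^+ n.
Proof.
move=> r0; rewrite /intR /Rintegral integral_indic//; last exact: measurable_cube.
by rewrite setIT -[X in fine X]/(lebesgue_rV R n (cube r)) lebesgue_rV_cube.
Qed.

Lemma L1_bounded_cube (B r : R) (b : E -> R) : measurable_fun setT b ->
  (forall x, `|b x| <= B) -> (forall x, b x != 0 -> cube r x) -> L1 b.
Proof.
move=> mb bB bs; apply: (@L1_le _ (fun x => B * \1_(@cube R n r) x)) => //; last first.
  exact/L1Z/L1_cube.
move=> x; rewrite indicE; have [->|/bs/mem_set->] := eqVneq (b x) 0; last by rewrite mulr1.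
by rewrite normr0 mulr_ge0//; apply: le_trans (bB x).
Qed.

Definition L1loc_rV w := forall r, L1 (fun x => \1_(@cube R n r) x * w x).

Lemma measurable_1cube r : measurable_fun setT (\1_(@cube R n r) : E -> R).
Proof. apply: measurable_indic; exact: measurable_cube. Qed.

Lemma L1M_loc (B r : R) (b w : E -> R) : measurable_fun setT b -> (forall x, `|b x| <= B) ->
  (forall x, b x != 0 -> cube r x) -> L1loc_rV w -> L1 (fun x => b x * w x).
Proof.
move=> mb bB bs lw; rewrite (_ : (fun x => _) = (fun x => b x * (\1_(@cube R n r) x * w x))).
  by apply: (L1M mb bB); exact: lw.
apply/funext => x; rewrite indicE.
by have [->|/bs/mem_set->] := eqVneq (b x) 0; rewrite ?mul0r// mul1r.
Qed.

(** Fubini in the form used for kernels: joint measurability together with an integrable bound of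
the inner absolute integrals gives joint integrability. *)
Lemma fubini_intR (F : E * E -> R) (H : E -> R) : measurable_fun setT F ->
  (forall x, L1 (fun y => F (x, y))) -> (forall y, L1 (fun x => F (x, y))) ->
  L1 H -> (forall x, intR (fun y => `|F (x, y)|) <= H x) ->
  [/\ L1 (fun x => intR (fun y => F (x, y))),
      L1 (fun y => intR (fun x => F (x, y))) &
      intR (fun x => intR (fun y => F (x, y))) = intR (fun y => intR (fun x => F (x, y)))].
Proof.
move=> mF iF1 iF2 iH FH.
have mF' : measurable_fun setT (EFin \o F) by exact/measurable_EFinP.
have iF : (leb \x leb)%E.-integrable setT (EFin \o F).
  apply/integrable12ltyP => //.
  have /integrableP[_] := iH; apply: le_lt_trans; apply: ge0_le_integral => //.
  - by move=> x _; exact: integral_ge0.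
  - apply: (@measurable_fun_fubini_tonelli_F _ _ _ _ _ leb (abse \o (EFin \o F))) => //=.
    exact: measurableT_comp.
  - by apply/measurable_EFinP/measurableT_comp => //; exact: L1_measurable.
  - move=> x _ /=; rewrite (@L1_EFin (fun y => `|F (x, y)|)) ?lee_fin; last exact/L1_norm.
    exact: le_trans (FH x) (ler_norm _).
have e1 : fubini_F leb (EFin \o F) = EFin \o (fun x => intR (fun y => F (x, y))).
  by apply/funext => x; rewrite /fubini_F/= L1_EFin.
split.
- by have := integrable_fubini_F iF; rewrite e1.
- have mFs : measurable_fun setT (fun p : E * E => (F (p.2, p.1))%:E).
    apply/measurable_EFinP; apply: (measurableT_comp mF).
    by apply/measurable_fun_pair; [exact: measurable_snd|exact: measurable_fst].
  have iFs : (leb \x leb)%E.-integrable setT (fun p : E * E => (F (p.2, p.1))%:E).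
    by apply/integrable12ltyP => //; exact: (integrable21ltyP _ _ mF').1 iF.
  have := integrable_fubini_F iFs.
  rewrite (_ : fubini_F _ _ = EFin \o (fun y => intR (fun x => F (x, y))))//.
  by apply/funext => y; rewrite /fubini_F/= (@L1_EFin (fun x => F (x, y))).
- have := Fubini iF.
  rewrite (eq_integral (fun x => (intR (fun y => F (x, y)))%:E)); last first.
    by move=> x _; rewrite /= L1_EFin.
  rewrite [X in _ = X -> _](eq_integral (fun x => (intR (fun y => F (y, x)))%:E)); last first.
    by move=> x _; rewrite /= L1_EFin.
  by rewrite /intR /Rintegral => ->.
Qed.

End L1.

Section dominated.
Context (R : realType) (n : nat).
Local Notation E := 'rV[R]_n.

Lemma cvg_intR (u_ : nat -> E -> R) (u H : E -> R) :
  (forall k, measurable_fun setT (u_ k)) -> (forall x, u_ k x @[k --> \oo] --> u x) ->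
  L1 H -> (forall k x, `|u_ k x| <= H x) ->
  L1 u /\ intR (u_ k) @[k --> \oo] --> intR u.
Proof.
move=> mu_ uu iH uH.
have iu_ k : L1 (u_ k) by exact: L1_le (mu_ k) (uH k) iH.
have mE k : measurable_fun setT (EFin \o u_ k) by exact/measurable_EFinP.
have cE x : setT x -> (EFin \o u_ k) x @[k --> \oo] --> (EFin \o u) x.
  by move=> _; apply: cvg_EFin; [exact: nearW|exact: uu].
have dE k x : setT x -> (`|(EFin \o u_ k) x| <= (EFin \o H) x)%E.
  by move=> _; rewrite /= lee_fin.
have mu : measurable_fun setT (EFin \o u).
  by apply/measurable_EFinP; apply: (measurable_fun_cvg mu_) => x _; exact: uu.
have [iu _ cu] := dominated_convergence measurableT mE mu (aeW _ cE) iH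
  (aeW _ (fun x k => dE k x)).
split => //; move: cu.
have -> : (\int[lebesgue_rV R n]_x (EFin \o u) x = (intR u)%:E)%E by exact: L1_EFin.
rewrite (_ : [sequence _]_k = EFin \o (fun k => intR (u_ k))).
  by move=> /fine_cvg.
by apply/funext => k /=; exact: L1_EFin.
Qed.

Lemma cvg_1cube (x : E) : (\1_(@cube R n k%:R) x : R) @[k --> \oo] --> (1 : R).
Proof.
apply: cvg_near_cst; near=> k; rewrite indicE mem_set// => i.
apply: (le_trans (coord_le_norm _ _)); near: k; exact: nbhs_infty_ger.
Unshelve. all: by end_near. Qed.

Lemma L1_tail (w : E -> R) e : L1 w -> 0 < e ->
  exists2 r : R, 0 < r &
    forall s, r <= s -> intR (fun x => (1 - \1_(@cube R n s) x) * `|w x|) <= e.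
Proof.
move=> iw e0.
pose u (s : R) (x : E) : R := (1 - \1_(@cube R n s) x) * `|w x|.
have mc s : measurable_fun setT (fun x : E => 1 - \1_(@cube R n s) x : R).
  by apply: measurable_funB => //; exact: measurable_1cube.
have bc s x : `|1 - \1_(@cube R n s) x : R| <= 1.
  by rewrite indicE; case: (_ \in _); rewrite ?subrr ?normr0 ?subr0 ?normr1.
have iu s : L1 (u s) by apply: (L1M (mc s) (bc s)); exact: L1_norm.
have : intR (u k%:R) @[k --> \oo] --> intR (fun _ : E => 0).
  apply: (@cvg_intR (fun k => u k%:R) (fun=> 0) (fun x => `|w x|) _ _ (L1_norm iw) _).2.
  - by move=> k; exact: L1_measurable (iu _).
  - move=> x; rewrite -[X in _ --> X](mul0r `|w x|); apply: cvgMr_tmp.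
    by rewrite -[X in _ --> X](subrr 1); apply: cvgB; [exact: cvg_cst|exact: cvg_1cube].
  - by move=> k x; rewrite /u normrM normr_id ler_piMl.
rewrite intR0 => /cvgrPdist_le/(_ _ e0)[N _ /(_ N (leqnn N))] uN.
exists N.+1%:R => // s Ns.
move: uN; rewrite sub0r normrN; apply: le_trans; apply: le_trans (ler_norm _).
apply: (le_intR (iu s) (iu N%:R)) => x; rewrite /u ler_wpM2r// lerD2l lerN2 !indicE.
case: (boolP (x \in cube N%:R)) => [/set_mem xN|//].
rewrite mem_set// => i; apply: le_trans (xN i) (le_trans _ Ns).
by rewrite ler_nat.
Qed.

End dominated.

(** * Continuity of translations in L^1 *)

Section translation_continuity.
Context (R : realType) (n : nat).
Local Notation E := 'rV[R]_n.
Local Notation c1 r := (\1_(@cube R n r) : E -> R).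

(** Indicators of arbitrary measurable sets are not integrable; this class contains them and is
closed under linear combinations, and continuity of translations is tested on cubes. *)
Definition bounded_meas (w : E -> R) :=
  measurable_fun setT w /\ exists B, forall x, `|w x| <= B.

Lemma bounded_meas_indic A : measurable A -> bounded_meas (\1_A : E -> R).
Proof.
move=> mA; split; first exact: measurable_indic.
by exists 1 => x; rewrite indicE; case: (_ \in _); rewrite ?normr0 ?normr1.
Qed.

Lemma bounded_measD v w : bounded_meas v -> bounded_meas w -> bounded_meas (fun x => v x + w x).
Proof.
move=> [mv [B Bv]] [mw [C Cw]]; split; first exact: measurable_funD.
by exists (B + C) => x; apply: le_trans (ler_normD _ _) (lerD _ _).
Qed.

Lemma bounded_measZ (a : R) w : bounded_meas w -> bounded_meas (fun x => a * w x).
Proof.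
move=> [mw [C Cw]]; split; first by apply: measurable_funM => //; exact: measurable_cst.
by exists (`|a| * C) => x; rewrite normrM ler_wpM2l.
Qed.

Definition shift_modulus (r : R) (w : E -> R) (z : E) :=
  intR (fun x => c1 r x * `|w (x + z) - w x|).

Lemma L1_shift_modulus r w z : bounded_meas w -> L1 (fun x => c1 r x * `|w (x + z) - w x|).
Proof.
move=> [mw [B Bw]].
rewrite (_ : (fun x => _) = (fun x => `|w (x + z) - w x| * c1 r x)); last first.
  by apply/funext => x; rewrite mulrC.
apply: (@L1M _ _ (B + B)) (L1_cube _ r).
  apply: measurableT_comp => //; apply: measurable_funB => //.
  by apply: (measurableT_comp mw); exact: measurable_addrV.
by move=> x; rewrite normr_id; apply: le_trans (ler_normB _ _) (lerD _ _).
Qed.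

Definition shift_continuous w := forall r e, 0 < e ->
  exists2 d, 0 < d & forall z, `|z| <= d -> shift_modulus r w z <= e.

Lemma c1_ge0 r x : 0 <= c1 r x. Proof. by rewrite indicE. Qed.

Lemma shift_modulusD r v w z : bounded_meas v -> bounded_meas w ->
  shift_modulus r (fun x => v x + w x) z <= shift_modulus r v z + shift_modulus r w z.
Proof.
move=> bv bw; rewrite -intRD; [|exact: L1_shift_modulus..].
apply: le_intR => [||x]; first exact/L1_shift_modulus/bounded_measD.
  by apply: L1D; exact: L1_shift_modulus.
rewrite -mulrDr ler_wpM2l ?c1_ge0//.
by rewrite opprD addrACA; exact: ler_normD.
Qed.

Lemma shift_continuousD v w : bounded_meas v -> bounded_meas w -> shift_continuous v -> shift_continuous w ->
  shift_continuous (fun x => v x + w x).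
Proof.
move=> bv bw tv tw r e e0; have e2 : 0 < e / 2 by rewrite divr_gt0.
have [d d0 vd] := tv r _ e2; have [d' d'0 wd'] := tw r _ e2.
exists (Num.min d d'); first by rewrite lt_min d0.
move=> z; rewrite le_min => /andP[zd zd'].
by apply: le_trans (shift_modulusD _ _ bv bw) _; rewrite (splitr e) lerD// ?vd ?wd'.
Qed.

Lemma shift_modulusZ r a w z : bounded_meas w -> shift_modulus r (fun x => a * w x) z = `|a| * shift_modulus r w z.
Proof.
move=> bw; rewrite -intRZ; last exact: L1_shift_modulus.
by apply: eq_intR => x; rewrite -mulrBr normrM mulrCA.
Qed.

Lemma shift_continuousZ a w : bounded_meas w -> shift_continuous w -> shift_continuous (fun x => a * w x).
Proof.
move=> bw tw r e e0.
have a0 : 0 < `|a| + 1 by rewrite ltr_wpDl.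
have [d d0 wd] := tw r (e / (`|a| + 1)) ltac:(by rewrite divr_gt0).
exists d => // z zd; rewrite shift_modulusZ//.
apply: (@le_trans _ _ ((`|a| + 1) * (e / (`|a| + 1)))).
  have lm0 : 0 <= shift_modulus r w z by apply: intR_ge0 => x; rewrite mulr_ge0// c1_ge0.
  by apply: ler_pM (wd _ zd) => //; rewrite lerDl.
by rewrite mulrCA mulfV ?mulr1// gt_eqF.
Qed.

Lemma shift_continuous_sum I (s : seq I) (w : I -> E -> R) : (forall i, bounded_meas (w i)) ->
  (forall i, shift_continuous (w i)) -> bounded_meas (fun x => \sum_(i <- s) w i x) /\
  shift_continuous (fun x => \sum_(i <- s) w i x).
Proof.
move=> bw tw; elim: s => [|i s [IH1 IH2]].
  rewrite (_ : (fun x => _) = (fun x => 0 * \1_(@setT E) x)); last first.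
    by apply/funext => x; rewrite big_nil mul0r.
  have b1 : bounded_meas (\1_(@setT E) : E -> R) by apply: bounded_meas_indic.
  split; first exact: bounded_measZ.
  move=> r e e0; exists 1 => // z _; rewrite shift_modulusZ// normr0 mul0r; exact: ltW.
rewrite (_ : (fun x => _) = (fun x => w i x + \sum_(i <- s) w i x)); last first.
  by apply/funext => x; rewrite big_cons.
by split; [exact: bounded_measD|exact: shift_continuousD].
Qed.

(** These sets form a sigma-algebra which contains the half-spaces, hence all measurable sets; that
is how continuity of translations is obtained without approximation by continuous functions. *)
Definition shift_set (A : set E) := measurable A /\ shift_continuous (\1_A : E -> R).

Lemma shift_set0 : shift_set set0.
Proof.
split=> // r e e0; exists 1 => // z _; apply: le_trans (ltW e0).
rewrite /shift_modulus (_ : (fun x => _) = fun=> 0) ?intR0//.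
by apply/funext => x; rewrite !indicE !in_set0 subrr normr0 mulr0.
Qed.

Lemma shift_setC A : shift_set A -> shift_set (~` A).
Proof.
move=> [mA tA]; split; first exact: measurableC.
move=> r e e0; have [d d0 Ad] := tA r e e0; exists d => // z /Ad.
apply: le_trans; rewrite /shift_modulus le_eqVlt; apply/orP; left; apply/eqP.
apply: eq_intR => x; rewrite !indicE !in_setC; congr (_ * _).
by case: (_ \in A); case: (_ \in A); rewrite /= ?subrr// distrC.
Qed.

Lemma shift_setI A B : shift_set A -> shift_set B -> shift_set (A `&` B).
Proof.
move=> [mA tA] [mB tB]; split; first exact: measurableI.
move=> r e e0; have e2 : 0 < e / 2 by rewrite divr_gt0.
have [d d0 Ad] := tA r _ e2; have [d' d'0 Bd] := tB r _ e2.
exists (Num.min d d'); first by rewrite lt_min d0.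
move=> z; rewrite le_min => /andP[/Ad Adz /Bd Bdz].
rewrite (splitr e); apply: le_trans (lerD Adz Bdz); rewrite -intRD; last 2 first.
  by apply: L1_shift_modulus; exact: bounded_meas_indic.
  by apply: L1_shift_modulus; exact: bounded_meas_indic.
apply: le_intR => [||x].
- by apply: L1_shift_modulus; apply: bounded_meas_indic; exact: measurableI.
- by apply: L1D; apply: L1_shift_modulus; exact: bounded_meas_indic.
rewrite -mulrDr ler_wpM2l ?c1_ge0// !indicE !in_setI.
by case: (_ \in A); case: (_ \in A); case: (_ \in B); case: (_ \in B);
  rewrite /= ?subrr ?subr0 ?sub0r ?normrN ?normr0 ?normr1 ?addr0 ?add0r ?ler01 ?lerDl.
Qed.

(** Finite unions are dealt with by complements and intersections.  A countable union is
approximated by a finite one on the cube of radius r + 1, which contains all translates by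
|z| <= 1 of the cube of radius r, so that one approximation serves all small z. *)
Lemma shift_set_bigcup (A : nat -> set E) : (forall k, shift_set (A k)) ->
  shift_set (\bigcup_k A k).
Proof.
move=> tA.
pose B N := \big[setU/set0]_(k < N) A k.
have tB N : shift_set (B N).
  elim: N => [|N IH]; first by rewrite /B big_ord0; exact: shift_set0.
  rewrite /B big_ord_recr/= -[X in shift_set X]setCK setCU.
  by apply: shift_setC; apply: shift_setI; apply: shift_setC.
have mA : measurable (\bigcup_k A k).
  by apply: bigcupT_measurable => k; exact: (tA k).1.
have mB N : measurable (B N) by exact: (tB N).1.
split => // r e e0.
have e3 : 0 < e / 3 by rewrite divr_gt0.
pose u N (x : E) : R := c1 (r + 1) x * `|\1_(\bigcup_k A k) x - \1_(B N) x|.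
have mu N : measurable_fun setT (u N).
  apply: measurable_funM; first exact: measurable_1cube.
  by apply: measurableT_comp => //; apply: measurable_funB; exact: measurable_indic.
have u1 N x : `|u N x| <= c1 (r + 1) x.
  rewrite normrM normr_id ger0_norm ?c1_ge0// ler_piMr ?c1_ge0// !indicE.
  by case: (_ \in _); case: (_ \in _);
    rewrite /= ?subrr ?subr0 ?sub0r ?normrN ?normr0 ?normr1.
have iu N : L1 (u N) := L1_le (mu N) (u1 N) (L1_cube _ _).
have : intR (u k) @[k --> \oo] --> intR (fun _ : E => 0).
  apply: (@cvg_intR _ _ u (fun=> 0) (c1 (r + 1)) _ _ (L1_cube _ _) _).2 => //.
  move=> x; apply: cvg_near_cst; have [Ax|Ax] := pselect ((\bigcup_k A k) x).
    have [k _ Akx] := Ax; near=> N.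
    have BNx : B N x.
      by rewrite /B -bigcup_mkord; exists k => //=; near: N; exact: nbhs_infty_gt.
    by rewrite /u ![\1_(\bigcup_k A k) _]indicE ![\1_(B N) _]indicE !mem_set ?subrr ?normr0 ?mulr0.
  apply: nearW => N.
  have BNx : ~ B N x by rewrite /B -bigcup_mkord => -[k _ Akx]; apply: Ax; exists k.
  by rewrite /u ![\1_(\bigcup_k A k) _]indicE ![\1_(B N) _]indicE !memNset ?subrr ?normr0 ?mulr0.
rewrite intR0 => /cvgrPdist_le/(_ _ e3)[N _ /(_ N (leqnn N))].
rewrite sub0r normrN => /(le_trans (ler_norm _)) uN.
have [d d0 Bd] := (tB N).2 r _ e3.
exists (Num.min d 1); first by rewrite lt_min d0/=.
move=> z; rewrite le_min => /andP[/Bd Bdz z1].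
apply: (@le_trans _ _ (intR (fun x => u N (x + z)) + shift_modulus r (\1_(B N)) z + intR (u N))).
  have iuz : L1 (fun x => u N (x + z)) by exact: L1_translation.
  have iB : L1 (fun x => c1 r x * `|(\1_(B N) : E -> R) (x + z) - \1_(B N) x|).
    by apply: L1_shift_modulus; exact: bounded_meas_indic.
  rewrite -intRD// -intRD//; last exact: L1D.
  apply: le_intR => [||x].
  - by apply: L1_shift_modulus; exact: bounded_meas_indic.
  - by apply: L1D => //; exact: L1D.
  have [rx|rx] := boolP (x \in @cube R n r); last first.
    rewrite (_ : c1 r x = 0) ?indicE ?(negbTE rx)// !mul0r.
    by rewrite addr0 addr_ge0// mulr_ge0// c1_ge0.
  have rx' i : `|x ord0 i| <= r by move: rx => /set_mem.
  have -> : c1 r x = 1 by rewrite indicE rx.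
  rewrite /u.
  have -> : c1 (r + 1) x = 1.
    by rewrite indicE mem_set// => i; apply: le_trans (rx' i) _; rewrite lerDl.
  have -> : c1 (r + 1) (x + z) = 1.
    rewrite indicE mem_set// => i; rewrite mxE; apply: le_trans (ler_normD _ _) _.
    by apply: lerD (rx' i) (le_trans (coord_le_norm _ _) z1).
  rewrite !mul1r.
  set a := \1_(\bigcup_k A k) (x + z); set b := \1_(B N) (x + z).
  set a' := \1_(\bigcup_k A k) x; set b' := \1_(B N) x.
  rewrite [X in _ <= _ + X]distrC.
  rewrite (_ : a - a' = (a - b) + (b - b') + (b' - a')); last by ring.
  by apply: le_trans (ler_normD _ _) _; rewrite lerD2r ler_normD.
rewrite intR_translation//.
by rewrite (_ : e = e / 3 + e / 3 + e / 3); [rewrite !lerD|field].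
Unshelve. all: by end_near. Qed.

End translation_continuity.

Section translation_continuity_L1.
Context (R : realType) (n : nat).
Local Notation E := 'rV[R]_n.
Local Notation c1 r := (\1_(@cube R n r) : E -> R).

(** The indicator changes under translation by |z| <= d only in a slab of thickness 2 d. *)
Lemma shift_set_halfspace (i : 'I_n) (a : R) : shift_set [set x : E | a < x ord0 i].
Proof.
have mA : measurable [set x : E | a < x ord0 i].
  rewrite (_ : [set _ | _] = setT `&` rVcoord i @^-1` `]a, +oo[%classic).
    by apply: measurable_rVcoord => //; exact: measurable_itv.
  by apply/seteqP; split => x; rewrite /= in_itv/= andbT; tauto.
split=> // r e e0.
(* the slab has measure 2 d c in the cube of radius |r|; c + 1 avoids dividing by 0 *)
pose c : R := \prod_(j < n | j != i) (2 * `|r|).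
have c0 : 0 <= c by apply: prodr_ge0 => j _; rewrite mulr_ge0.
pose d : R := e / (2 * (c + 1)).
have d0 : 0 < d by rewrite divr_gt0// mulr_gt0// ltr_wpDl.
pose A (j : 'I_n) : set R := if j == i then `[a - d, a + d]%classic else `[- `|r|, `|r|]%classic.
pose S := [set v : E | forall j, A j (v ord0 j)].
have mAj j : measurable (A j) by rewrite /A; case: ifP => _; exact: measurable_itv.
have mS : measurable S by exact: measurable_rV_box.
have lS : lebesgue_rV R n S = ((2 * d) * c)%:E.
  rewrite lebesgue_rV_box// (bigD1 i)//= EFinM; congr (_ * _)%E.
    rewrite /A eqxx lebesgue_measure_itv/= lte_fin ltrD2l gtrN//.
    by rewrite -EFinD; congr (_%:E); ring.
  rewrite /c -prodEFin; apply: eq_bigr => j /negbTE ji.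
  rewrite /A ji lebesgue_measure_itv/= lte_fin.
  case: ltP => h; first by rewrite -EFinD; congr (_%:E); ring.
  by congr (_%:E); move: (normr_ge0 r) => ?; lra.
have iS : L1 (\1_S : E -> R).
  apply: (@L1_bounded_cube _ _ 1 (`|r| + `|a| + d)); first exact: measurable_indic.
    by move=> x; rewrite indicE; case: (_ \in _); rewrite ?normr0 ?normr1.
  move=> x; rewrite indicE pnatr_eq0 eqb0 negbK => /set_mem Sx j.
  have := Sx j; rewrite /A; case: eqP => [->|_] /=; rewrite in_itv/= => /andP[h1 h2].
    rewrite ler_norml; move: (normr_ge0 r) (ler_norm a) (ler_norm (-a)).
    by rewrite normrN => *; apply/andP; split; lra.
  by rewrite ler_norml; move: (normr_ge0 a) => *; apply/andP; split; lra.
have IS : intR (\1_S) = 2 * d * c.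
  by rewrite /intR /Rintegral integral_indic// setIT -[X in fine X]/(lebesgue_rV R n S) lS.
exists d => // z zd; apply: (@le_trans _ _ (intR (\1_S))); last first.
  rewrite IS /d (_ : 2 * _ * c = e * (c / (c + 1))); last by field; rewrite gt_eqF// ltr_wpDl.
  by rewrite ler_piMr ?(ltW e0)// ler_pdivrMr ?ltr_wpDl// mul1r lerDl.
apply: le_intR => //; first by apply: L1_shift_modulus; exact: bounded_meas_indic.
move=> x; have [xS|xS] := boolP (x \in S).
  rewrite [leRHS]indicE xS !indicE.
  by case: (_ \in _); case: (_ \in _); case: (_ \in _);
    rewrite /= ?subrr ?subr0 ?sub0r ?normrN ?normr0 ?normr1 ?mulr0 ?mul0r ?mulr1.
rewrite [leRHS]indicE (negbTE xS) le_eqVlt; apply/orP; left.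
rewrite mulf_eq0 indicE pnatr_eq0 eqb0 -implybE; apply/implyP => /set_mem xr.
rewrite normr_eq0 subr_eq0 !indicE; apply/eqP; congr (_%:R).
have zi := le_trans (coord_le_norm z i) zd.
have xi : ~ (a - d <= x ord0 i <= a + d).
  move=> h; move/negP: xS; apply; apply/mem_set => j; rewrite /A.
  case: eqP => [->|_] /=; rewrite in_itv//=.
  by rewrite -ler_norml; apply: le_trans (xr j) (ler_norm r).
congr nat_of_bool; apply/idP/idP => /set_mem/= h; apply/mem_set => /=; move: zi;
  rewrite ?mxE ler_norml => /andP[z1 z2]; rewrite ltNge; apply/negP => h';
  apply: xi; move: h; rewrite ?mxE => h; apply/andP; split; lra.
Qed.

Lemma measurable_shift_set (A : set E) : measurable A -> shift_set A.
Proof.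
move: A; have tcD A B : shift_set A -> shift_set B -> shift_set (A `\` B : set E).
  by move=> tA tB; rewrite setDE; apply: shift_setI => //; exact: shift_setC.
have tcT : shift_set (setT : set E) by rewrite -setC0; apply: shift_setC; exact: shift_set0.
apply: smallest_sub.
  split; [exact: shift_set0|by move=> B tB; exact: tcD|exact: shift_set_bigcup].
move=> B; rewrite -bigcup_seq => -[i _ [C mC <-]]; rewrite setTI.
have {mC} : (@RGenOInfty.G R).-sigma.-measurable C.
  by rewrite -RGenOInfty.measurableE.
move: C; apply: smallest_sub.
  split; first by rewrite /= preimage_set0; exact: shift_set0.
  - by move=> D tD; rewrite /= setTD preimage_setC; exact: shift_setC.
  - by move=> D tD; rewrite /= preimage_bigcup; exact: shift_set_bigcup.
move=> _ [a ->]; rewrite /= (_ : _ @^-1` _ = [set x : E | a < x ord0 i]).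
  exact: shift_set_halfspace.
by apply/seteqP; split => x; rewrite /= in_itv/= andbT.
Qed.

Import HBSimple.

Lemma shift_continuous_sfun (s : {sfun E >-> R}) : bounded_meas (s : E -> R) /\ shift_continuous s.
Proof.
have -> : (s : E -> R) = fun x => \sum_(y <- finmap.enum_fset (fset_set (range s))) y * \1_(s @^-1` [set y]) x.
  apply/funext => x; rewrite [LHS]fimfunE fsbig_finite//=; exact: fimfunP.
have ms y : measurable (s @^-1` [set y]) by exact: measurable_sfunP.
apply: shift_continuous_sum => y; first exact/bounded_measZ/bounded_meas_indic.
by apply: shift_continuousZ; [exact: bounded_meas_indic|exact: (measurable_shift_set (ms y)).2].
Qed.

(** Reduction to simple functions, for which it holds on cubes, with the mass outside a large
cube made small. *)
Lemma L1_translation_continuous (w : E -> R) e : L1 w -> 0 < e ->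
  exists2 d, 0 < d & forall z, `|z| <= d -> intR (fun x => `|w (x + z) - w x|) <= e.
Proof.
move=> iw e0; have e6 : 0 < e / 6 by rewrite divr_gt0.
have [r r0 wr] := L1_tail iw e6.
have [s_ [is_ _]] := approximation_sfun_integrable measurableT iw.
have is' k : L1 (fun x => w x - s_ k x) by apply: L1B => //; exact: is_.
rewrite (_ : (fun k => _) = EFin \o (fun k => intR (fun x => `|w x - s_ k x|))); last first.
  apply/funext => k /=; rewrite -L1_EFin//; exact: L1_norm.
move=> /fine_cvg/cvgrPdist_le/(_ _ e6)[N _ /(_ N (leqnn N))] /=.
rewrite sub0r normrN => /(le_trans (ler_norm _)).
set s := s_ N => ws.
have [bs ts] := shift_continuous_sfun s.
have [d d0 sd] := ts (r + 1) _ e6.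
exists (Num.min d 1); first by rewrite lt_min d0/=.
move=> z; rewrite le_min => /andP[/sd sz z1].
pose q (x : E) := `|w x - s x|.
have iq : L1 q by apply: L1_norm; exact: is'.
pose t (x : E) := (1 - c1 r x) * `|w x|.
have it : L1 t.
  apply: (@L1M _ _ 1); last exact: L1_norm.
    by apply: measurable_funB => //; exact: measurable_1cube.
  by move=> x; rewrite indicE; case: (_ \in _); rewrite ?subrr ?normr0 ?subr0 ?normr1.
have ts0 x : 0 <= t x.
  by rewrite /t mulr_ge0// subr_ge0 indicE; case: (_ \in _).
have q0 x : 0 <= q x by exact: normr_ge0.
apply: (@le_trans _ _ (intR (fun x => q (x + z)) + intR q + shift_modulus (r + 1) s z
  + intR (fun x => t (x + z)) + intR t)); last first.
  rewrite !intR_translation//.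
  have tr : intR t <= e / 6 by exact: wr.
  move: sz ws tr; rewrite -/(intR q).
  by move=> h1 h2 h3; have h4 : intR q <= e / 6 by []; lra.
have iqz := L1_translation z iq; have itz := L1_translation z it.
have il : L1 (fun x => c1 (r + 1) x * `|s (x + z) - s x|) by exact: L1_shift_modulus.
have i1 := L1D iqz iq; have i2 := L1D i1 il; have i3 := L1D i2 itz.
rewrite /shift_modulus -intRD// -intRD// -intRD// -intRD//.
apply: le_intR => [||x].
- by apply: L1_norm; apply: L1B => //; exact: L1_translation.
- exact: L1D.
have [rx|rx] := boolP (x \in @cube R n (r + 1)).
  have -> : c1 (r + 1) x = 1 by rewrite indicE rx.
  rewrite mul1r -[leLHS]addr0 -[X in _ + X](addr0 0) addrA !lerD//.
  rewrite (_ : w (x + z) - w x = (w (x + z) - s (x + z)) - (w x - s x) + (s (x + z) - s x)).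
    by apply: le_trans (ler_normD _ _) _; rewrite lerD2r ler_normB.
  by ring.
have nx : ~ cube (r + 1) x by move=> h; move/negP: rx; apply; exact/mem_set.
have n1 : c1 r x = 0.
  rewrite indicE memNset// => h; apply: nx => i; apply: le_trans (h i) _; rewrite lerDl//.
have n2 : c1 r (x + z) = 0.
  rewrite indicE memNset// => h; apply: nx => i.
  rewrite (_ : x ord0 i = (x + z) ord0 i - z ord0 i); last by rewrite mxE addrK.
  by apply: le_trans (ler_normB _ _) _; apply: lerD (h i) (le_trans (coord_le_norm _ _) z1).
rewrite /t n1 n2 subr0 !mul1r -addrA; apply: le_trans (ler_normB _ _) _.
by rewrite lerDr !addr_ge0// mulr_ge0// c1_ge0.
Qed.

End translation_continuity_L1.

(** * Smooth bumps and mollifiers *)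

Section bump.
Context (R : realType).
Implicit Types (p : {poly R}) (m : nat) (t : R).

(** Keeping p and m arbitrary makes the class closed under differentiation, so that smoothness is a
mere induction on the order; p = 1 and m = 0 give the usual bump function. *)
Definition ebump p m t : R :=
  if `|t| < 1 then p.[t] * ((1 - t ^+ 2)^-1) ^+ m * expR (- (1 - t ^+ 2)^-1) else 0.

Definition ebump_deriv p m : {poly R} :=
  (p^`() * (1 - 'X^2) + (2 * m%:R) *: ('X * p)) * (1 - 'X^2) - 2 *: ('X * p).

Lemma sqr_lt1 t : `|t| < 1 -> 0 < 1 - t ^+ 2.
Proof. by move=> t1; rewrite subr_gt0 -real_normK ?num_real// expr_lt1. Qed.

(** The exponential beats every power of 1 / (1 - t^2); the two powers that are kept yield a
vanishing derivative at the end points. *)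
Lemma ebump_le p m : exists2 C, 0 <= C & forall t, `|t| < 1 ->
  `|ebump p m t| <= C * (1 - t ^+ 2) ^+ 2.
Proof.
have [M pM] := poly_itv_bound p (-1) 1.
have M0 : 0 <= M by apply: le_trans (pM 0 _); rewrite ?normr_ge0// lerN10 ler01.
exists (M * m.+2`!%:R); first by rewrite mulr_ge0.
move=> t t1; rewrite /ebump t1; have := sqr_lt1 t1; set a := 1 - _ => a0.
have pt : `|p.[t]| <= M by apply: pM; rewrite -ler_norml ltW.
have : 1 + a^-1 ^+ m.+2 / m.+2`!%:R <= expR a^-1.
  by apply: expR_ge1Dxn; rewrite invr_ge0 ltW.
have f0 : 0 < m.+2`!%:R :> R by rewrite ltr0n fact_gt0.
move=> h; have {h} : a^-1 ^+ m.+2 / m.+2`!%:R <= expR a^-1.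
  by apply: le_trans h; rewrite lerDr.
rewrite ler_pdivrMr// => h.
rewrite -mulrA normrM -mulrA ler_pM//.
rewrite ger0_norm ?mulr_ge0 ?exprn_ge0 ?invr_ge0 ?(ltW a0) ?expR_ge0//.
rewrite expRN ler_pdivrMr ?expR_gt0//.
have -> : a^-1 ^+ m = a^-1 ^+ m.+2 * a ^+ 2.
  by rewrite -addn2 exprD -mulrA -exprMn mulVf ?gt_eqF// expr1n mulr1.
rewrite [leRHS](_ : _ = (expR a^-1 * m.+2`!%:R) * a ^+ 2); last by ring.
by apply: ler_wpM2r; rewrite ?exprn_ge0 ?(ltW a0).
Qed.

(** At a point outside ]-1, 1[ the increment is quadratic, because 1 - x^2 is at most 2 |x - t|. *)
Lemma ebump_le_dist p m : exists2 C, 0 <= C & forall t x, 1 <= `|t| ->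
  `|ebump p m x - ebump p m t| <= C * `|x - t| ^+ 2.
Proof.
have [C C0 bC] := ebump_le p m; exists (4 * C); first by rewrite mulr_ge0.
move=> t x t1; rewrite [in X in _ - X]/ebump ltNge t1/= subr0.
have [x1|x1] := boolP (`|x| < 1); last first.
  by rewrite /ebump (negbTE x1) normr0 !mulr_ge0// exprn_ge0.
apply: le_trans (bC _ x1) _; rewrite (mulrC 4) -mulrA ler_wpM2l//.
have : 1 - x ^+ 2 <= 2 * `|x - t|.
  have -> : 1 - x ^+ 2 = (1 - `|x|) * (1 + `|x|).
    by rewrite -(real_normK (num_real x)); ring.
  rewrite [leRHS]mulrC; apply: ler_pM; rewrite ?subr_ge0 ?(ltW x1) ?addr_ge0 ?(ltW x1)//; last by lra.
  apply: (le_trans (lerB t1 (lexx `|x|))).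
  by rewrite distrC; exact: lerB_dist.
have a0 := sqr_lt1 x1; move=> h.
rewrite (_ : 4 * _ = (2 * `|x - t|) ^+ 2); last by ring.
by rewrite ler_pXn2r// nnegrE ?(ltW a0)// mulr_ge0.
Qed.

Lemma is_derive_ebump_in p m t : `|t| < 1 ->
  is_derive t 1 (ebump p m) (ebump (ebump_deriv p m) m.+2 t).
Proof.
move=> t1.
have tn : \forall x \near t, `|x| < 1.
  have : `|x| @[x --> t] --> `|t| by apply: cvg_norm; exact: cvg_id.
  by move/cvgr_lt; apply.
have s0 : 1 - t ^+ 2 != 0 by rewrite gt_eqF// sqr_lt1.
pose s := fun x : R => (1 - x ^+ 2)^-1.
apply: (@near_eq_is_derive _ _ _
  (fun x => p.[x] * (s x) ^+ m * expR (- s x))).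
  by near=> x; rewrite /ebump (_ : `|x| < 1 = true)//; near: x.
have ds : is_derive t 1 s (2 * t * s t ^+ 2).
  have d1 : is_derive t 1 (fun x : R => 1 - x ^+ 2) (- (2 * t)).
    have := is_deriveB (is_derive_cst (1 : R) t (1 : R)) (is_deriveX 2 (is_derive_id t (1 : R))).
    by rewrite sub0r /GRing.scale/= expr1 mulr1.
  have := @is_deriveV _ (fun x : R => 1 - x ^+ 2) _ _ _ s0 d1; rewrite /GRing.scale/= mulrNN -exprVn.
  by rewrite [_ * (2 * t)]mulrC.
have de : is_derive t 1 (fun x : R => expR (- s x)) (expR (- s t) * (- (2 * t * s t ^+ 2))).
  exact: (@is_derive1_comp _ expR (fun x => - s x)).
have dm : is_derive t 1 (fun x : R => s x ^+ m) ((m%:R * s t ^+ m.-1) * (2 * t * s t ^+ 2)).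
  by have := is_deriveX m ds; rewrite exprfctE.
have := is_deriveM (is_deriveM (is_derive_poly p t) dm) de.
congr (is_derive _ _ _ _); rewrite /ebump t1; rewrite -(addn2 m).
rewrite -/(s t) /ebump_deriv /GRing.scale !hornerE /=.
have -> : (1 - t ^+ 2) = (s t)^-1 by rewrite invrK.
have st0 : s t != 0 by rewrite invr_eq0.
rewrite !fctE.
clear dm ds de; set e := expR (- s t); set b := p^`().[t]; set a := p.[t]; set S := s t in st0 *; move: e b a S st0 => e b a S S0.
case: m => [|m]; rewrite ?[0.-1]/0%N ?[m.+1.-1]/m !exprD ?exprS ?expr0; field => //.
Unshelve. all: by end_near. Qed.

Lemma is_derive_ebump p m t :
  is_derive t 1 (ebump p m) (ebump (ebump_deriv p m) m.+2 t).
Proof.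
have [|t1] := boolP (`|t| < 1); first exact: is_derive_ebump_in.
have -> : ebump (ebump_deriv p m) m.+2 t = 0 by rewrite /ebump (negbTE t1).
rewrite -leNgt in t1; have [C C0 bC] := ebump_le_dist p m.
have cv : h^-1 *: (ebump p m (h *: 1 + t) - ebump p m t) @[h --> 0^'] --> (0 : R).
  apply/cvgrPdist_le => e e0; near=> h.
  have h0 : h != 0 by near: h; exact: nbhs_dnbhs_neq.
  rewrite sub0r normrN normrZ normfV ler_pdivrMl ?normr_gt0//.
  apply: le_trans (bC t _ t1) _; rewrite addrK /GRing.scale/= mulr1 expr2 mulrA mulrC.
  rewrite ler_wpM2l//; apply: (@le_trans _ _ ((C + 1) * `|h|)).
    by rewrite ler_wpM2r// lerDl.
  rewrite mulrC -ler_pdivlMr ?ltr_wpDl//; near: h.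
  by apply: dnbhs0_le; rewrite divr_gt0// ltr_wpDl.
apply: DeriveDef; first by apply/cvg_ex; exists 0.
exact/cvg_lim.
Unshelve. all: by end_near. Qed.

Lemma ebump_bounded p m : exists2 C, 0 <= C & forall t, `|ebump p m t| <= C.
Proof.
have [C C0 bC] := ebump_le p m; exists C => // t.
have [t1|t1] := boolP (`|t| < 1); last by rewrite /ebump (negbTE t1) normr0.
apply: le_trans (bC _ t1) _; rewrite ler_piMr// exprn_ile1 ?(ltW (sqr_lt1 t1))//.
by rewrite gerBl sqr_ge0.
Qed.

Lemma continuous_ebump p m : continuous (ebump p m).
Proof.
move=> t; apply/differentiable_continuous/derivable1_diffP.
by have [] := is_derive_ebump p m t.
Qed.

Lemma ebump_supp p m t : ebump p m t != 0 -> `|t| < 1.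
Proof. by rewrite /ebump; case: ifP; rewrite ?eqxx. Qed.

Lemma ebump1_ge0 t : 0 <= ebump 1 0 t.
Proof. by rewrite /ebump; case: ifP => // _; rewrite hornerC expr0 !mul1r expR_ge0. Qed.

Lemma ebump1N t : ebump 1 0 (- t) = ebump 1 0 t.
Proof. by rewrite /ebump normrN sqrrN !hornerC. Qed.

Lemma ebump1_lb t : `|t| <= 2^-1 -> expR (- 2) <= ebump 1 0 t.
Proof.
move=> t2; rewrite /ebump (le_lt_trans t2); last by lra.
rewrite hornerC expr0 !mul1r ler_expR lerN2.
have : t ^+ 2 <= 2^-1.
  have := ler_pM (normr_ge0 t) (normr_ge0 t) t2 t2.
  by rewrite -expr2 real_normK ?num_real//; lra.
move=> h; rewrite -[2]invrK lef_pV2 ?posrE; lra.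
Qed.

End bump.

Section direction.
Context (R : realType) (n : nat) (W : normedModType R).
Local Notation E := 'rV[R]_n.

Lemma dir_quotE (f : E -> W) (x v : E) :
  (fun h : R => h^-1 *: (((fun t : R => f (t *: v + x)) \o shift 0) (h *: 1) -
     (fun t : R => f (t *: v + x)) 0)) =
  (fun h => h^-1 *: ((f \o shift x) (h *: v) - f x)).
Proof.
by apply/funext => h /=; rewrite addr0 scale0r add0r /GRing.scale/= mulr1.
Qed.

Lemma dir_derivable (f : E -> W) (x v : E) :
  derivable f x v <-> derivable (fun t : R => f (t *: v + x)) 0 1.
Proof. by rewrite /derivable dir_quotE. Qed.

Lemma dir_derive (f : E -> W) (x v : E) :
  'D_v f x = 'D_1 (fun t : R => f (t *: v + x)) 0.
Proof. by rewrite /derive dir_quotE. Qed.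

(** Directional derivatives are derivatives of functions of one real variable, for which the chain
rule and the mean value theorem are available. *)
Lemma dir_is_derive (f : E -> W) (x v : E) df :
  is_derive x v f df <-> is_derive (0 : R) 1 (fun t : R => f (t *: v + x)) df.
Proof.
split=> -[d1 <-]; apply: DeriveDef.
- by move/dir_derivable: d1.
- by rewrite dir_derive.
- by apply/dir_derivable.
- by rewrite dir_derive.
Qed.

End direction.

Section shifts.
Context (R : realType).

Lemma is_derive_shift1 (W : normedModType R) (g : R -> W) (a : R) dg :
  is_derive (0 : R) 1 (fun t => g (t + a)) dg <-> is_derive a 1 g dg.
Proof.
have E1 : (fun h : R => h^-1 *: (((fun t : R => g (t + a)) \o shift 0) (h *: 1) -
     (fun t : R => g (t + a)) 0)) = (fun h => h^-1 *: ((g \o shift a) (h *: 1) - g a)).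
  by apply/funext => h /=; rewrite addr0 add0r.
split=> -[d1 <-]; apply: DeriveDef.
- by rewrite /derivable -E1.
- by rewrite /derive -E1.
- by rewrite /derivable E1.
- by rewrite /derive E1.
Qed.

Lemma is_derive_refl (n : nat) (f : 'rV[R]_n -> R) (x y v : 'rV[R]_n) df :
  is_derive (y - x) v f df -> is_derive x v (fun x => f (y - x)) (- df).
Proof.
move=> /dir_is_derive h; apply/dir_is_derive.
rewrite (_ : (fun t => _) = (fun t : R => f (t *: v + (y - x))) \o -%R); last first.
  by apply/funext => t /=; congr f; rewrite opprD addrCA scaleNr.
have h' : is_derive (- 0 : R) 1 (fun t : R => f (t *: v + (y - x))) df by rewrite oppr0.
have := @is_derive1_comp _ _ (-%R) (0 : R) _ _ h' (is_deriveNid (0 : R) (1 : R)).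
by rewrite mulrN1.
Qed.

End shifts.

Section kern.
Context (R : realType) (n : nat).
Local Notation E := 'rV[R]_n.

(** Products of one-dimensional bumps, each coordinate having its own polynomial and exponent, so
that partial derivatives stay in the class. *)
Definition kern (c d : R) (P : 'I_n -> {poly R} * nat) (x : E) : R :=
  c * \prod_j ebump (P j).1 (P j).2 (x ord0 j / d).

Definition kern_upd (P : 'I_n -> {poly R} * nat) (i j : 'I_n) :=
  if j == i then (ebump_deriv (P j).1 (P j).2, (P j).2.+2) else P j.

Lemma is_derive_kern c d P i x :
  is_derive x (ebase i) (kern c d P) (kern (c / d) d (kern_upd P i) x).
Proof.
apply/dir_is_derive.
pose a := \prod_(j | j != i) ebump (P j).1 (P j).2 (x ord0 j / d).
rewrite (_ : (fun t => _) =
    (fun t : R => (c * a) *: ebump (P i).1 (P i).2 (t / d + x ord0 i / d))); last first.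
  apply/funext => t; rewrite /kern (bigD1 i)//=.
  rewrite (eq_bigr (fun j => ebump (P j).1 (P j).2 (x ord0 j / d))); last first.
    by move=> j /negbTE ji; rewrite /ebase !mxE eqxx/= ji mulr0 add0r.
  rewrite (_ : (t *: ebase i + x) ord0 i / d = t / d + x ord0 i / d).
    by rewrite -/a /GRing.scale/=; ring.
  by rewrite /ebase !mxE !eqxx/= mulr1 mulrDl.
have -> : kern (c / d) d (kern_upd P i) x =
    (c * a) *: (ebump (ebump_deriv (P i).1 (P i).2) (P i).2.+2 (0 / d + x ord0 i / d) * d^-1).
  rewrite /kern (bigD1 i)//= {1 2}/kern_upd !eqxx/= mul0r add0r.
  rewrite (eq_bigr (fun j => ebump (P j).1 (P j).2 (x ord0 j / d))); last first.
    by move=> j /negbTE ji; rewrite /kern_upd ji.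
  by rewrite -/a /GRing.scale/=; ring.
apply: is_deriveZ.
apply: (@is_derive1_comp _ (ebump (P i).1 (P i).2) (fun t => t / d + x ord0 i / d)).
  exact: is_derive_ebump.
have := is_deriveD (is_deriveM (is_derive_id (0:R) (1:R)) (is_derive_cst (d^-1) (0:R) (1:R)))
  (is_derive_cst (x ord0 i / d) (0:R) (1:R)).
by rewrite scaler0 add0r addr0 /GRing.scale/= mulr1.
Qed.

Lemma continuous_coord (g : R -> R) (j : 'I_n) : continuous g ->
  continuous (fun x : E => g (x ord0 j)).
Proof.
move=> cg x; apply: (continuous_comp (f := fun x : E => x ord0 j)).
  exact: coord_continuous.
exact: cg.
Qed.

Lemma continuous_kern c d P : continuous (kern c d P).
Proof.
have cp (s : seq 'I_n) : continuous
    (fun x : E => \prod_(j <- s) ebump (P j).1 (P j).2 (x ord0 j / d)).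
  elim: s => [|j s IH] x.
    have -> : (fun x : E => \prod_(j <- [::]) ebump (P j).1 (P j).2 (x ord0 j / d)) = cst 1.
      by apply/funext => y; rewrite big_nil.
    exact: cst_continuous.
  have -> : (fun x : E => \prod_(j <- j :: s) ebump (P j).1 (P j).2 (x ord0 j / d)) =
      (fun x : E => ebump (P j).1 (P j).2 (x ord0 j / d) *
      \prod_(j <- s) ebump (P j).1 (P j).2 (x ord0 j / d)).
    by apply/funext => y; rewrite big_cons.
  have h1 : continuous (fun x : E => ebump (P j).1 (P j).2 (x ord0 j / d)).
    apply: (@continuous_coord (fun t => ebump (P j).1 (P j).2 (t / d))) => t.
    apply: (continuous_comp (f := fun t : R => t / d)); last exact: continuous_ebump.
    exact: mulrr_continuous.
  exact: (continuousM (h1 x) (IH x)).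
by move=> x; apply: (continuousM _ (cp _ x)); exact: cst_continuous.
Qed.

Lemma kern_bounded c d P : exists2 B, 0 <= B & forall x, `|kern c d P x| <= B.
Proof.
have /choice[B BP] (j : 'I_n) : exists B, 0 <= B /\ forall t, `|ebump (P j).1 (P j).2 t| <= B.
  by have [C C0 bC] := ebump_bounded (P j).1 (P j).2; exists C.
exists (`|c| * \prod_j B j).
  by rewrite mulr_ge0// prodr_ge0// => j _; exact: (BP j).1.
move=> x; rewrite normrM ler_wpM2l// normr_prod.
by apply: ler_prod => j _; rewrite normr_ge0 (BP j).2.
Qed.

Lemma kern_supp c d P x : 0 < d -> kern c d P x != 0 -> cube d x.
Proof.
move=> d0; rewrite mulf_eq0 negb_or => /andP[_] h j.
have : ebump (P j).1 (P j).2 (x ord0 j / d) != 0.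
  by apply: contra h => /eqP h; rewrite (bigD1 j)//= h mul0r.
by move/ebump_supp; rewrite normrM normfV (gtr0_norm d0) ltr_pdivrMr// mul1r => /ltW.
Qed.

Lemma measurable_kern c d P : measurable_fun setT (kern c d P).
Proof. by apply: continuous_measurable_rV; exact: continuous_kern. Qed.

Lemma L1_kern c d P : 0 < d -> L1 (kern c d P).
Proof.
move=> d0; have [B B0 bB] := kern_bounded c d P.
apply: (L1_bounded_cube (measurable_kern _ _ _) bB) => x; exact: kern_supp.
Qed.

Definition ebump1 (j : 'I_n) : {poly R} * nat := (1, 0%N).

Definition rho_mass d := intR (kern 1 d ebump1).

(** The kernel kern 1 d is at least (2 beta)^n on a cube of volume d^n, so that (2 d)^n divided by its
mass is at most beta^-n. *)
Definition beta := (expR (- 2) : R) / 2.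

Lemma beta_gt0 : 0 < beta. Proof. by rewrite divr_gt0// expR_gt0. Qed.

Lemma kern1_ge0 c d x : 0 <= c -> 0 <= kern c d ebump1 x.
Proof. by move=> c0; rewrite mulr_ge0// prodr_ge0// => j _; exact: ebump1_ge0. Qed.

Lemma rho_mass_ge d : 0 < d -> ((2 * beta) * d) ^+ n <= rho_mass d.
Proof.
move=> d0; have d2 : 0 <= d / 2 by rewrite ltW// divr_gt0.
have b2 : 2 * beta = expR (- 2) by rewrite mulrC divfK.
have -> : ((2 * beta) * d) ^+ n = intR (fun x => (2 * beta) ^+ n * \1_(@cube R n (d / 2)) x).
  rewrite intRZ; last exact: L1_cube.
  by rewrite intR_cube// -exprMn; congr (_ ^+ _); field.
apply: le_intR; [exact/L1Z/L1_cube|exact: L1_kern|move=> x].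
rewrite indicE; case: (boolP (_ \in _)) => [/set_mem xd|_]; last by rewrite mulr0 kern1_ge0.
rewrite mulr1 /kern mul1r -[X in _ ^+ X]card_ord -prodr_const.
apply: ler_prod => j _; rewrite b2 expR_ge0/=; apply: ebump1_lb.
by rewrite normrM normfV (gtr0_norm d0) ler_pdivrMr// mulrC.
Qed.

Lemma rho_mass_gt0 d : 0 < d -> 0 < rho_mass d.
Proof.
move=> d0; apply: lt_le_trans (rho_mass_ge d0).
by rewrite exprn_gt0// !mulr_gt0// beta_gt0.
Qed.

Definition rho d := kern (rho_mass d)^-1 d ebump1.
Definition drho d i := kern ((rho_mass d)^-1 / d) d (kern_upd ebump1 i).

Lemma is_derive_rho d i x : is_derive x (ebase i) (rho d) (drho d i x).
Proof. exact: is_derive_kern. Qed.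

Lemma rho_ge0 d x : 0 < d -> 0 <= rho d x.
Proof. by move=> d0; rewrite kern1_ge0// invr_ge0 ltW// rho_mass_gt0. Qed.

Lemma intR_rho d : 0 < d -> intR (rho d) = 1.
Proof.
move=> d0; rewrite (@eq_intR _ _ _ (fun x => (rho_mass d)^-1 * kern 1 d ebump1 x)).
  by rewrite intRZ ?mulVf ?gt_eqF ?rho_mass_gt0//; exact: L1_kern.
by move=> x; rewrite /rho /kern mul1r.
Qed.

Lemma rhoN d x : rho d (- x) = rho d x.
Proof.
congr (_ * _); apply: eq_bigr => j _.
by rewrite mxE mulNr ebump1N.
Qed.

(** The kernel is bounded by a constant over d times the inverse of the mass, on a cube of volume
(2 d)^n, and the mass is at least a constant times d^n. *)
Lemma intR_drho : exists2 C, 0 < C & forall d i, 0 < d -> intR (fun x => `|drho d i x|) <= C / d.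
Proof.
have /choice[B BP] (i : 'I_n) : exists B, 0 <= B /\ forall x, `|kern 1 1 (kern_upd ebump1 i) x| <= B.
  by have [B B0 bB] := kern_bounded 1 1 (kern_upd ebump1 i); exists B.
pose M := \sum_i B i.
have M0 : 0 <= M by apply: sumr_ge0 => i _; exact: (BP i).1.
exists ((M + 1) / beta ^+ n); first by rewrite divr_gt0 ?exprn_gt0 ?beta_gt0// ltr_wpDl.
move=> d i d0.
pose c := (rho_mass d)^-1 / d * M.
have c0 : 0 <= c by rewrite !mulr_ge0// invr_ge0 ltW// rho_mass_gt0.
apply: (@le_trans _ _ (intR (fun x => c * \1_(@cube R n d) x))).
  apply: le_intR; [exact/L1_norm/L1_kern|exact/L1Z/L1_cube|move=> x].
  have [x0|x0] := eqVneq (drho d i x) 0; first by rewrite x0 normr0 mulr_ge0// indicE.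
  rewrite indicE mem_set; last exact: kern_supp x0.
  rewrite mulr1 /drho /kern normrM /c ger0_norm; last first.
    by rewrite mulr_ge0// invr_ge0 ltW// rho_mass_gt0.
  rewrite ler_wpM2l//; first by rewrite mulr_ge0// invr_ge0 ltW// rho_mass_gt0.
  have := (BP i).2 (d^-1 *: x); rewrite /kern mul1r => h.
  apply: le_trans (le_trans h _).
    by rewrite le_eqVlt; apply/orP; left; apply/eqP; congr `|_|; apply: eq_bigr => j _;
      rewrite mxE divr1 mulrC.
  by rewrite /M (bigD1 i)//= lerDl sumr_ge0// => j _; exact: (BP j).1.
rewrite intRZ; last exact: L1_cube.
rewrite intR_cube ?(ltW d0)// /c.
have b0 := beta_gt0.
have bd : 0 < beta ^+ n by rewrite exprn_gt0.
rewrite [leLHS](_ : _ = (M / d) * ((2 * d) ^+ n / rho_mass d)); last by ring.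
rewrite [leRHS](_ : _ = ((M + 1) / d) / beta ^+ n); last by ring.
apply: ler_pM; first by rewrite mulr_ge0// invr_ge0 ltW.
- by rewrite mulr_ge0 ?exprn_ge0 ?mulr_ge0 ?invr_ge0 ?ltW// rho_mass_gt0.
- by rewrite ler_pM2r ?invr_gt0// lerDl.
rewrite ler_pdivrMr ?rho_mass_gt0// [leRHS]mulrC ler_pdivlMr//.
by apply: le_trans (rho_mass_ge d0); rewrite -exprMn le_eqVlt; apply/orP; left; apply/eqP; congr (_ ^+ _); ring.
Qed.

(** The constant of the theorem is n (1 + n Cdrho). *)
Definition Cdrho := sval (cid2 intR_drho).

Lemma Cdrho_gt0 : 0 < Cdrho.
Proof. by rewrite /Cdrho; case: cid2. Qed.

Lemma intR_drho_le d i : 0 < d -> intR (fun x => `|drho d i x|) <= Cdrho / d.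
Proof. by move=> d0; rewrite /Cdrho; case: cid2 => C C0 /= CP; exact: CP. Qed.

End kern.

(** * Convolution and mollification *)

Section convolution.
Context (R : realType) (n : nat).
Local Notation E := 'rV[R]_n.
Implicit Types K w : E -> R.

Lemma is_derive_line (K K' : E -> R) (v : E) : (forall x, is_derive x v K (K' x)) ->
  forall (p : E) (t : R), is_derive t 1 (fun t => K (t *: v + p)) (K' (t *: v + p)).
Proof.
move=> KK' p t; apply/is_derive_shift1.
rewrite (_ : (fun s => _) = (fun s : R => K (s *: v + (t *: v + p)))).
  by apply/dir_is_derive.
by apply/funext => s; rewrite scalerDl addrA.
Qed.

Definition convol K w x := intR (fun y => K (x - y) * w y).

Lemma measurable_reflect K (x : E) : measurable_fun setT K ->
  measurable_fun setT (fun y : E => K (x - y)).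
Proof.
move=> mK; apply: (measurableT_comp mK).
by apply: (measurable_fun_rV_comp _ _).1; [exact: measurable_cst|exact: measurable_id].
Qed.

Lemma L1_conv_integrand (B : R) K w x : measurable_fun setT K -> (forall x, `|K x| <= B) ->
  L1 w -> L1 (fun y => K (x - y) * w y).
Proof.
move=> mK bK iw; apply: (@L1M _ _ B) => //; exact: measurable_reflect.
Qed.

Lemma conv_shift (B : R) K w x z : measurable_fun setT K -> (forall x, `|K x| <= B) ->
  L1 w -> convol K w (x + z) = convol K (fun y => w (y + z)) x.
Proof.
move=> mK bK iw; rewrite /convol.
rewrite -(intR_translation z (L1_conv_integrand (x + z) mK bK iw)).
by apply: eq_intR => y; congr (K _ * _); rewrite opprD addrACA subrr addr0.
Qed.

(** Translating x amounts to translating w, so that continuity of translations in L^1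
applies; the kernel itself is only measurable and bounded. *)
Lemma continuous_conv (B : R) K w : measurable_fun setT K -> (forall x, `|K x| <= B) ->
  L1 w -> continuous (convol K w).
Proof.
move=> mK bK iw x; apply/(@cvgrPdist_le _ _ _ (nbhs x)) => e e0.
have B0 : 0 <= B by apply: le_trans (bK x).
have B1 : 0 < B + 1 by rewrite ltr_wpDl.
have [d d0 wd] := L1_translation_continuous iw (divr_gt0 e0 B1).
have := nbhsx_ballx x d d0; apply: filterS => y; rewrite mx_norm_ball/= => xyd.
have yd : `|y - x| <= d by rewrite distrC ltW.
have -> : y = x + (y - x) by rewrite addrC subrK.
rewrite (conv_shift x (y - x) mK bK iw).
have iwz := L1_translation (y - x) iw.
rewrite /convol -intRB; [|exact: (L1_conv_integrand x mK bK)..].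
apply: (@le_trans _ _ (intR (fun u => B * `|w (u + (y - x)) - w u|))).
  apply: norm_intR_le => [||u].
  - by apply: L1B; exact: (L1_conv_integrand x mK bK).
  - by apply/L1Z/L1_norm/L1B.
  - by rewrite -mulrBr normrM distrC ler_wpM2r.
rewrite intRZ; last exact/L1_norm/L1B.
apply: (@le_trans _ _ ((B + 1) * (e / (B + 1)))).
  by apply: ler_pM (wd _ yd) => //; [exact: intR_ge0|rewrite lerDl].
by rewrite mulrC divfK ?gt_eqF.
Qed.

(** Differentiation under the integral sign along a line; the base point p y may depend on the
integration variable, so that it serves both for convolutions and for shifted test functions. *)
Lemma is_derive_intR (B : R) (K K' : E -> R) (v : E) (p : E -> E) w :
  measurable_fun setT K -> (forall x, `|K x| <= B) ->
  (forall x, is_derive x v K (K' x)) -> (forall x, `|K' x| <= B) ->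
  measurable_fun setT p -> L1 w ->
  forall t, is_derive (t : R) 1 (fun t => intR (fun y => K (t *: v + p y) * w y))
    (intR (fun y => K' (t *: v + p y) * w y)).
Proof.
move=> mK bK dK bK' mp iw t.
pose f (t : R) y := K (t *: v + p y) * w y.
pose I : set R := `]t - 1, t + 1[%classic.
have It : I t by rewrite /I/= in_itv/=; apply/andP; split; lra.
have df (s : R) (y : E) : is_derive s 1 (f^~ y) (K' (s *: v + p y) * w y).
  have := is_deriveM (is_derive_line dK (p y) s) (is_derive_cst (w y) s (1 : R)).
  by rewrite scaler0 add0r [_ *: K' _]mulrC.
have intf (s : R) : I s -> (lebesgue_rV R n).-integrable setT (EFin \o f s).
  move=> _; apply: (@L1M _ _ B) => //.
  apply: (measurableT_comp mK).
  exact: (@measurable_fun_rV_comp _ _ _ _ (fun=> s *: v) p (measurable_cst _) mp).2.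
have derf (s : R) (y : E) : I s -> setT y -> derivable (f^~ y) s 1 by move=> _ _; case: (df s y).
have d1E (s : R) (y : E) : partial1of2 f s y = K' (s *: v + p y) * w y.
  by rewrite partial1of2E; case: (df s y).
have G0 (y : E) : 0 <= B * `|w y| by rewrite mulr_ge0//; apply: le_trans (bK 0).
have iG : (lebesgue_rV R n).-integrable setT (EFin \o (fun y => B * `|w y|)).
  exact/L1Z/L1_norm.
have Gub (s : R) (y : E) : I s -> setT y -> `|partial1of2 f s y| <= B * `|w y|.
  by move=> _ _; rewrite d1E normrM ler_wpM2r.
have d1 := derivable_under_integral measurableT It intf derf G0 iG Gub.
have d2 := differentiation_under_integral measurableT It intf derf G0 iG Gub.
apply: DeriveDef; first exact: d1.
by rewrite -derive1E d2; apply: eq_intR => y; rewrite d1E.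
Qed.

Lemma is_derive_conv (B : R) K K' v w x : measurable_fun setT K -> (forall x, `|K x| <= B) ->
  (forall x, is_derive x v K (K' x)) -> (forall x, `|K' x| <= B) -> L1 w ->
  is_derive x v (convol K w) (convol K' w x).
Proof.
move=> mK bK dK bK' iw; apply/dir_is_derive.
have mp : measurable_fun setT (fun y : E => x - y).
  by apply: (measurable_fun_rV_comp _ _).1; [exact: measurable_cst|exact: measurable_id].
have := is_derive_intR mK bK dK bK' mp iw 0.
have -> : (fun t : R => intR (fun y => K (t *: v + (x - y)) * w y)) =
    (fun t : R => convol K w (t *: v + x)).
  by apply/funext => t; apply: eq_intR => y; congr (K _ * _); rewrite /= addrA.
suff -> : intR (fun y => K' (0 *: v + (x - y)) * w y) = convol K' w x by [].
by apply: eq_intR => y; rewrite scale0r add0r.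
Qed.

Lemma is_derive_conv_kern c d P i w x : L1 w ->
  is_derive x (ebase i) (convol (kern c d P) w) (convol (kern (c / d) d (kern_upd P i)) w x).
Proof.
move=> iw; have [B B0 bB] := kern_bounded c d P.
have [C C0 bC] := kern_bounded (c / d) d (kern_upd P i).
apply: (@is_derive_conv (B + C)) => //.
- exact: measurable_kern.
- by move=> y; apply: le_trans (bB y) _; rewrite lerDl.
- by move=> y; exact: is_derive_kern.
- by move=> y; apply: le_trans (bC y) _; rewrite lerDr.
Qed.

(** Derivatives fall on the kernel, and the kernels are stable under partial derivatives. *)
Lemma Ck_conv k c d P w : L1 w -> Ck k setT (convol (kern c d P) w).
Proof.
move=> iw; elim: k c P => [|k IH] c P /=; split => //.
- by move=> x _; have [B _ bB] := kern_bounded c d P;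
    apply: (continuous_conv (measurable_kern c d P) bB iw).
- by move=> x _; have [B _ bB] := kern_bounded c d P;
    apply: (continuous_conv (measurable_kern c d P) bB iw).
move=> i; split; first by move=> x _; case: (is_derive_conv_kern c d P i x iw).
rewrite (_ : 'D_(ebase i) _ = convol (kern (c / d) d (kern_upd P i)) w) //.
by apply/funext => x; case: (is_derive_conv_kern c d P i x iw).
Qed.

End convolution.

Section mollify.
Context (R : realType) (n : nat).
Local Notation E := 'rV[R]_n.
Implicit Types (v w : E -> R) (x : E) (d : R).

Lemma cubeE (d : R) (x : E) : 0 <= d -> cube d x <-> `|x| <= d.
Proof.
move=> d0; split=> h; first exact: norm_le_coord.
by move=> i; apply: le_trans h; exact: coord_le_norm.
Qed.

Lemma measurable_rho d : measurable_fun setT (@rho R n d).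
Proof. exact: measurable_kern. Qed.

Lemma L1_rho d : 0 < d -> L1 (@rho R n d).
Proof. exact: L1_kern. Qed.

Lemma rho_bounded d : exists2 B, 0 <= B & forall x : E, `|rho d x| <= B.
Proof. exact: kern_bounded. Qed.

Lemma L1_rhoM d w x : 0 < d -> L1 w -> L1 (fun z => rho d z * w (x + z)).
Proof.
move=> d0 iw; have [B B0 bB] := rho_bounded d.
apply: (L1M (measurable_rho d) bB).
rewrite (_ : (fun z => _) = (fun z => w (z + x))); first exact: L1_translation.
by apply/funext => z; rewrite addrC.
Qed.

Lemma conv_rhoE d w x : 0 < d -> L1 w ->
  convol (rho d) w x = intR (fun z => rho d z * w (x + z)).
Proof.
move=> d0 iw; have [B B0 bB] := rho_bounded d.
rewrite /convol -(intR_translation x (L1_conv_integrand x (measurable_rho d) bB iw)).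
by apply: eq_intR => z; rewrite opprD addrCA subrr addr0 rhoN addrC.
Qed.

(** A mollification is an average over the cube of radius d. *)
Lemma conv_rho_bounds d w x (a b : R) : 0 < d -> L1 w ->
  (forall z, cube d z -> a <= w (x + z) <= b) -> a <= convol (rho d) w x <= b.
Proof.
move=> d0 iw wab; rewrite conv_rhoE//.
have e c : intR (fun z : E => c * rho d z) = c.
  by rewrite intRZ ?intR_rho ?mulr1//; exact: L1_rho.
rewrite -{1}(e a) -{1}(e b); apply/andP; split; apply: le_intR => [||z];
  try exact: L1_rhoM; try exact/L1Z/L1_rho.
- rewrite mulrC; have [->|/(kern_supp d0)/wab/andP[h _]] := eqVneq (rho d z) 0.
    by rewrite !mul0r.
  by rewrite ler_wpM2l// rho_ge0.
- rewrite [b * _]mulrC; have [->|/(kern_supp d0)/wab/andP[_ h]] := eqVneq (rho d z) 0.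
    by rewrite !mul0r.
  by rewrite ler_wpM2l// rho_ge0.
Qed.

Lemma conv_rho_norm d w x (b : R) : 0 < d -> L1 w ->
  (forall z, cube d z -> `|w (x + z)| <= b) -> `|convol (rho d) w x| <= b.
Proof.
move=> d0 iw wb; rewrite ler_norml; apply: conv_rho_bounds => // z /wb.
by rewrite ler_norml.
Qed.

Lemma conv_rho_supp d w x : 0 < d -> L1 w -> convol (rho d) w x != 0 ->
  exists2 z, cube d z & w (x + z) != 0.
Proof.
move=> d0 iw h; apply: contrapT => nz; move/negP: h; apply.
rewrite eq_le andbC; apply: conv_rho_bounds => // z zd.
have [->|w0] := eqVneq (w (x + z)) 0; first by rewrite lexx.
by exfalso; apply: nz; exists z.
Qed.

(** Fubini for a bounded kernel k with compact support: only the values of q at shifts z in the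
support of k matter, so integrability of q is asked there only. *)
Lemma kernel_fubini (B d e : R) (k : E -> R) (q : E * E -> R) :
  measurable_fun setT k -> (forall z, `|k z| <= B) -> (forall z, k z != 0 -> cube d z) ->
  measurable_fun setT q -> 0 <= e ->
  (forall z, cube d z -> L1 (fun x => q (z, x)) /\ intR (fun x => `|q (z, x)|) <= e) ->
  (forall x, L1 (fun z => k z * q (z, x))) ->
  [/\ L1 (fun x => intR (fun z => k z * q (z, x))),
      intR (fun x => intR (fun z => k z * q (z, x))) =
      intR (fun z => k z * intR (fun x => q (z, x))),
      L1 (fun z => k z * intR (fun x => q (z, x))) &
      `|intR (fun x => intR (fun z => k z * q (z, x)))| <= intR (fun z => `|k z|) * e].
Proof.
move=> mk bk sk mq e0 hq1 hq2.
pose F (p : E * E) := k p.1 * q p.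
have iF z : L1 (fun x => F (z, x)).
  rewrite /F/=; have [->|/sk/hq1[iq _]] := eqVneq (k z) 0; last exact: L1Z.
  by rewrite (_ : (fun x => _) = (fun=> 0)); [exact: L1_0|apply/funext => x; rewrite mul0r].
have FH z : intR (fun x => `|F (z, x)|) <= `|k z| * e.
  rewrite /F/=; have [->|/sk/hq1[iq qe]] := eqVneq (k z) 0.
    rewrite normr0 mul0r (_ : (fun x => _) = (fun=> 0)) ?intR0//.
    by apply/funext => x; rewrite mul0r normr0.
  rewrite (@eq_intR _ _ _ (fun x => `|k z| * `|q (z, x)|)); last by move=> x; rewrite normrM.
  by rewrite intRZ ?ler_wpM2l//; exact: L1_norm.
have iH : L1 (fun z => `|k z| * e).
  rewrite (_ : (fun z => _) = (fun z => e * `|k z|)); last by apply/funext => z; rewrite mulrC.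
  exact/L1Z/L1_norm/(L1_bounded_cube mk bk sk).
have mF : measurable_fun setT F.
  by apply: measurable_funM => //; apply: (measurableT_comp mk); exact: measurable_fst.
have [i1 i2 i3] := fubini_intR mF iF hq2 iH FH.
have i4 z : intR (fun x => F (z, x)) = k z * intR (fun x => q (z, x)).
  rewrite /F/=.
  have [->|/sk/hq1[iq _]] := eqVneq (k z) 0; last by rewrite intRZ.
  by rewrite mul0r (_ : (fun x => _) = (fun=> 0)) ?intR0//; apply/funext => x; rewrite mul0r.
split; first exact: i2.
- by rewrite -[LHS]i3; exact: eq_intR.
- by move: i1; congr L1; apply/funext.
 rewrite -[X in `|X|]i3 [leRHS]mulrC -intRZ; last first.
  exact/L1_norm/(L1_bounded_cube mk bk sk).
apply: norm_intR_le; first exact: i1.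
  by rewrite (_ : (fun z => _) = (fun z => `|k z| * e)); [|apply/funext => z; rewrite mulrC].
by move=> z; rewrite mulrC; apply: le_trans (FH z); exact: le_norm_intR.
Qed.

(** The mollifier is even. *)
Lemma conv_rho_adjoint d v w : 0 < d -> L1 v -> L1 w ->
  [/\ L1 (fun x => convol (rho d) w x * v x), L1 (fun x => w x * convol (rho d) v x) &
  intR (fun x => convol (rho d) w x * v x) = intR (fun x => w x * convol (rho d) v x)].
Proof.
move=> d0 iv iw; have [B B0 bB] := rho_bounded d.
pose F (p : E * E) := rho d (p.1 - p.2) * w p.2 * v p.1.
have mF : measurable_fun setT F.
  apply: measurable_funM; last first.
    by apply: (measurableT_comp (L1_measurable iv)); exact: measurable_fst.
  apply: measurable_funM; last first.
    by apply: (measurableT_comp (L1_measurable iw)); exact: measurable_snd.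
  apply: (measurableT_comp (measurable_rho d)).
  by apply: (measurable_fun_rV_comp _ _).1; [exact: measurable_fst|exact: measurable_snd].
have iw' x := L1_conv_integrand x (measurable_rho d) bB iw.
have iv' x := L1_conv_integrand x (measurable_rho d) bB iv.
have iF1 x : L1 (fun y => F (x, y)).
  rewrite (_ : (fun y => _) = (fun y => v x * (rho d (x - y) * w y))); first exact: L1Z.
  by apply/funext => y; rewrite /F/= mulrC.
have F2E y : (fun x => F (x, y)) = (fun x => w y * (rho d (y - x) * v x)).
  by apply/funext => x; rewrite /F/= -opprB rhoN; ring.
have iF2 y : L1 (fun x => F (x, y)) by rewrite F2E; exact: L1Z.
have iH : L1 (fun x => (B * intR (fun y => `|w y|)) * `|v x|) by exact/L1Z/L1_norm.
have FH x : intR (fun y => `|F (x, y)|) <= (B * intR (fun y => `|w y|)) * `|v x|.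
  rewrite mulrAC -intRZ; last exact: L1_norm.
  apply: le_intR; [exact: L1_norm|exact/L1Z/L1_norm|move=> y].
  rewrite /F/= (normrM _ (v x)) (normrM _ (w y)) (mulrAC B).
  by apply: ler_wpM2r => //; apply: ler_wpM2r => //; exact: bB.
have [i1 i2 i3] := fubini_intR mF iF1 iF2 iH FH.
have e1 x : intR (fun y => F (x, y)) = convol (rho d) w x * v x.
  rewrite [RHS]mulrC -intRZ//; apply: eq_intR => y; by rewrite /F/= mulrC.
have e2 y : intR (fun x => F (x, y)) = w y * convol (rho d) v y.
  by rewrite F2E intRZ.
split.
- by rewrite (_ : (fun x => _) = (fun x => intR (fun y => F (x, y))))//; apply/funext => x.
- by rewrite (_ : (fun x => _) = (fun y => intR (fun x => F (x, y))))//; apply/funext => x.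
- rewrite (@eq_intR _ _ _ (fun x => intR (fun y => F (x, y)))) ?i3; last by move=> x.
  exact: eq_intR.
Qed.

Lemma measurable_conv_rho d w : 0 < d -> L1 w -> measurable_fun setT (convol (rho d) w).
Proof.
move=> d0 iw; have [B B0 bB] := rho_bounded d.
by apply: continuous_measurable_rV; exact: (continuous_conv (measurable_rho d) bB iw).
Qed.

(** By Fubini the mollification error is an average of translation errors, so it is bounded by
their supremum. *)
Lemma moll_weight d (e : R) v w : 0 < d -> 0 <= e -> L1 w -> measurable_fun setT v ->
  (forall x, 0 <= v x) ->
  (forall z, cube d z -> L1 (fun x => `|w (x + z) - w x| * v x) /\
    intR (fun x => `|w (x + z) - w x| * v x) <= e) ->
  L1 (fun x => `|convol (rho d) w x - w x| * v x) /\
  intR (fun x => `|convol (rho d) w x - w x| * v x) <= e.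
Proof.
move=> d0 e0 iw mv v0 hw; have [B B0 bB] := rho_bounded d.
have mw := L1_measurable iw.
pose q (p : E * E) := `|w (p.2 + p.1) - w p.2| * v p.2.
have mq : measurable_fun setT q.
  apply: measurable_funM; last by apply: (measurableT_comp mv); exact: measurable_snd.
  apply: measurableT_comp => //; apply: measurable_funB.
    apply: (measurableT_comp mw).
    by apply: (measurable_fun_rV_comp _ _).2; [exact: measurable_snd|exact: measurable_fst].
  by apply: (measurableT_comp mw); exact: measurable_snd.
have iq x : L1 (fun z => rho d z * (w (x + z) - w x)).
  rewrite (_ : (fun z => _) = (fun z => rho d z * w (x + z) - w x * rho d z)).
    by apply: L1B; [exact: L1_rhoM|exact/L1Z/L1_rho].
  by apply/funext => z; ring.
have hq2E x : (fun z => rho d z * q (z, x)) = (fun z => v x * `|rho d z * (w (x + z) - w x)|).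
  by apply/funext => z; rewrite /q/= normrM (ger0_norm (rho_ge0 _ d0)); ring.
have hq2 x : L1 (fun z => rho d z * q (z, x)) by rewrite hq2E; exact/L1Z/L1_norm.
have hq1 z : cube d z -> L1 (fun x => q (z, x)) /\ intR (fun x => `|q (z, x)|) <= e.
  move=> /hw[i1 i2]; split => //; rewrite (@eq_intR _ _ _ (fun x => q (z, x)))// => x.
  by rewrite ger0_norm// /q/= mulr_ge0.
have [j1 j2 _ j3] := kernel_fubini (measurable_rho d) bB (@kern_supp _ _ _ _ _ ^~ d0) mq e0 hq1 hq2.
have le x : `|convol (rho d) w x - w x| * v x <= intR (fun z => rho d z * q (z, x)).
  rewrite hq2E intRZ; last exact: L1_norm.
  rewrite mulrC ler_wpM2l//.
  rewrite conv_rhoE// -[w x in X in `|X|](mulr1) -(intR_rho n d0) -intRZ; last exact: L1_rho.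
  rewrite -intRB; [|exact: L1_rhoM|exact/L1Z/L1_rho].
  rewrite (@eq_intR _ _ _ (fun z => rho d z * (w (x + z) - w x))); last by move=> z; ring.
  exact: le_norm_intR.
have mc := measurable_conv_rho d0 iw.
have i : L1 (fun x => `|convol (rho d) w x - w x| * v x).
  apply: (L1_le _ _ j1).
    by apply: measurable_funM => //; apply: measurableT_comp => //; exact: measurable_funB.
  by move=> x; rewrite ger0_norm ?mulr_ge0.
split=> //; apply: (le_trans (le_intR i j1 le)); apply: (le_trans (ler_norm _)).
apply: (le_trans j3).
rewrite (@eq_intR _ _ _ (rho d)) ?intR_rho ?mul1r// => z.
by rewrite ger0_norm// rho_ge0.
Qed.

Lemma moll_L1 w (e : R) : L1 w -> 0 < e -> exists2 d0, 0 < d0 & forall d, 0 < d -> d <= d0 ->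
  L1 (fun x => convol (rho d) w x - w x) /\
  intR (fun x => `|convol (rho d) w x - w x|) <= e.
Proof.
move=> iw e0; have [d0 d00 wd0] := L1_translation_continuous iw e0.
exists d0 => // d dp dd0.
have [||i1 i2] := @moll_weight d e (fun=> 1) w dp (ltW e0) iw (measurable_cst _).
- by move=> _.
- move=> z zd; rewrite (_ : (fun x => _) = (fun x => `|w (x + z) - w x|)); last first.
    by apply/funext => x; rewrite mulr1.
  split; first by apply/L1_norm/L1B => //; exact: L1_translation.
  by apply: wd0; apply: le_trans dd0; apply/cubeE => //; exact: ltW.
move: i1 i2; rewrite (_ : (fun x => _) = (fun x => `|convol (rho d) w x - w x|)); last first.
  by apply/funext => x; rewrite mulr1.
move=> i1 i2; split => //.
apply: (L1_le _ _ i1) => //; apply: measurable_funB; last exact: L1_measurable.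
exact: measurable_conv_rho.
Qed.

(** (w(x + z) - w x) f x is the difference of (w f)(x + z) - (w f) x and of
w(x + z) (f(x + z) - f x): continuity of translations for w f and for f suffices, although f may
be unbounded. *)
Lemma moll_L1_weight (B : R) w (f : E -> R) (e : R) : L1 w -> (forall x, `|w x| <= B) -> L1 f ->
  (forall x, 0 <= f x) -> 0 < e ->
  exists2 d0, 0 < d0 & forall d, 0 < d -> d <= d0 ->
  L1 (fun x => `|convol (rho d) w x - w x| * f x) /\
  intR (fun x => `|convol (rho d) w x - w x| * f x) <= e.
Proof.
move=> iw bw fi f0 e0.
have mw := L1_measurable iw.
have B0 : 0 <= B by apply: le_trans (bw 0).
have iwf : L1 (fun x => w x * f x) by exact: (L1M mw bw).
have e2 : 0 < e / 2 by rewrite divr_gt0.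
have [d1 d10 wd1] := L1_translation_continuous iwf e2.
have e3 : 0 < e / 2 / (B + 1) by rewrite divr_gt0// ltr_wpDl.
have [d2 d20 fd2] := L1_translation_continuous fi e3.
exists (Num.min d1 d2); first by rewrite lt_min d10.
move=> d d0; rewrite le_min => /andP[dd1 dd2].
apply: moll_weight => //; [exact: ltW|exact: L1_measurable|].
move=> z /cubeE -/(_ (ltW d0)) zd.
have iz : L1 (fun x => `|w (x + z) - w x| * f x).
  apply: (@L1M _ _ (B + B)) => //.
    apply: measurableT_comp => //; apply: measurable_funB => //.
    by apply: (measurableT_comp mw); exact: measurable_addrV.
  by move=> x; rewrite normr_id; apply: le_trans (ler_normB _ _) (lerD _ _).
split=> //.
have i1 : L1 (fun x => `|w (x + z) * f (x + z) - w x * f x|).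
  by apply/L1_norm/L1B => //; exact: (L1_translation z iwf).
have i2 : L1 (fun x => B * `|f (x + z) - f x|).
  by apply/L1Z/L1_norm/L1B => //; exact: L1_translation.
apply: (@le_trans _ _ (intR (fun x => `|w (x + z) * f (x + z) - w x * f x| +
    B * `|f (x + z) - f x|))).
  apply: le_intR => //; first exact: L1D.
  move=> x; rewrite -[X in _ * X](ger0_norm (f0 x)) -normrM.
  rewrite (_ : (w (x + z) - w x) * f x = (w (x + z) * f (x + z) - w x * f x)
    - w (x + z) * (f (x + z) - f x)); last by ring.
  by apply: le_trans (ler_normB _ _) _; rewrite lerD2l normrM ler_wpM2r.
rewrite intRD// (splitr e) lerD//; first by apply: wd1; exact: le_trans dd1.
rewrite intRZ; last by apply/L1_norm/L1B => //; exact: L1_translation.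
apply: (@le_trans _ _ ((B + 1) * (e / 2 / (B + 1)))).
  apply: ler_pM => //; [exact: intR_ge0|by rewrite lerDl|].
  by apply: fd2; exact: le_trans dd2.
by rewrite mulrC divfK// gt_eqF// ltr_wpDl.
Qed.

End mollify.

(** * Test functions and weak gradients *)

Section C1.
Context (R : realType) (n : nat).
Local Notation E := 'rV[R]_n.
Implicit Types (u v w : E -> R) (du dv : 'I_n -> E -> R).

(** The gradient is carried along as explicit data, which avoids rewriting with derivation
operators under integrals. *)
Definition C1 u du := [/\ continuous u, forall i, continuous (du i) &
  forall i x, is_derive x (ebase i) u (du i x)].

Lemma C1_measurable u du : C1 u du -> measurable_fun setT u.
Proof. by case=> cu _ _; exact: continuous_measurable_rV. Qed.

Lemma C1_dmeasurable u du i : C1 u du -> measurable_fun setT (du i).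
Proof. by case=> _ cu _; apply: continuous_measurable_rV; exact: cu. Qed.

Lemma C1M u du v dv : C1 u du -> C1 v dv ->
  C1 (fun x => u x * v x) (fun i x => u x * dv i x + v x * du i x).
Proof.
move=> [cu cdu du'] [cv cdv dv']; split=> [x|i x|i x].
- exact: continuousM (cu x) (cv x).
- apply: (@continuousD _ _ _ (fun x => u x * dv i x) (fun x => v x * du i x)).
    exact: continuousM (cu x) (cdv i x).
  exact: continuousM (cv x) (cdu i x).
- have := is_deriveM (du' i x) (dv' i x); exact.
Qed.

Lemma C1D u du v dv : C1 u du -> C1 v dv ->
  C1 (fun x => u x + v x) (fun i x => du i x + dv i x).
Proof.
move=> [cu cdu du'] [cv cdv dv']; split=> [x|i x|i x].
- exact: continuousD (cu x) (cv x).
- exact: continuousD (cdu i x) (cdv i x).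
- have := is_deriveD (du' i x) (dv' i x); exact.
Qed.

Lemma C1N u du : C1 u du -> C1 (fun x => - u x) (fun i x => - du i x).
Proof.
move=> [cu cdu du']; split=> [x|i x|i x].
- exact: continuousN (cu x).
- exact: continuousN (cdu i x).
- have := is_deriveN (du' i x); exact.
Qed.

Lemma C1_0 : C1 (fun=> 0) (fun _ => fun=> 0).
Proof. by split=> [x|i x|i x]; [exact: cst_continuous|exact: cst_continuous|exact: is_derive_cst]. Qed.

Lemma C1_sum I (s : seq I) (u : I -> E -> R) (du : I -> 'I_n -> E -> R) :
  (forall j, C1 (u j) (du j)) ->
  C1 (fun x => \sum_(j <- s) u j x) (fun i x => \sum_(j <- s) du j i x).
Proof.
move=> cu; elim: s => [|j s IH].
  have -> : (fun x : E => \sum_(j <- [::]) u j x) = (fun=> 0).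
    by apply/funext => x; rewrite big_nil.
  have -> : (fun i (x : E) => \sum_(j <- [::]) du j i x) = (fun _ => fun=> 0).
    by apply/funext => i; apply/funext => x; rewrite big_nil.
  exact: C1_0.
have -> : (fun x : E => \sum_(j <- j :: s) u j x) = (fun x => u j x + \sum_(j <- s) u j x).
  by apply/funext => x; rewrite big_cons.
have -> : (fun i (x : E) => \sum_(j <- j :: s) du j i x) =
    (fun i x => du j i x + \sum_(j <- s) du j i x).
  by apply/funext => i; apply/funext => x; rewrite big_cons.
exact: C1D.
Qed.

Lemma C1_convol d w : L1 w -> C1 (convol (rho d) w) (fun i => convol (drho d i) w).
Proof.
move=> iw; split.
- have [B _ bB] := rho_bounded n d.
  exact: (continuous_conv (measurable_rho d) bB iw).
- move=> i; have [B _ bB] := @kern_bounded R n ((rho_mass n d)^-1 / d) d (kern_upd (@ebump1 R n) i).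
  exact: (continuous_conv (measurable_kern _ _ _) bB iw).
- by move=> i x; exact: is_derive_conv_kern.
Qed.

Lemma continuous_reflect u (y : E) : continuous u -> continuous (fun x : E => u (y - x)).
Proof.
move=> cu x; apply: (continuous_comp (f := fun x : E => y - x)); last exact: cu.
by apply: (@continuousB _ _ _ (fun=> y) id); [exact: cst_continuous|by move=> ?; exact: cvg_id].
Qed.

Lemma C1_rho_reflect d (y : E) : C1 (fun x : E => rho d (y - x)) (fun i (x : E) => - drho d i (y - x)).
Proof.
split.
- by apply: continuous_reflect; exact: continuous_kern.
- move=> i x; apply: (@continuousN _ _ _ (fun x : E => drho d i (y - x))).
  by apply: continuous_reflect; exact: continuous_kern.
- by move=> i x; apply: is_derive_refl; exact: is_derive_rho.
Qed.

Lemma C1_shift u du (a : E) : C1 u du -> C1 (fun x : E => u (a + x)) (fun i (x : E) => du i (a + x)).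
Proof.
have ca x : {for x, continuous (fun x : E => a + x)}.
  by apply: (@continuousD _ _ _ (fun=> a) id); [exact: cst_continuous|by move=> ?; exact: cvg_id].
move=> [cu cdu du']; split=> [x|i x|i x].
- exact: (continuous_comp (ca x) (cu _)).
- exact: (continuous_comp (ca x) (cdu i _)).
- apply/dir_is_derive; have /dir_is_derive := du' i (a + x).
  suff -> : (fun t : R => u (t *: ebase i + (a + x))) = (fun t : R => u (a + (t *: ebase i + x))) by [].
  by apply/funext => t; rewrite addrCA.
Qed.

Lemma C1_eqD u du i : C1 u du -> 'D_(ebase i) u = du i.
Proof. by move=> [_ _ d]; apply/funext => x; case: (d i x). Qed.

Lemma C1_Ck u du : C1 u du -> Ck 1 setT u.
Proof.
move=> h; have [cu cdu du'] := h; split=> [x _|i]; first exact: cu.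
split; first by move=> x _; case: (du' i x).
by rewrite (C1_eqD i h); split => // x _; exact: cdu.
Qed.

Lemma closed_cube r : closed (@cube R n r).
Proof.
rewrite (_ : cube r = \bigcap_(i in [set: 'I_n]) [set x : E | `|x ord0 i| <= r]).
  apply: closed_bigI => i _.
  have : continuous (fun x : E => `|x ord0 i|).
    by apply: continuous_coord => t; exact: norm_continuous.
  move=> /continuous_closedP/(_ _ (@closed_le R r)); exact.
by apply/seteqP; split=> [x h i _|x h i]; [exact: h|exact: (h i Logic.I)].
Qed.

Lemma compact_cube r : compact (@cube R n r).
Proof.
apply: bounded_closed_compact; last exact: closed_cube.
exists (Num.max r 0); split; first exact: num_real.
move=> M; rewrite gt_max => /andP[rM M0] x xr.
by apply: norm_le_coord; [exact: ltW|move=> i; apply: le_trans (xr i) (ltW rM)].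
Qed.

Definition test r u du := C1 u du /\ forall x, u x != 0 -> cube r x.

(** Outside the closed cube the function vanishes near the point. *)
Lemma test_dsupp r u du i x : test r u du -> du i x != 0 -> cube r x.
Proof.
move=> [[cu cdu d] su] dx; apply: contrapT => nx; move/negP: dx; apply; apply/eqP.
have : \forall y \near x, (fun=> 0 : R) y = u y.
  have : nbhs x (~` @cube R n r).
    by apply: open_nbhs_nbhs; split => //; apply: closed_openC; exact: closed_cube.
  apply: filterS => y ny; apply/eqP; rewrite eq_sym; apply/negPn/negP => /su //.
move=> h; have d0 := near_eq_is_derive h (is_derive_cst (0 : R) x (ebase i)).
by case: (d i x) => _ <-; case: d0 => _ ->.
Qed.

Lemma continuous_bounded u r : continuous u -> (forall x, u x != 0 -> cube r x) ->
  exists2 B, 0 <= B & forall x, `|u x| <= B.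
Proof.
move=> cu su.
have /compact_bounded[M [_ hM]] : compact (u @` @cube R n r).
  apply: continuous_compact; last exact: compact_cube.
  exact: continuous_subspaceT.
exists (`|M| + 1); first by rewrite addr_ge0.
move=> x; have [->|/su xr] := eqVneq (u x) 0; first by rewrite normr0 addr_ge0.
apply: hM; first by rewrite (le_lt_trans (ler_norm _))// ltrDl.
by exists x.
Qed.

Lemma test_bounded r u du : test r u du -> exists2 B, 0 <= B &
  (forall x, `|u x| <= B) /\ (forall i x, `|du i x| <= B).
Proof.
move=> h; have [[cu cdu d] su] := h.
have [B B0 bB] := continuous_bounded cu su.
have /choice[C CP] (i : 'I_n) : exists C, 0 <= C /\ forall x, `|du i x| <= C.
  have [C C0 bC] := @continuous_bounded (du i) r (cdu i) (fun x => test_dsupp h).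
  by exists C.
exists (B + \sum_i C i); first by rewrite addr_ge0// sumr_ge0// => i _; case: (CP i).
split=> [x|i x].
  by apply: le_trans (bB x) _; rewrite lerDl sumr_ge0// => i _; case: (CP i).
apply: le_trans ((CP i).2 x) _; rewrite (bigD1 i)//= addrCA lerDl addr_ge0//.
by rewrite sumr_ge0// => j _; case: (CP j).
Qed.

Lemma test_L1 r u du : test r u du -> L1 u.
Proof.
move=> h; have [B B0 [bu _]] := test_bounded h; have [c su] := h.
exact: (L1_bounded_cube (C1_measurable c) bu su).
Qed.

Lemma testM r u du v dv : C1 u du -> test r v dv ->
  test r (fun x => u x * v x) (fun i x => u x * dv i x + v x * du i x).
Proof.
move=> cu [cv sv]; split; first exact: C1M.
by move=> x; rewrite mulf_eq0 negb_or => /andP[_ /sv].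
Qed.

Lemma test_C1c r u du : test r u du -> C1c setT u.
Proof.
move=> [c su]; split => //; first exact: C1_Ck c.
have cl : closure [set x | u x != 0] `<=` cube r.
  by rewrite ((closure_id _).1 (@closed_cube r)); apply: closureS; exact: su.
exact: (subclosed_compact (@closed_closure _ _) (@compact_cube r) cl).
Qed.

End C1.

Section weak_gradient.
Context (R : realType) (n : nat).
Local Notation E := 'rV[R]_n.

Lemma L1loc_L1loc_rV (w : E -> R) : L1loc (lebesgue_rV R n) setT w -> L1loc_rV w.
Proof.
move=> lw r; have := lw _ (@compact_cube R n r) (@subsetT _ _).
move=> /(integrable_mkcond _ (@measurable_cube R n r)) h.
rewrite /L1 (_ : EFin \o _ = (EFin \o w) \_ (cube r))//.
apply/funext => x /=; rewrite /patch indicE; case: ifP => _; rewrite ?mul1r ?mul0r//.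
Qed.

Variables (f : E -> R) (G : E -> E).
Hypothesis fL1 : L1 f.
Hypothesis fG : is_weak_grad f G.

Lemma weak_grad_loc i : L1loc_rV (fun x => G x ord0 i).
Proof. by apply: L1loc_L1loc_rV; case: fG. Qed.

(** The definition of weak gradient, with real integrals and the explicit gradient. *)
Lemma weak_grad_test r u du i : test r u du ->
  intR (fun x => f x * du i x) = - intR (fun x => G x ord0 i * u x).
Proof.
move=> h; have [_ /(_ i _ (test_C1c h))] := fG.
rewrite (eq_integral (fun x => (f x * du i x)%:E)); last first.
  by move=> x _; rewrite (_ : 'D_(ebase i) u x = du i x)//; case: h => -[_ _ d] _; case: (d i x).
have [B B0 [bu bdu]] := test_bounded h; have [c su] := h.
have i1 : L1 (fun x => f x * du i x).
  rewrite (_ : (fun x => _) = (fun x => du i x * f x)); last by apply/funext => x; rewrite mulrC.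
  exact: (L1M (C1_dmeasurable i c) (bdu i)).
have i2 : L1 (fun x => G x ord0 i * u x).
  rewrite (_ : (fun x => _) = (fun x => u x * G x ord0 i)); last by apply/funext => x; rewrite mulrC.
  exact: (L1M_loc (C1_measurable c) bu su (weak_grad_loc i)).
by rewrite (L1_EFin i1) (L1_EFin i2) -EFinN => -[].
Qed.

End weak_gradient.

(** * Increments of a Sobolev function *)

Section sobolev_difference.
Context (R : realType) (n : nat).
Local Notation E := 'rV[R]_n.

Lemma is_derive_lipschitz (F F' : R -> R) (M s : R) :
  (forall t : R, is_derive t 1 F (F' t)) -> (forall t, `|t| <= `|s| -> `|F' t| <= M) ->
  `|F s - F 0| <= `|s| * M.
Proof.
move=> dF bF.
have cF (A : set R) : {within A, continuous F}.
  apply: continuous_subspaceT => t; apply/differentiable_continuous/derivable1_diffP.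
  by case: (dF t).
have [s0|s0] := leP 0 s.
  have [c + ->] := MVT_segment s0 (fun x _ => dF x) (cF _).
  rewrite in_itv/= => /andP[c0 cs]; rewrite subr0 normrM mulrC ler_wpM2l// bF//.
  by rewrite !ger0_norm.
have [c + e] := MVT_segment (ltW s0) (fun x _ => dF x) (cF _).
rewrite in_itv/= => /andP[sc c0]; rewrite distrC e sub0r normrM normrN mulrC ler_wpM2l// bF//.
by rewrite !ler0_norm ?lerN2// ltW.
Qed.

Variables (f : E -> R) (G : E -> E).
Hypothesis fL1 : L1 f.
Hypothesis fG : is_weak_grad f G.

Lemma test_moll d r (w : E -> R) : 0 < d -> L1 w -> (forall x, w x != 0 -> cube r x) ->
  test (r + d) (convol (rho d) w) (fun i => convol (drho d i) w).
Proof.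
move=> d0 iw sw; split; first exact: C1_convol.
move=> x /(conv_rho_supp d0 iw)[z zd /sw h] i.
rewrite (_ : x ord0 i = (x + z) ord0 i - z ord0 i); last by rewrite mxE addrK.
by apply: le_trans (ler_normB _ _) (lerD (h i) (zd i)).
Qed.

(** F t = int u(y + t e_k) f y is differentiable, and by definition of the weak gradient its
derivative is minus the integral of u(y + t e_k) G_k y; the mean value theorem for F on the
segment between 0 and -s concludes. *)
Lemma test_diff1 r u du (k : 'I_n) (s : R) (W : E -> R) : test r u du ->
  (forall y (t : R), `|t| <= `|s| -> `|u (y + t *: ebase k)| <= W y) ->
  L1 (fun y => W y * `|G y ord0 k|) ->
  `|intR (fun y => u y * (f (y + s *: ebase k) - f y))| <=
  `|s| * intR (fun y => W y * `|G y ord0 k|).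
Proof.
move=> h uW iW.
have [B B0 [bu bdu]] := test_bounded h; have [c su] := h.
have mu := C1_measurable c.
pose F (t : R) := intR (fun y => u (t *: ebase k + y) * f y).
pose F' (t : R) := intR (fun y => du k (t *: ebase k + y) * f y).
have dF (t : R) : is_derive t 1 F (F' t).
  have dk x : is_derive x (ebase k) u (du k x) by case: c.
  exact: (is_derive_intR mu bu dk (bdu k) (@measurable_id _ E setT) fL1 t).
have shift_test (t : R) : test (r + `|t|) (fun y : E => u (t *: ebase k + y)) (fun i (y : E) => du i (t *: ebase k + y)).
  split; first exact: C1_shift c.
  move=> y /su uy i.
  rewrite (_ : y ord0 i = (t *: ebase k + y) ord0 i - (t *: ebase k : E) ord0 i).
    apply: le_trans (ler_normB _ _) (lerD (uy i) _).
    rewrite !mxE eqxx/= normrM ler_piMr//.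
    by case: (i == k); rewrite ?normr1 ?normr0.
  by rewrite mxE addrAC subrr add0r.
have F'E (t : R) : F' t = - intR (fun y => G y ord0 k * u (t *: ebase k + y)).
  have ht := shift_test t.
  rewrite -(weak_grad_test fL1 fG k ht); apply: eq_intR => y; exact: mulrC.
have bF (t : R) : `|t| <= `|- s| -> `|F' t| <= intR (fun y => W y * `|G y ord0 k|).
  rewrite normrN => ts; rewrite F'E normrN.
  have W0 y : `|u (t *: ebase k + y)| <= W y by rewrite addrC; exact: uW.
  have [ct st] := shift_test t.
  apply: norm_intR_le => //; last by move=> y; rewrite normrM mulrC ler_wpM2r.
  rewrite (_ : (fun y => _) = (fun y => u (t *: ebase k + y) * G y ord0 k)); last first.
    by apply/funext => y; rewrite mulrC.
  apply: (L1M_loc (C1_measurable ct) _ st (weak_grad_loc fG k)) => y; exact: bu.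
have FE : F (- s) - F 0 = intR (fun y => u y * (f (y + s *: ebase k) - f y)).
  have i0 : L1 (fun y => u y * f y) by exact: (L1M mu bu).
  have is1 : L1 (fun y => u y * f (y + s *: ebase k)).
    by apply: (L1M mu bu); exact: L1_translation.
  transitivity (intR (fun y => u y * f (y + s *: ebase k)) - intR (fun y => u y * f y)).
    congr (_ - _); last by apply: eq_intR => y; rewrite scale0r add0r.
    have [ct st] := shift_test (- s).
    have im : L1 (fun y => u (- s *: ebase k + y) * f y).
      apply: (L1M (C1_measurable ct)) => // y; exact: bu.
    rewrite /F -(intR_translation (s *: ebase k) im).
    by apply: eq_intR => y; rewrite addrCA scaleNr addNr addr0.
  by rewrite -intRB//; apply: eq_intR => y; rewrite mulrBr.
by rewrite -FE -[`|s|]normrN; exact: (is_derive_lipschitz dF bF).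
Qed.

(** Mollify w: the mollifications are test functions with the same envelope W, and by duality the
error is the mollification error of the integrable increment of f. *)
Lemma measurable_diff1 (B : R) r (w : E -> R) (k : 'I_n) (s d0 : R) (W : E -> R) :
  0 < d0 -> measurable_fun setT w -> (forall x, `|w x| <= B) ->
  (forall x, w x != 0 -> cube r x) ->
  (forall y z, `|z| <= `|s| + d0 -> `|w (y + z)| <= W y) ->
  L1 (fun y => W y * `|G y ord0 k|) ->
  `|intR (fun y => w y * (f (y + s *: ebase k) - f y))| <=
  `|s| * intR (fun y => W y * `|G y ord0 k|).
Proof.
move=> d00 mw bw sw wW iW; apply/ler_addgt0Pr => e e0.
have iw : L1 w := L1_bounded_cube mw bw sw.
have B0 : 0 <= B by apply: le_trans (bw 0).
pose q y := f (y + s *: ebase k) - f y.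
have iq : L1 q by apply: L1B => //; exact: L1_translation.
have e1 : 0 < e / (B + 1) by rewrite divr_gt0// ltr_wpDl.
have [d1 d10 qd1] := moll_L1 iq e1.
pose d := Num.min d0 d1.
have dp : 0 < d by rewrite lt_min d00.
have dd0 : d <= d0 by rewrite ge_min lexx.
have dd1 : d <= d1 by rewrite ge_min lexx orbT.
have [iqd qde] := qd1 d dp dd1.
have ht := test_moll dp iw sw.
have [_ ia adj] := conv_rho_adjoint dp iq iw.
have wq : L1 (fun x => w x * q x) by exact: (L1M mw bw).
have -> : intR (fun y => w y * q y) = intR (fun y => convol (rho d) w y * q y)
    - intR (fun y => w y * (convol (rho d) q y - q y)).
  rewrite adj -intRB//; last exact: (L1M mw bw).
  by apply: eq_intR => y; ring.
apply: le_trans (ler_normB _ _) _; apply: lerD.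
  apply: (test_diff1 ht) => // y t ts.
  apply: (conv_rho_norm dp iw) => z zd; rewrite -addrA; apply: wW.
  apply: le_trans (ler_normD _ _) (lerD _ _).
    rewrite normrZ (le_trans _ ts)// ler_piMr//.
    by apply: norm_le_coord => // i; rewrite !mxE; case: (_ && _); rewrite ?normr1 ?normr0.
  by apply: le_trans dd0; apply/cubeE => //; exact: ltW.
apply: (@le_trans _ _ (intR (fun y => B * `|convol (rho d) q y - q y|))).
  apply: norm_intR_le; [exact: (L1M mw bw)|exact/L1Z/L1_norm|].
  by move=> y; rewrite normrM ler_wpM2r.
rewrite intRZ; last exact: L1_norm.
apply: (@le_trans _ _ ((B + 1) * (e / (B + 1)))).
  by apply: ler_pM => //; [exact: intR_ge0|rewrite lerDl].
by rewrite mulrC divfK// gt_eqF// ltr_wpDl.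
Qed.

(** The vertices of the path from 0 to z along the coordinate axes. *)
Definition ztrunc (z : E) (m : nat) : E := \row_j (if (j < m)%N then z ord0 j else 0).

Lemma ztrunc0 z : ztrunc z 0 = 0.
Proof. by apply/rowP => j; rewrite !mxE. Qed.

Lemma ztruncn z : ztrunc z n = z.
Proof. by apply/rowP => j; rewrite !mxE ltn_ord. Qed.

Lemma ztruncS z (k : 'I_n) : ztrunc z k.+1 = ztrunc z k + z ord0 k *: ebase k.
Proof.
apply/rowP => j; rewrite !mxE eqxx/= ltnS leq_eqVlt.
have [->|jk] := eqVneq j k; first by rewrite eqxx ltnn/= mulr1 add0r.
by rewrite -(inj_eq val_inj) in jk; rewrite (negbTE jk)/= mulr0 addr0.
Qed.

Lemma ztrunc_le z m : `|ztrunc z m| <= `|z|.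
Proof.
apply: norm_le_coord => // j; rewrite mxE; case: ifP => _; first exact: coord_le_norm.
by rewrite normr0.
Qed.

(** The path from 0 to z is followed one coordinate at a time.  The radius 3 d is made of at most d
for the vertex of the path, d for the current coordinate and d for the mollification of w. *)
Lemma sobolev_diff (B : R) r (w : E -> R) (d : R) (W : E -> R) :
  0 < d -> measurable_fun setT w -> (forall x, `|w x| <= B) ->
  (forall x, w x != 0 -> cube r x) ->
  (forall y z, `|z| <= 3 * d -> `|w (y + z)| <= W y) ->
  (forall k, L1 (fun y => W y * `|G y ord0 k|)) ->
  forall z, `|z| <= d ->
  `|intR (fun y => w y * (f (y + z) - f y))| <=
  d * \sum_k intR (fun y => W y * `|G y ord0 k|).
Proof.
move=> d0 mw bw sw wW iW z zd.
pose D (m : nat) y := f (y + ztrunc z m.+1) - f (y + ztrunc z m).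
have iD m : L1 (D m) by apply: L1B; exact: L1_translation.
have wD m : L1 (fun y => w y * D m y) by exact: (L1M mw bw).
have -> : intR (fun y => w y * (f (y + z) - f y)) =
    \sum_(k < n) intR (fun y => w y * D k y).
  rewrite -(@intR_sum _ _ _ _ (fun (k : 'I_n) y => w y * D k y))//; apply: eq_intR => y.
  rewrite -mulr_sumr; congr (_ * _); rewrite -(big_mkord xpredT (fun k => D k y)).
  by rewrite /D telescope_sumr// ztrunc0 ztruncn addr0.
apply: le_trans (ler_norm_sum _ _ _) _; rewrite mulr_sumr; apply: ler_sum => k _.
have -> : intR (fun y => w y * D k y) =
    intR (fun y => w (y - ztrunc z k) * (f (y + z ord0 k *: ebase k) - f y)).
  rewrite -(intR_translation (- ztrunc z k) (wD k)); apply: eq_intR => y.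
  by rewrite /D subrK ztruncS addrA subrK.
have zk : `|z ord0 k| <= d by apply: le_trans zd; exact: coord_le_norm.
apply: (@le_trans _ _ (`|z ord0 k| * intR (fun y => W y * `|G y ord0 k|))); last first.
  rewrite ler_wpM2r//; apply: intR_ge0 => y; rewrite mulr_ge0//.
  by apply: le_trans (wW y 0 _); rewrite ?normr0 ?mulr_ge0 ?(ltW d0).
have mt : measurable_fun setT (fun y : E => w (y - ztrunc z k)).
  by apply: (measurableT_comp mw); exact: measurable_addrV.
apply: (measurable_diff1 (B := B) (r := r + d) d0 mt) => //.
- move=> x /sw h i; rewrite (_ : x ord0 i = (x - ztrunc z k) ord0 i + ztrunc z k ord0 i).
    apply: le_trans (ler_normD _ _) (lerD (h i) _).
    by apply: le_trans zd; apply: le_trans (ztrunc_le z k); exact: coord_le_norm.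
  by rewrite !mxE subrK.
- move=> y u ud; rewrite -addrA; apply: wW.
  apply: le_trans (ler_normB _ _) _.
  have := le_trans (ztrunc_le z k) zd; move: ud zk; lra.
Qed.

End sobolev_difference.

Section lipschitz.
Context (R : realType) (n : nat).
Local Notation E := 'rV[R]_n.

Lemma test_lipschitz r (u : E -> R) du : test r u du ->
  exists2 B, 0 <= B & forall y z, `|u (y + z) - u y| <= B * `|z|.
Proof.
move=> h; have [B B0 [bu bdu]] := test_bounded h; have [[cu cdu du'] su] := h.
exists (n%:R * B); first by rewrite mulr_ge0.
move=> y z.
have -> : u (y + z) - u y = \sum_(k < n) (u (y + ztrunc z k.+1) - u (y + ztrunc z k)).
  rewrite -(big_mkord xpredT (fun k => u (y + ztrunc z k.+1) - u (y + ztrunc z k))).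
  by rewrite telescope_sumr// ztrunc0 ztruncn addr0.
apply: le_trans (ler_norm_sum _ _ _) _.
apply: (@le_trans _ _ (\sum_(k < n) (`|z| * B))); last first.
  by rewrite sumr_const card_ord -[leLHS]mulr_natl mulrA mulrAC.
apply: ler_sum => k _; rewrite ztruncS.
have := @is_derive_lipschitz _ (fun t => u (t *: ebase k + (y + ztrunc z k)))
  (fun t => du k (t *: ebase k + (y + ztrunc z k))) B (z ord0 k)
  (is_derive_line (du' k) (y + ztrunc z k)) (fun t _ => bdu k _).
rewrite scale0r add0r [_ + (y + _)]addrC addrA => /le_trans; apply.
by rewrite ler_wpM2r// coord_le_norm.
Qed.

(** A test function is Lipschitz, and its translates by |z| <= 1 are supported in the cube of radius
r + 1. *)
Lemma test_translate_le r (u : E -> R) du om : test r u du -> 0 < om ->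
  exists2 d0, 0 < d0 & forall y z, `|z| <= d0 ->
    `|u (y + z) - u y| <= om * \1_(@cube R n (r + 1)) y.
Proof.
move=> h om0; have [B B0 bB] := test_lipschitz h.
have B1 : 0 < B + 1 by rewrite ltr_wpDl.
exists (Num.min 1 (om / (B + 1))); first by rewrite lt_min ltr01 divr_gt0.
move=> y z; rewrite le_min => /andP[z1 zo].
have [yr|yr] := boolP (y \in @cube R n (r + 1)).
  rewrite indicE yr mulr1; apply: le_trans (bB y z) _.
  apply: (@le_trans _ _ ((B + 1) * (om / (B + 1)))).
    by apply: ler_pM => //; rewrite lerDl.
  by rewrite mulrC divfK// gt_eqF.
have ny : ~ cube (r + 1) y by move=> yr'; move/negP: yr; apply; exact/mem_set.
have [c su] := h.
have u0 : u y = 0.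
  apply/eqP/negPn/negP => /su yr'; apply: ny => i.
  by apply: le_trans (yr' i) _; rewrite lerDl.
have u1 : u (y + z) = 0.
  apply/eqP/negPn/negP => /su yr'; apply: ny => i.
  rewrite (_ : y ord0 i = (y + z) ord0 i - z ord0 i); last by rewrite mxE addrK.
  by apply: le_trans (ler_normB _ _) (lerD (yr' i) (le_trans (coord_le_norm _ _) z1)).
by rewrite u0 u1 subrr normr0 mulr_ge0// ltW.
Qed.

End lipschitz.

(** * Mollification of one layer *)

Section mollified_piece.
Context (R : realType) (n : nat).
Local Notation E := 'rV[R]_n.
Variables (f : E -> R) (G : E -> E).
Hypothesis fL1 : L1 f.
Hypothesis fG : is_weak_grad f G.
Let Gc k x := G x ord0 k.

Variables (M rz ru d : R) (g z : E -> R) (dz : 'I_n -> E -> R)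
  (u : E -> R) (du : 'I_n -> E -> R).
Hypotheses (mg : measurable_fun setT g) (gM : forall x, `|g x| <= M).
Hypotheses (tz : test rz z dz) (tu : test ru u du) (u1 : forall x, `|u x| <= 1).
Hypothesis d0 : 0 < d.
Variable k : 'I_n.

Let M0 : 0 <= M. Proof. exact: le_trans (gM 0). Qed.

(** The k-th part of the functional in the weighted variation of the field with components u. *)
Definition wdiv x := du k x * f x + u x * Gc k x.

Let iuf : L1 (fun x => u x * f x).
Proof. exact: (L1M (C1_measurable tu.1) u1). Qed.

Lemma L1_wdiv : L1 wdiv.
Proof.
have [B B0 [bu bdu]] := test_bounded tu.
apply: L1D; first exact: (L1M (C1_dmeasurable k tu.1) (bdu k)).
exact: (L1M_loc (C1_measurable tu.1) bu tu.2 (weak_grad_loc fG k)).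
Qed.

(** The weak gradient of f is tested against x |-> rho d (y - x) u x; reflection changes the sign of
the derivative of the mollifier. *)
Lemma convol_wdiv y : convol (rho d) wdiv y =
  intR (fun x => drho d k (y - x) * (u x * f x)).
Proof.
have [B B0 [bu bdu]] := test_bounded tu.
have tp := testM (C1_rho_reflect d y) tu.
have [B' B'0 [bp bdp]] := test_bounded tp.
have := weak_grad_test fL1 fG k tp.
have [Bd Bd0 bdr] := @kern_bounded R n ((rho_mass n d)^-1 / d) d (kern_upd (@ebump1 R n) k).
have i1 : L1 (fun x => drho d k (y - x) * (u x * f x)).
  exact: (L1_conv_integrand y (measurable_kern _ _ _) bdr iuf).
have [Br Br0 br] := rho_bounded n d.
have i2 : L1 (fun x => rho d (y - x) * (du k x * f x)).
  apply: (L1_conv_integrand y (measurable_rho d) br).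
  exact: (L1M (C1_dmeasurable k tu.1) (bdu k)).
have i3 : L1 (fun x => rho d (y - x) * (u x * Gc k x)).
  apply: (L1_conv_integrand y (measurable_rho d) br).
  exact: (L1M_loc (C1_measurable tu.1) bu tu.2 (weak_grad_loc fG k)).
rewrite (@eq_intR _ _ _ (fun x => rho d (y - x) * (du k x * f x) - drho d k (y - x) * (u x * f x))); last first.
  by move=> x; ring.
rewrite intRB// [in RHS](@eq_intR _ _ _ (fun x => rho d (y - x) * (u x * Gc k x))); last first.
  by move=> x; rewrite /Gc; ring.
move=> e; rewrite /convol.
rewrite (@eq_intR _ _ _ (fun x => rho d (y - x) * (du k x * f x) + rho d (y - x) * (u x * Gc k x))); last first.
  by move=> x; rewrite /wdiv; ring.
by rewrite intRD//; lra.
Qed.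

(** What is lost when f is pulled out of the convolution. *)
Definition commutator y := intR (fun x => drho d k (y - x) * (u x * (f x - f y))).

Let Tu := convol (rho d) u.
Let dTu := convol (drho d k) u.

Let iu : L1 u := test_L1 tu.

Lemma convol_wdiv_split y : convol (rho d) wdiv y = f y * dTu y + commutator y.
Proof.
have [Bd Bd0 bdr] := @kern_bounded R n ((rho_mass n d)^-1 / d) d (kern_upd (@ebump1 R n) k).
have i1 : L1 (fun x => drho d k (y - x) * (u x * f x)).
  exact: (L1_conv_integrand y (measurable_kern _ _ _) bdr iuf).
have i2 : L1 (fun x => drho d k (y - x) * u x).
  exact: (L1_conv_integrand y (measurable_kern _ _ _) bdr iu).
rewrite convol_wdiv /dTu /convol -intRZ//.
have i3 : L1 (fun x => drho d k (y - x) * (u x * (f x - f y))).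
  rewrite (_ : (fun x => _) = (fun x => drho d k (y - x) * (u x * f x) - f y * (drho d k (y - x) * u x))).
    by apply: L1B => //; exact: L1Z.
  by apply/funext => x; ring.
rewrite /commutator -intRD//; last exact: L1Z.
by apply: eq_intR => x; ring.
Qed.

Let gz x := g x * z x.
Let psi x := z x * Tu x.
Let dpsi x := z x * dTu x + Tu x * dz k x.

Lemma Tu1 x : `|Tu x| <= 1.
Proof. by apply: (conv_rho_norm d0 iu) => y _; exact: u1. Qed.

Let mgz : measurable_fun setT gz.
Proof. by apply: measurable_funM => //; exact: C1_measurable tz.1. Qed.

Lemma gz_bounded : exists2 B, 0 <= B & forall x, `|gz x| <= B.
Proof.
have [B B0 [bz bdz]] := test_bounded tz; exists (M * B); first by rewrite mulr_ge0.
by move=> x; rewrite normrM ler_pM.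
Qed.

Let gz_supp x : gz x != 0 -> cube rz x.
Proof. by rewrite mulf_eq0 negb_or => /andP[_ /(tz.2 x)]. Qed.

Lemma L1_gz : L1 gz.
Proof.
have [B B0 bB] := gz_bounded; exact: (L1_bounded_cube mgz bB gz_supp).
Qed.

Variables (om : R).
Hypothesis om0 : 0 <= om.
Hypothesis z0 : forall x, 0 <= z x.
Hypothesis zom : forall y v, `|v| <= 3 * d ->
  `|z (y + v) - z y| <= om * \1_(@cube R n (rz + 1)) y.

(** Dominates the translates of |g| z by |v| <= 3 d. *)
Definition envelope y := M * (z y + om * \1_(@cube R n (rz + 1)) y).

Lemma L1_envelope j : L1 (fun y => envelope y * `|Gc j y|).
Proof.
have lG : L1loc_rV (fun y => `|Gc j y|).
  move=> r; have := L1_norm (weak_grad_loc fG j r).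
  congr L1; apply/funext => x; rewrite normrM ger0_norm// indicE//.
have [B B0 [bz bdz]] := test_bounded tz.
rewrite (_ : (fun y => _) = (fun y => M * (z y * `|Gc j y|) +
   M * om * (\1_(@cube R n (rz + 1)) y * `|Gc j y|))).
  apply: L1D; last exact: L1Z.
  apply: L1Z; exact: (L1M_loc (C1_measurable tz.1) bz tz.2 lG).
by apply/funext => y; rewrite /envelope; ring.
Qed.

(** After the change of variables x = y + v, Fubini puts the integral in v outside: for fixed v the
integral in y is an increment of f against a bounded function, of size at most d times an integral
of the gradient by [sobolev_diff], and the kernel has mass at most Cdrho / d. *)
Lemma commutator_bound : L1 (fun y => gz y * commutator y) /\
  `|intR (fun y => gz y * commutator y)| <= Cdrho R n * \sum_j intR (fun y => envelope y * `|Gc j y|).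
Proof.
have [Bd Bd0 bdr] := @kern_bounded R n ((rho_mass n d)^-1 / d) d (kern_upd (@ebump1 R n) k).
have [B B0 bgz] := gz_bounded.
(* K is the kernel in the variable v = x - y *)
pose K (v : E) := drho d k (- v).
have mK : measurable_fun setT K.
  apply: (measurableT_comp (measurable_kern _ _ _)).
  apply: measurable_fun_rVP => i; rewrite (_ : _ \o _ = (fun v : E => - rVcoord i v)).
    by apply: measurableT_comp => //; exact: measurable_rVcoord.
  by apply/funext => v; rewrite /rVcoord/= mxE.
have bK v : `|K v| <= Bd by exact: bdr.
have sK v : K v != 0 -> cube d v.
  by move=> /(kern_supp d0) h i; have := h i; rewrite mxE normrN.
pose q (p : E * E) := gz p.2 * u (p.2 + p.1) * (f (p.2 + p.1) - f p.2).
have ms : measurable_fun setT (fun p : E * E => p.2 + p.1).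
  by apply: (measurable_fun_rV_comp _ _).2; [exact: measurable_snd|exact: measurable_fst].
have mf := L1_measurable fL1.
have mq : measurable_fun setT q.
  apply: measurable_funM.
    apply: measurable_funM; first by apply: (measurableT_comp mgz); exact: measurable_snd.
    exact: (measurableT_comp (C1_measurable tu.1) ms).
  apply: measurable_funB; first exact: (measurableT_comp mf ms).
  by apply: (measurableT_comp mf); exact: measurable_snd.
pose w v (y : E) := gz y * u (y + v).
have mw v : measurable_fun setT (w v).
  apply: measurable_funM => //; apply: (measurableT_comp (C1_measurable tu.1)).
  exact: measurable_addrV.
have bw v y : `|w v y| <= B by rewrite normrM -[B]mulr1 ler_pM.
have sw v y : w v y != 0 -> cube rz y.
  by rewrite mulf_eq0 negb_or => /andP[/gz_supp].
have ifv v : L1 (fun y => f (y + v) - f y) by apply: L1B => //; exact: L1_translation.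
pose e := B * (intR (fun y => `|f y|) + intR (fun y => `|f y|)).
have e0 : 0 <= e by rewrite mulr_ge0// addr_ge0// intR_ge0.
have hq1 v : cube d v -> L1 (fun y => q (v, y)) /\ intR (fun y => `|q (v, y)|) <= e.
  move=> _; have iq : L1 (fun y => q (v, y)) by exact: (L1M (mw v) (bw v) (ifv v)).
  split => //.
  have ifz : L1 (fun y => `|f (y + v)|).
    by apply: (L1_translation (w := fun y => `|f y|)); exact: L1_norm.
  rewrite /e -{1}(intR_translation v (L1_norm fL1)) -intRD//; last exact: L1_norm.
  rewrite -intRZ; last by apply: L1D => //; exact: L1_norm.
  apply: le_intR => [||y]; first exact: L1_norm.
    by apply: L1Z; apply: L1D => //; exact: L1_norm.
  by rewrite /q/= normrM ler_pM//; [exact: (bw v y)|exact: ler_normB].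
have qE y : (fun v => K v * q (v, y)) = (fun v => gz y * ((fun x => drho d k (y - x) * (u x * (f x - f y))) (v + y))).
  apply/funext => v; rewrite /K /q/= [v + y]addrC opprD addrA subrr add0r; ring.
have iQ y : L1 (fun x => drho d k (y - x) * (u x * (f x - f y))).
  apply: (L1_conv_integrand y (measurable_kern _ _ _) bdr).
  rewrite (_ : (fun x => _) = (fun x => u x * f x - f y * u x)); last by apply/funext => x; ring.
  by apply: L1B => //; exact: L1Z.
have hq2 y : L1 (fun v => K v * q (v, y)).
  by rewrite qE; apply: L1Z; exact: (L1_translation y (iQ y)).
have [j1 j2 j3 _] := kernel_fubini mK bK sK mq e0 hq1 hq2.
have QE y : intR (fun v => K v * q (v, y)) = gz y * commutator y.
  rewrite qE intRZ; last exact: (L1_translation y (iQ y)).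
  by rewrite (intR_translation y (iQ y)).
have jE : (fun y => gz y * commutator y) = (fun y => intR (fun v => K v * q (v, y))).
  by apply/funext => y; rewrite QE.
split; first by rewrite jE.
rewrite jE j2.
pose S := \sum_j intR (fun y => envelope y * `|Gc j y|).
have S0 : 0 <= S.
  apply: sumr_ge0 => j _; apply: intR_ge0 => y; rewrite mulr_ge0// mulr_ge0// addr_ge0//.
  by rewrite mulr_ge0// indicE.
have sob v : cube d v -> `|intR (fun y => q (v, y))| <= d * S.
  move=> /cubeE -/(_ (ltW d0)) vd.
  apply: (sobolev_diff fL1 fG d0 (mw v) (bw v) (sw v) _ _ vd); last exact: L1_envelope.
  move=> y t td; rewrite /w normrM -[leRHS]mulr1; apply: ler_pM => //.
  rewrite /gz normrM; apply: ler_pM => //.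
  rewrite (ger0_norm (z0 _)); have := zom y td; rewrite ler_norml => /andP[_ h].
  by lra.
have iK : L1 K by exact: (L1_bounded_cube mK bK sK).
have KE : intR (fun v => `|K v|) = intR (fun v => `|drho d k v|).
  rewrite /K (_ : (fun v => `|drho d k (- v)|) = (fun v => `|drho d k v|))//.
  apply/funext => v; rewrite /drho /kern !normrM !normr_prod; congr (_ * _).
  apply: eq_bigr => j _; rewrite mxE mulNr /kern_upd; case: eqP => _ /=.
    rewrite /ebump normrN; case: ifP => // _; rewrite sqrrN !normrM; congr (_ * _ * _).
    rewrite /ebump_deriv derivC mul0r mulr0 scale0r addr0 mul0r sub0r mulr1.
    by rewrite !hornerN !hornerZ !hornerX mulrN opprK normrN.
  by rewrite ebump1N.
apply: (@le_trans _ _ (intR (fun v => (d * S) * `|K v|))).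
  apply: norm_intR_le; [exact: j3|exact/L1Z/L1_norm|].
  move=> v; rewrite normrM mulrC.
  have [->|/sK/sob h] := eqVneq (K v) 0; first by rewrite normr0 !mulr0.
  by rewrite ler_wpM2r.
rewrite intRZ; last exact: L1_norm.
rewrite KE; have := intR_drho_le k d0 => h.
apply: (@le_trans _ _ (d * S * (Cdrho R n / d))).
  by apply: ler_wpM2l; [apply: mulr_ge0; [exact: ltW|exact: S0]|exact: h].
rewrite -/S; move: (gt_eqF d0) => d0'; rewrite le_eqVlt; apply/orP; left; apply/eqP; by field; rewrite d0'.
Qed.

(** The mollifier is moved to the test functional, f is pulled out of it, and the product rule for
z Tu makes the weighted divergence of z Tu appear. *)
Lemma mollified_piece : exists err : R,
  [/\ `|err| <= Cdrho R n * \sum_j intR (fun y => envelope y * `|Gc j y|),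
   L1 (fun x => g x * (dpsi x * f x + psi x * Gc k x)),
   L1 (fun x => g x * f x * dz k x * Tu x),
   L1 (fun x => g x * (psi x * Gc k x)) &
   intR (fun x => convol (rho d) gz x * wdiv x) =
     intR (fun x => g x * (dpsi x * f x + psi x * Gc k x))
     - intR (fun x => g x * f x * dz k x * Tu x)
     - intR (fun x => g x * (psi x * Gc k x)) + err].
Proof.
have [iQ eQ] := commutator_bound.
have [_ iT adj] := conv_rho_adjoint d0 L1_wdiv L1_gz.
have [B B0 [bz bdz]] := test_bounded tz.
have mTu : measurable_fun setT Tu by exact: measurable_conv_rho.
have ia : L1 (fun x => gz x * (f x * dTu x)).
  have := L1B iT iQ; congr L1; apply/funext => y.
  by rewrite convol_wdiv_split; ring.
have ib : L1 (fun x => g x * f x * dz k x * Tu x).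
  rewrite (_ : (fun x => _) = (fun x => (g x * dz k x * Tu x) * f x)); last first.
    by apply/funext => x; ring.
  apply: (@L1M _ _ (M * B)) => //.
    apply: measurable_funM => //; apply: measurable_funM => //.
    exact: C1_dmeasurable tz.1.
  by move=> x; rewrite -[M * B]mulr1 2!normrM; apply: ler_pM; rewrite ?mulr_ge0 ?ler_pM ?Tu1.
have ic : L1 (fun x => g x * (psi x * Gc k x)).
  rewrite (_ : (fun x => _) = (fun x => (g x * psi x) * Gc k x)); last first.
    by apply/funext => x; ring.
  apply: (@L1M_loc _ _ (M * B) rz); last exact: (weak_grad_loc fG k).
  - apply: measurable_funM => //; apply: measurable_funM => //.
    exact: C1_measurable tz.1.
  - move=> x; rewrite normrM; apply: ler_pM => //.
    by rewrite normrM -[B]mulr1; apply: ler_pM => //; exact: Tu1.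
  - by move=> x; rewrite mulf_eq0 negb_or => /andP[_]; rewrite mulf_eq0 negb_or => /andP[/(tz.2 x)].
have id : L1 (fun x => g x * (dpsi x * f x + psi x * Gc k x)).
  have := L1D (L1D ia ib) ic; congr L1; apply/funext => x.
  by rewrite /gz /dpsi; ring.
exists (intR (fun y => gz y * commutator y)); split => //.
rewrite adj -intRB// -intRB//; last exact: L1B.
rewrite -intRD//; last by apply: L1B => //; exact: L1B.
by apply: eq_intR => x; rewrite convol_wdiv_split /gz /dpsi; ring.
Qed.

End mollified_piece.

(** * A partition of an open set into layers *)

Section inner_sets.
Context (R : realType) (n : nat).
Local Notation E := 'rV[R]_n.
Variable U : set E.
Hypothesis oU : open U.

Definition inner (r : R) : set E := [set x | forall y, `|y - x| < r -> U y].

Lemma inner_le r s : r <= s -> inner s `<=` inner r.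
Proof. by move=> rs x h y yx; apply: h; exact: lt_le_trans rs. Qed.

Lemma inner_sub r : 0 < r -> inner r `<=` U.
Proof. by move=> r0 x; apply; rewrite subrr normr0. Qed.

Lemma inner_shift r s x z : inner r x -> `|z| <= s -> inner (r - s) (x + z).
Proof.
move=> h zs y yx; apply: h.
rewrite (_ : y - x = (y - (x + z)) + z); last by rewrite opprD addrA subrK.
by apply: le_lt_trans (ler_normD _ _) _; move: yx zs; lra.
Qed.

Lemma closed_inner r : closed (inner r).
Proof.
rewrite (_ : inner r = ~` (\bigcup_(y in ~` U) ball y r)).
  apply: open_closedC; apply: bigcup_open => y _; exact: ball_open.
apply/seteqP; split => x /=.
  move=> h [y nUy]; rewrite mx_norm_ball/= => yx; exact/nUy/h.
move=> h y yx; apply: contrapT => nUy; apply: h; exists y => //.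
by rewrite mx_norm_ball.
Qed.

Lemma measurable_inner r : measurable (inner r).
Proof.
rewrite -[inner r]setCK; apply: measurableC; apply: open_measurable_rV.
by apply: closed_openC; exact: closed_inner.
Qed.

(** Compactness turns the balls around the points of K that are contained in U into balls of the same
radius. *)
Lemma compact_inner K : compact K -> K `<=` U -> exists2 r, 0 < r & K `<=` inner r.
Proof.
move=> cK KU.
have /compact_near_coveringP nc := cK.
have : \forall r \near (0 : R)^'+, K `<=` inner r.
  apply: nc => x Kx; have /nbhs_ballP[e /= e0 eU] := oU (KU x Kx).
  have e2 : 0 < e / 2 by rewrite divr_gt0.
  exists (ball x (e / 2), [set r | r < e / 2]).
    by split=> /=; [exact: nbhsx_ballx|exact: nbhs_right_lt].
  move=> [x' r] /= [xx' re] y yx'; apply: eU.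
  move: xx'; rewrite mx_norm_ball/= => xx'.
  rewrite (_ : x - y = (x - x') - (y - x')); last by rewrite opprB addrA subrK.
  by apply: le_lt_trans (ler_normB _ _) _; move: xx' re yx'; lra.
move=> h; have : \forall r \near (0 : R)^'+, 0 < r /\ K `<=` inner r.
  by apply: filterI h; exact: nbhs_right_gt.
by move=> /filter_ex[r [r0 Kr]]; exists r.
Qed.

End inner_sets.

Section smooth_indicators.
Context (R : realType) (n : nat).
Local Notation E := 'rV[R]_n.

(** All cutoff functions below are of this form. *)
Definition smooth_indic d (A : set E) := convol (rho d) (\1_A : E -> R).
Definition dsmooth_indic d (A : set E) i := convol (drho d i) (\1_A : E -> R).

Lemma L1_indic_cube r (A : set E) : measurable A -> A `<=` cube r -> L1 (\1_A : E -> R).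
Proof.
move=> mA Ar; apply: (@L1_bounded_cube _ _ 1 r); first exact: measurable_indic.
  by move=> x; rewrite indicE; case: (_ \in _); rewrite ?normr0 ?normr1.
by move=> x; rewrite indicE pnatr_eq0 eqb0 negbK => /set_mem /Ar.
Qed.

Lemma smooth_indic_props d r (A : set E) : 0 < d -> measurable A -> A `<=` cube r ->
  [/\ test (r + d) (smooth_indic d A) (dsmooth_indic d A),
      forall x, 0 <= smooth_indic d A x <= 1,
      forall x, (forall z, `|z| <= d -> A (x + z)) -> smooth_indic d A x = 1 &
      forall x, (forall z, `|z| <= d -> ~ A (x + z)) -> smooth_indic d A x = 0].
Proof.
move=> d0 mA Ar; have iA := L1_indic_cube mA Ar; split.
- apply: test_moll => // x; rewrite indicE pnatr_eq0 eqb0 negbK => /set_mem; exact: Ar.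
- move=> x; apply: conv_rho_bounds => // z _; rewrite indicE.
  by case: (_ \in _); rewrite lexx ler01.
- move=> x h; apply/eqP; rewrite eq_le andbC; apply: conv_rho_bounds => // z.
  by move=> /cubeE-/(_ (ltW d0)) /h Az; rewrite indicE mem_set// lexx.
- move=> x h; apply/eqP; rewrite eq_le andbC; apply: conv_rho_bounds => // z.
  by move=> /cubeE-/(_ (ltW d0)) /h Az; rewrite indicE memNset// lexx.
Qed.

(** The difference quotients vanish for small increments. *)
Lemma C1_locally_cst (u : E -> R) du (O : set E) (c : R) x i : C1 u du -> open O -> O x ->
  (forall y, O y -> u y = c) -> du i x = 0.
Proof.
move=> [cu cdu d] oO Ox uc.
have h : \forall y \near x, cst c y = u y.
  have : nbhs x O by exact: open_nbhs_nbhs.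
  by apply: filterS => y /uc.
have d0 := near_eq_is_derive h (is_derive_cst c x (ebase i)).
by case: (d i x) => _ <-; case: d0 => _ ->.
Qed.

Lemma open_norm_lt r (c : E) : open [set x | `|x - c| < r].
Proof.
rewrite (_ : [set _ | _] = ball c r); first exact: ball_open.
by apply/seteqP; split=> x; rewrite mx_norm_ball /ball_/= distrC.
Qed.

(** The bound does not depend on A: this makes the derivative of the cutoff at infinity bounded
uniformly in its radius. *)
Lemma dsmooth_indic_bound d : 0 < d -> exists2 C, 0 <= C & forall (A : set E) r x i,
  measurable A -> A `<=` cube r -> `|dsmooth_indic d A i x| <= C.
Proof.
move=> d0.
have /choice[B BP] (i : 'I_n) : exists B, 0 <= B /\ forall x : E, `|drho d i x| <= B.
  by have [B B0 bB] := @kern_bounded R n ((rho_mass n d)^-1 / d) d (kern_upd (@ebump1 R n) i); exists B.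
exists ((\sum_i B i) * (2 * d) ^+ n).
  rewrite mulr_ge0 ?exprn_ge0 ?mulr_ge0 ?(ltW d0)// sumr_ge0// => i _; exact: (BP i).1.
move=> A r x i mA Ar; have iA := L1_indic_cube mA Ar.
rewrite -(intR_cube n (ltW d0)) -(intR_translation (- x) (L1_cube n d)) -intRZ; last first.
  exact: (L1_translation (- x) (L1_cube n d)).
apply: norm_intR_le.
- exact: (L1_conv_integrand x (measurable_kern _ _ _) (BP i).2 iA).
- by apply: L1Z; exact: (L1_translation (- x) (L1_cube n d)).
move=> y; have S0 : 0 <= \sum_i B i by rewrite sumr_ge0// => j _; exact: (BP j).1.
have [->|k0] := eqVneq (drho d i (x - y)) 0.
  by rewrite mul0r normr0 mulr_ge0// indicE.
have yx : cube d (y - x).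
  by move=> j; have := kern_supp d0 k0 j; rewrite !mxE distrC.
rewrite [\1_(cube d) _]indicE mem_set// normrM; apply: ler_pM => //.
  by apply: le_trans ((BP i).2 _) _; rewrite (bigD1 i)//= lerDl sumr_ge0// => j _; exact: (BP j).1.
by rewrite indicE; case: (_ \in _); rewrite ?normr0 ?normr1.
Qed.

End smooth_indicators.

Section partition.
Context (R : realType) (n : nat).
Local Notation E := 'rV[R]_n.
Variable U : set E.
Variable r0 : R.

(** Equal to 1 on the cube of radius r0 - 1 and 0 outside the cube of radius r0 + 1. *)
Definition cutoff := smooth_indic 1 (@cube R n r0).
Definition dcutoff := dsmooth_indic 1 (@cube R n r0).

Definition layer_rad (j : nat) : R := 4^-1 ^+ j.

Lemma layer_rad_gt0 j : 0 < layer_rad j. Proof. by rewrite exprn_gt0// invr_gt0. Qed.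

Lemma layer_radS j : layer_rad j.+1 = layer_rad j / 4. Proof. by rewrite /layer_rad exprS mulrC. Qed.

Lemma layer_rad_le1 j : layer_rad j <= 1.
Proof. by rewrite /layer_rad exprn_ile1 ?invr_ge0//; lra. Qed.

Lemma layer_rad_le i j : (i <= j)%N -> layer_rad j <= layer_rad i.
Proof. by move=> ij; rewrite /layer_rad ler_wiXn2l ?invr_ge0//; lra. Qed.

Definition block j := inner U (layer_rad j) `&` @cube R n (r0 + 3).

(** The mollification radius is small enough for chi j to be 1 at depth (3/2) 4^-j and to be supported
at depth 4^-j / 2; in particular chi (j + 1) is 1 on the support of chi j, near the support of the
cutoff. *)
Definition chi j := smooth_indic (layer_rad j / 4) (block j).
Definition dchi j := dsmooth_indic (layer_rad j / 4) (block j).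

Lemma cutoff_props : [/\ test (r0 + 1) cutoff dcutoff, forall x, 0 <= cutoff x <= 1 &
  forall x, cube (r0 - 1) x -> cutoff x = 1].
Proof.
have [h1 h2 h3 _] := smooth_indic_props ltr01 (@measurable_cube R n r0) (@subset_refl _ _).
split=> // x xr; apply: h3 => z z1 i; rewrite mxE.
apply: le_trans (ler_normD _ _) _.
have := xr i; have := le_trans (coord_le_norm z i) z1; lra.
Qed.

Lemma dcutoff_eq0 x i : `|x| < r0 - 1 -> dcutoff i x = 0.
Proof.
move=> xr; have [[c _] _ k1] := cutoff_props.
apply: (C1_locally_cst (O := [set x : E | `|x - 0| < r0 - 1]) (c := 1) i c).
- exact: open_norm_lt.
- by rewrite /= subr0.
- move=> y /=; rewrite subr0 => yr; apply: k1; apply/cubeE; last exact: ltW.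
  exact: le_trans (normr_ge0 y) (ltW yr).
Qed.

Lemma measurable_block j : measurable (block j).
Proof. by apply: measurableI; [exact: measurable_inner|exact: measurable_cube]. Qed.

Lemma chi_props j : [/\ test (r0 + 4) (chi j) (dchi j), forall x, 0 <= chi j x <= 1,
  forall x, inner U (3 / 2 * layer_rad j) x -> cube (r0 + 2) x -> chi j x = 1 &
  forall x, chi j x != 0 -> inner U (layer_rad j / 2) x].
Proof.
have j0 := layer_rad_gt0 j; have j1 := layer_rad_le1 j.
have d0 : 0 < layer_rad j / 4 by rewrite divr_gt0.
have [[c s] h2 h3 h4] := smooth_indic_props d0 (measurable_block j) (@subIsetr _ _ _).
split=> //.
- split=> // x /s xr i; apply: le_trans (xr i) _; lra.
- move=> x xi xr; apply: h3 => z zj; split.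
    by apply: (inner_le _ (inner_shift xi zj)); lra.
  move=> i; rewrite mxE; apply: le_trans (ler_normD _ _) _.
  have := xr i; have := le_trans (coord_le_norm z i) zj; lra.
- move=> x; apply: contra_neqP => nx; apply: h4 => z zj [h _]; apply: nx.
  rewrite -[x](addrK z); apply: (inner_le _ (inner_shift h _)); last by rewrite normrN; exact: zj.
  lra.
Qed.

Definition zeta j x := (if j is i.+1 then chi j x - chi i x else chi j x) * cutoff x.

Definition dpre j k x := if j is i.+1 then dchi j k x - dchi i k x else dchi j k x.

Definition dzeta j k x :=
  (if j is i.+1 then chi j x - chi i x else chi j x) * dcutoff k x + cutoff x * dpre j k x.

Lemma zeta_test j : test (r0 + 1) (zeta j) (dzeta j).
Proof.
have [tk _ _] := cutoff_props.
case: j => [|j]; apply: testM tk.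
  by have [[]] := chi_props 0.
have [[c1 _] _ _ _] := chi_props j.+1; have [[c2 _] _ _ _] := chi_props j.
exact: (C1D c1 (C1N c2)).
Qed.

Lemma chi_incr j x : cube (r0 + 1) x -> chi j x <= chi j.+1 x.
Proof.
move=> xr; have [_ h1 h2 h3] := chi_props j; have [_ h1' h2' h3'] := chi_props j.+1.
have [->|/h3 xi] := eqVneq (chi j x) 0; first by case/andP: (h1' x).
rewrite h2'; first by case/andP: (h1 x).
  by apply: inner_le xi; rewrite layer_radS; have := layer_rad_gt0 j; lra.
by move=> i; apply: le_trans (xr i) _; lra.
Qed.

Lemma cutoff_cube x : cutoff x != 0 -> cube (r0 + 1) x.
Proof. by have [[_ s] _ _] := cutoff_props => /s. Qed.

Lemma zeta_ge0 j x : 0 <= zeta j x.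
Proof.
have [_ k01 _] := cutoff_props; have /andP[k0 k1] := k01 x.
rewrite /zeta; have [->|/cutoff_cube xr] := eqVneq (cutoff x) 0; first by rewrite mulr0.
rewrite mulr_ge0//; case: j => [|j]; last by rewrite subr_ge0 chi_incr.
by have [_ h1 _ _] := chi_props 0; case/andP: (h1 x).
Qed.

Lemma sum_zeta N x : \sum_(j < N.+1) zeta j x = chi N x * cutoff x.
Proof.
elim: N => [|N IH]; first by rewrite big_ord_recr big_ord0/= add0r.
by rewrite big_ord_recr IH /= /zeta; ring.
Qed.

Lemma sum_dzeta N k x : \sum_(j < N.+1) dzeta j k x = chi N x * dcutoff k x + cutoff x * dchi N k x.
Proof.
elim: N => [|N IH]; first by rewrite big_ord_recr big_ord0/= add0r.
by rewrite big_ord_recr IH /= /dzeta /dpre; ring.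
Qed.

Lemma zeta_supp j x : zeta j x != 0 -> inner U (layer_rad j / 2) x.
Proof.
have [_ _ _ h3] := chi_props j.
rewrite mulf_eq0 negb_or => /andP[+ _]; case: j h3 => [|j] h3; first exact: h3.
have [_ _ _ h3'] := chi_props j.
have [c0|/h3//] := eqVneq (chi j.+1 x) 0.
rewrite c0 sub0r oppr_eq0 => /h3'; apply: inner_le.
by rewrite layer_radS; have := layer_rad_gt0 j; lra.
Qed.

(** Both chi j and chi (j + 1) are 1 there, on the support of the cutoff. *)
Lemma zeta_eq0 j x : inner U (3 / 2 * layer_rad j) x -> zeta j.+1 x = 0.
Proof.
move=> xi; rewrite /zeta; have [->|/cutoff_cube xr] := eqVneq (cutoff x) 0; first by rewrite mulr0.
have xr' : cube (r0 + 2) x by move=> i; apply: le_trans (xr i) _; lra.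
have [_ _ h2 _] := chi_props j; have [_ _ h2' _] := chi_props j.+1.
rewrite h2// h2' ?subrr ?mul0r//.
by apply: inner_le xi; rewrite layer_radS; have := layer_rad_gt0 j; lra.
Qed.

Lemma chi_cutoff_inner N x : inner U (3 / 2 * layer_rad N) x -> chi N x * cutoff x = cutoff x.
Proof.
move=> xi; have [->|/cutoff_cube xr] := eqVneq (cutoff x) 0; first by rewrite mulr0.
have [_ _ h2 _] := chi_props N; rewrite h2 ?mul1r// => i.
by apply: le_trans (xr i) _; lra.
Qed.

(** At depth 2 4^-N the function chi N is 1 in a whole neighbourhood. *)
Lemma sum_dzeta_inner N k x : inner U (2 * layer_rad N) x ->
  \sum_(j < N.+1) dzeta j k x = dcutoff k x.
Proof.
move=> xi; rewrite sum_dzeta; have N0 := layer_rad_gt0 N.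
have [[c s] _ h2 _] := chi_props N; have [tk _ _] := cutoff_props.
have [xr|nxr] := pselect (cube (r0 + 1) x); last first.
  have k0 : cutoff x = 0 by apply/eqP; apply: contra_notT nxr; exact: cutoff_cube.
  have dk0 : dcutoff k x = 0.
    by apply/eqP; apply: contra_notT nxr; exact: (test_dsupp tk).
  by rewrite k0 dk0 mulr0 mul0r addr0.
have xr2 : cube (r0 + 2) x by move=> i; apply: le_trans (xr i) _; lra.
rewrite h2//; last by apply: inner_le xi; lra.
suff -> : dchi N k x = 0 by rewrite mul1r mulr0 addr0.
apply: (C1_locally_cst (O := [set y : E | `|y - x| < layer_rad N / 2]) (c := 1) k c).
- exact: open_norm_lt.
- by rewrite /= subrr normr0 divr_gt0.
move=> y /= yx; apply: h2.
  rewrite (_ : y = x + (y - x)); last by rewrite addrC subrK.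
  by apply: (inner_le _ (inner_shift xi (ltW yx))); lra.
move=> i; rewrite (_ : y ord0 i = x ord0 i + (y - x) ord0 i); last by rewrite !mxE; ring.
apply: le_trans (ler_normD _ _) _.
have := xr i; have := le_trans (coord_le_norm (y - x) i) (ltW yx); have := layer_rad_le1 N; lra.
Qed.

Lemma sum_zeta_le N x : \sum_(j < N.+1) zeta j x <= cutoff x * \1_U x.
Proof.
rewrite sum_zeta; have [_ k01 _] := cutoff_props; have /andP[k0 _] := k01 x.
have [_ h1 _ h3] := chi_props N; have /andP[c0 c1] := h1 x.
have [->|/h3 xi] := eqVneq (chi N x) 0; first by rewrite mul0r mulr_ge0// indicE.
rewrite indicE mem_set ?mulr1; first by rewrite ler_piMl.
by apply: inner_sub xi; rewrite divr_gt0// layer_rad_gt0.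
Qed.

End partition.

(** * Choice of the mollification scales *)

Section jensen.
Context (R : realType) (n : nat).
Local Notation E := 'rV[R]_n.

(** The variance is nonnegative.  The weights may have total mass less than 1. *)
Lemma sqr_convex (I : finType) (l v : I -> R) : (forall i, 0 <= l i) -> \sum_i l i <= 1 ->
  (\sum_i l i * v i) ^+ 2 <= \sum_i l i * v i ^+ 2.
Proof.
move=> l0 l1; set c := \sum_i l i * v i.
have : 0 <= \sum_i l i * (v i - c) ^+ 2.
  by apply: sumr_ge0 => i _; rewrite mulr_ge0// sqr_ge0.
have -> : \sum_i l i * (v i - c) ^+ 2 =
    \sum_i l i * v i ^+ 2 - 2 * c * (\sum_i l i * v i) + c ^+ 2 * \sum_i l i.
  clearbody c; rewrite !mulr_sumr -sumrB -big_split/=; apply: eq_bigr => i _; ring.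
rewrite -/c.
have : c ^+ 2 * \sum_i l i <= c ^+ 2 * 1 by rewrite ler_wpM2l// sqr_ge0.
lra.
Qed.

(** Jensen's inequality for the square, as nonnegativity of a variance. *)
Lemma convol_rho_sqr d (u : E -> R) x : 0 < d -> L1 u -> L1 (fun x => u x ^+ 2) ->
  (convol (rho d) u x) ^+ 2 <= convol (rho d) (fun x => u x ^+ 2) x.
Proof.
move=> d0 iu iu2; set c := convol (rho d) u x.
have i1 := L1_rhoM x d0 iu; have i2 := L1_rhoM x d0 iu2; have i3 := L1_rho n d0.
have : 0 <= intR (fun z => rho d z * (u (x + z) - c) ^+ 2).
  by apply: intR_ge0 => z; rewrite mulr_ge0 ?sqr_ge0// rho_ge0.
rewrite (@eq_intR _ _ _ (fun z => rho d z * u (x + z) ^+ 2 - (2 * c) * (rho d z * u (x + z))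
  + c ^+ 2 * rho d z)); last by move=> z; ring.
rewrite intRD; [|by apply: L1B => //; exact: L1Z|exact: L1Z].
rewrite intRB//; last exact: L1Z.
rewrite (intRZ _ i1) (intRZ _ i3) intR_rho// -(conv_rhoE x d0 iu) -(conv_rhoE x d0 iu2) -/c; lra.
Qed.

(** Keeps the mollified fields admissible in the definition of the weighted variation. *)
Lemma moll_sqr_sum d r (u : 'I_n -> E -> R) du x : 0 < d -> (forall k, test r (u k) (du k)) ->
  (forall x, \sum_k u k x ^+ 2 <= 1) -> \sum_k (convol (rho d) (u k) x) ^+ 2 <= 1.
Proof.
move=> d0 tu u1.
have iu k := test_L1 (tu k).
have iu2 k : L1 (fun x => u k x ^+ 2).
  have [B B0 [bu _]] := test_bounded (tu k).
  by rewrite (_ : (fun x => _) = (fun x => u k x * u k x));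
    [exact: (L1M (C1_measurable (tu k).1) bu)|apply/funext => y; rewrite expr2].
apply: (@le_trans _ _ (\sum_k convol (rho d) (fun x => u k x ^+ 2) x)).
  by apply: ler_sum => k _; exact: convol_rho_sqr.
have -> : \sum_k convol (rho d) (fun x => u k x ^+ 2) x =
    convol (rho d) (fun x => \sum_k u k x ^+ 2) x.
  rewrite conv_rhoE//; last exact: L1_sum.
  rewrite (@eq_intR _ _ _ (fun z => \sum_k rho d z * u k (x + z) ^+ 2)); last first.
    by move=> z; rewrite mulr_sumr.
  rewrite intR_sum; last by move=> k; exact: (L1_rhoM x d0 (iu2 k)).
  by apply: eq_bigr => k _; rewrite conv_rhoE.
suff /andP[] : 0 <= convol (rho d) (fun x => \sum_k u k x ^+ 2) x <= 1 by [].
apply: conv_rho_bounds => // [|z _]; first exact: L1_sum.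
by rewrite u1 andbT sumr_ge0// => k _; exact: sqr_ge0.
Qed.

End jensen.

Section scales.
Context (R : realType) (n : nat).
Local Notation E := 'rV[R]_n.
Variables (f : E -> R) (G : E -> E).
Hypothesis fL1 : L1 f.
Hypothesis f0 : forall x, 0 <= f x.
Variable U : set E.
Variable r0 : R.
Variables (M : R) (g : E -> R).
Hypotheses (mg : measurable_fun setT g) (gM : forall x, `|g x| <= M).
Variable tau : R.
Hypothesis tau0 : 0 < tau.

Definition box_grad_mass := \sum_k intR (fun x => \1_(@cube R n (r0 + 1 + 1)) x * `|G x ord0 k|).

Definition tau_part (j : nat) := tau * 2^-1 ^+ j.+1.
(** The constant added to zeta j in the envelope multiplies the integral of |G| on a cube; dividing by
that integral makes the product summable. *)
Definition om_part j := tau_part j / (1 + box_grad_mass).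

Lemma box_grad_mass_ge0 : 0 <= box_grad_mass.
Proof. by apply: sumr_ge0 => k _; apply: intR_ge0 => x; rewrite mulr_ge0// indicE. Qed.

Lemma tau_part_gt0 j : 0 < tau_part j.
Proof. by rewrite mulr_gt0// exprn_gt0// invr_gt0. Qed.

Lemma om_part_gt0 j : 0 < om_part j.
Proof. by rewrite divr_gt0 ?tau_part_gt0// ltr_pwDl// box_grad_mass_ge0. Qed.

Lemma om_part_le j : om_part j <= tau_part j.
Proof.
have S1 : 0 < 1 + box_grad_mass by rewrite ltr_pwDl// box_grad_mass_ge0.
by rewrite /om_part ler_pdivrMr// ler_peMr ?(ltW (tau_part_gt0 _))// lerDl box_grad_mass_ge0.
Qed.

Lemma om_part_mass j : om_part j * box_grad_mass <= tau_part j.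
Proof.
have S1 : 0 < 1 + box_grad_mass by rewrite ltr_pwDl// box_grad_mass_ge0.
by rewrite /om_part mulrAC ler_pdivrMr// ler_pM2l ?tau_part_gt0// lerDr.
Qed.

Lemma sum_tau_part N : \sum_(j < N) tau_part j <= tau.
Proof.
have -> : \sum_(j < N) tau_part j = tau * (1 - 2^-1 ^+ N).
  elim: N => [|N IH]; first by rewrite big_ord0 expr0 subrr mulr0.
  by rewrite big_ord_recr/= IH /tau_part exprS; field.
by rewrite ler_piMr ?(ltW tau0)// gerBl exprn_ge0// invr_ge0.
Qed.

Definition gz j x := g x * zeta U r0 j x.
Definition grad_term j k x := g x * f x * dzeta U r0 j k x.

Lemma L1_gzj j : L1 (gz j).
Proof. exact: (L1_gz mg gM (zeta_test U r0 j)). Qed.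

Lemma gz_bound j : exists2 B, 0 <= B & forall x, `|gz j x| <= B.
Proof. exact: (gz_bounded gM (zeta_test U r0 j)). Qed.

Lemma L1_grad_term j k : L1 (grad_term j k).
Proof.
have t := zeta_test U r0 j; have [B B0 [_ bd]] := test_bounded t.
have M0 : 0 <= M by apply: le_trans (gM 0).
rewrite (_ : grad_term j k = (fun x => (g x * dzeta U r0 j k x) * f x)).
  apply: (@L1M _ _ (M * B)) => //.
    by apply: measurable_funM => //; exact: C1_dmeasurable t.1.
  by move=> x; rewrite normrM ler_pM.
by apply/funext => x; rewrite /grad_term; ring.
Qed.

(** The scale d is small with respect to the width of the layer, does not enlarge zeta j too much, and
makes two mollification errors small: the one of g f d_k zeta_j in L^1, for the variation, and the
one of g zeta_j in L^1 with weight f, for the convergence. *)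
Definition good_scale j d := [/\ 0 < d, d <= layer_rad R j,
  forall y v, `|v| <= 3 * d -> `|zeta U r0 j (y + v) - zeta U r0 j y| <=
     om_part j * \1_(@cube R n (r0 + 1 + 1)) y,
  forall k, L1 (fun x => convol (rho d) (grad_term j k) x - grad_term j k x) /\
    intR (fun x => `|convol (rho d) (grad_term j k) x - grad_term j k x|) <= tau_part j &
  L1 (fun x => `|convol (rho d) (gz j) x - gz j x| * f x) /\
    intR (fun x => `|convol (rho d) (gz j) x - gz j x| * f x) <= tau_part j].

(** Each condition holds for all small d, and there are finitely many of them. *)
Lemma good_scale_exists j : exists d, good_scale j d.
Proof.
have [d1 d10 h1] := test_translate_le (zeta_test U r0 j) (om_part_gt0 j).
have [B B0 bB] := gz_bound j.
have [d2 d20 h2] := moll_L1_weight (L1_gzj j) bB fL1 f0 (tau_part_gt0 j).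
have /choice[d3 h3] (k : 'I_n) : exists d, 0 < d /\ forall d', 0 < d' -> d' <= d ->
    L1 (fun x => convol (rho d') (grad_term j k) x - grad_term j k x) /\
    intR (fun x => `|convol (rho d') (grad_term j k) x - grad_term j k x|) <= tau_part j.
  by have [d d0 hd] := moll_L1 (L1_grad_term j k) (tau_part_gt0 j); exists d.
have [d4 d40 h4] : exists2 d4, 0 < d4 & forall k, d4 <= d3 k.
  have H (s : seq 'I_n) : exists2 d4, 0 < d4 & forall k, k \in s -> d4 <= d3 k.
    elim: s => [|k s [d4 d40 IH]]; first by exists 1.
    exists (Num.min d4 (d3 k)); first by rewrite lt_min d40 (h3 k).1.
    move=> k'; rewrite inE => /predU1P[->|/IH h]; first by rewrite ge_min lexx orbT.
    by rewrite ge_min h.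
  by have [d4 d40 h] := H (enum 'I_n); exists d4 => // k; apply: h; rewrite mem_enum.
have j0 := layer_rad_gt0 R j.
pose d := Num.min (Num.min (d1 / 3) d2) (Num.min d4 (layer_rad R j)).
have dp : 0 < d by rewrite !lt_min d20 d40 j0 divr_gt0.
have dd1 : d <= d1 / 3 by rewrite !ge_min lexx.
have dd2 : d <= d2 by rewrite !ge_min lexx orbT.
have dd4 : d <= d4 by rewrite !ge_min lexx !orbT.
have dd5 : d <= layer_rad R j by rewrite !ge_min lexx !orbT.
exists d; split => //.
- by move=> y v vd; apply: h1; lra.
- by move=> k; apply: (h3 k).2 => //; exact: le_trans (h4 k).
- exact: h2.
Qed.

End scales.

(** * The approximation and its weighted variation *)

Section approximant.
Context (R : realType) (n : nat).
Local Notation E := 'rV[R]_n.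
Variables (f : E -> R) (G : E -> E).
Hypothesis fL1 : L1 f.
Hypothesis f0 : forall x, 0 <= f x.
Hypothesis fG : is_weak_grad f G.
Variable U : set E.
Variable r0 : R.
Variables (M : R) (g : E -> R).
Hypotheses (mg : measurable_fun setT g) (gM : forall x, `|g x| <= M).
Variable tau : R.
Hypothesis tau0 : 0 < tau.
Variable dl : nat -> R.
Hypothesis hdl : forall j, good_scale f G U r0 g tau j (dl j).

Local Notation Gc k := (fun x : E => G x ord0 k).
Local Notation gzj := (gz U r0 g).
Local Notation zj := (zeta U r0).
Local Notation T j := (convol (rho (dl j))).

Let M0 : 0 <= M. Proof. exact: le_trans (gM 0). Qed.

Lemma dl_gt0 j : 0 < dl j. Proof. by case: (hdl j). Qed.

Let igz j : L1 (gzj j) := L1_gzj U r0 mg gM j.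

(** Partial sums of the approximation. *)
Definition approx N x := \sum_(j < N.+1) T j (gzj j) x.

Lemma term_bound j x : `|T j (gzj j) x| <= M * (zj j x + om_part G r0 tau j).
Proof.
have [d0 _ h _ _] := hdl j.
apply: (conv_rho_norm d0 (igz j)) => z /cubeE-/(_ (ltW d0)) zd.
rewrite /gz normrM (ger0_norm (zeta_ge0 _ _ _ _)); apply: ler_pM => //; first exact: zeta_ge0.
have zd3 : `|z| <= 3 * dl j by lra.
have := h x z zd3; rewrite ler_norml => /andP[_ hz].
have o0 : 0 < om_part G r0 tau j := om_part_gt0 G r0 tau0 j.
rewrite -lerBlDl; apply: le_trans hz _.
by rewrite ler_piMr ?(ltW o0)// indicE; case: (_ \in _).
Qed.

Lemma sum_om_part N : \sum_(j < N) om_part G r0 tau j <= tau.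
Proof.
by apply: le_trans (sum_tau_part tau0 N); apply: ler_sum => j _; exact: om_part_le.
Qed.

Lemma approx_bound N x : `|approx N x| <= M * (1 + tau).
Proof.
apply: le_trans (ler_norm_sum _ _ _) _.
apply: (@le_trans _ _ (\sum_(j < N.+1) M * (zj j x + om_part G r0 tau j))).
  by apply: ler_sum => j _; exact: term_bound.
rewrite -mulr_sumr ler_wpM2l// big_split/= lerD ?sum_om_part//.
apply: le_trans (sum_zeta_le U r0 N x) _.
have [_ k01 _] := cutoff_props n r0; have /andP[k0 k1] := k01 x.
by rewrite mulr_ile1// indicE; case: (_ \in _).
Qed.

Lemma term_eq0 N j x : (N <= j)%N -> inner U (2 * layer_rad R N) x -> T j.+1 (gzj j.+1) x = 0.
Proof.
move=> Nj xi; have [d0 dr _ _ _] := hdl j.+1.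
apply/eqP; rewrite -normr_le0; apply: (conv_rho_norm d0 (igz j.+1)) => z.
move=> /cubeE-/(_ (ltW d0)) zd; rewrite /gz zeta_eq0 ?mulr0 ?normr0//.
apply: (inner_le _ (inner_shift xi zd)).
have := layer_rad_le R Nj; move: dr; rewrite layer_radS; have := layer_rad_gt0 R j; lra.
Qed.

(** At depth 2 4^-N the layers of index above N and their mollifications vanish, so that the partial
sums are constant from N on. *)
Lemma approx_stable N N' x : (N <= N')%N -> inner U (2 * layer_rad R N) x -> approx N' x = approx N x.
Proof.
move=> NN' xi; rewrite -(subnKC NN'); elim: (N' - N)%N => [|m IH]; first by rewrite addn0.
rewrite addnS /approx big_ord_recr/= -/(approx (N + m) x) IH.
by rewrite (term_eq0 _ xi) ?addr0// leq_addr.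
Qed.

(** The target is the partial sum of the g zeta_j, which is g times a product of two cutoffs. *)
Lemma approx_error N :
  L1 (fun x => `|approx N x - g x * (chi U r0 N x * cutoff r0 x)| * f x) /\
  intR (fun x => `|approx N x - g x * (chi U r0 N x * cutoff r0 x)| * f x) <= tau.
Proof.
pose e j x := `|T j (gzj j) x - gzj j x| * f x.
have ie j : L1 (e j) by have [_ _ _ _ []] := hdl j.
have eE x : `|approx N x - g x * (chi U r0 N x * cutoff r0 x)| * f x <= \sum_(j < N.+1) e j x.
  rewrite -(sum_zeta U r0 N x).
  apply: (@le_trans _ _ ((\sum_(j < N.+1) `|T j (gzj j) x - gzj j x|) * f x)).
    by apply: ler_wpM2r => //; rewrite mulr_sumr /approx -sumrB; exact: ler_norm_sum.
  by rewrite mulr_suml.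
have ma : measurable_fun setT (approx N).
  by apply: measurable_sum => j; exact: measurable_conv_rho (dl_gt0 j) (igz j).
have [tk _ _] := cutoff_props n r0.
have [[c _] _ _ _] := chi_props U r0 N.
have i : L1 (fun x => `|approx N x - g x * (chi U r0 N x * cutoff r0 x)| * f x).
  apply: (L1_le _ _ (L1_sum _ (fun j : 'I_N.+1 => ie j))).
    apply: measurable_funM; last exact: L1_measurable.
    apply: measurableT_comp => //; apply: measurable_funB => //.
    apply: measurable_funM => //; apply: measurable_funM; first exact: C1_measurable c.
    exact: C1_measurable tk.1.
  by move=> x; rewrite ger0_norm ?mulr_ge0.
split=> //; apply: (le_trans (le_intR i (L1_sum _ (fun j : 'I_N.+1 => ie j)) eE)).
rewrite intR_sum; last by move=> j; exact: ie.
apply: le_trans (sum_tau_part tau0 N.+1); apply: ler_sum => j _.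
by have [_ _ _ _ []] := hdl j.
Qed.

Variable V : R.
Hypothesis hV : forall (psi : 'I_n -> E -> R) (dpsi : 'I_n -> 'I_n -> E -> R) r (C : set E),
  (forall k, test r (psi k) (dpsi k)) -> closed C -> C `<=` U ->
  (forall k x, psi k x != 0 -> C x) -> (forall x, \sum_k psi k x ^+ 2 <= 1) ->
  intR (fun x => g x * \sum_k (dpsi k k x * f x + psi k x * G x ord0 k)) <= V.

Definition grad_mass := \sum_k intR (fun x => (cutoff r0 x * \1_U x) * `|G x ord0 k|).
(** The price of the cutoff at infinity, small when f has little mass where its derivative lives. *)
Definition cutoff_loss := \sum_k intR (fun x => f x * `|dcutoff r0 k x|).

Variables (phi : 'I_n -> E -> R) (dphi : 'I_n -> 'I_n -> E -> R) (rp : R) (N : nat).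
Hypothesis tphi : forall k, test rp (phi k) (dphi k).
Hypothesis phi1 : forall x, \sum_k phi k x ^+ 2 <= 1.
Hypothesis phiN : forall k x, phi k x != 0 -> inner U (2 * layer_rad R N) x.
Hypothesis mU : measurable U.

Let phi1k k x : `|phi k x| <= 1.
Proof.
rewrite -(@expr_le1 _ 2)// -normrX ger0_norm ?sqr_ge0//.
apply: le_trans (phi1 x); rewrite (bigD1 k)//= lerDl sumr_ge0// => j _; exact: sqr_ge0.
Qed.

Let psi j k x := zj j x * T j (phi k) x.
Let dpsi j k i x := zj j x * convol (drho (dl j) i) (phi k) x + T j (phi k) x * dzeta U r0 j i x.

Let tpsi j k : test (r0 + 1) (psi j k) (dpsi j k).
Proof.
have [tz1 tz2] := zeta_test U r0 j; split.
  apply: (C1M tz1); exact: C1_convol (test_L1 (tphi k)).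
by move=> x; rewrite mulf_eq0 negb_or => /andP[/tz2].
Qed.

Let sum_psi_le : intR (fun x => g x * \sum_k
   ((\sum_(j < N.+1) dpsi j k k x) * f x + (\sum_(j < N.+1) psi j k x) * G x ord0 k)) <= V.
Proof.
apply: (@hV (fun k x => \sum_(j < N.+1) psi j k x) (fun k i x => \sum_(j < N.+1) dpsi j k i x)
  (r0 + 1) (inner U (layer_rad R N / 2))).
- move=> k; split; first by apply: C1_sum => j; case: (tpsi j k).
  move=> x; apply: contra_neqP => nx; apply: big1 => j _.
  by apply/eqP/negPn/negP => /((tpsi j k).2 x).
- exact: closed_inner.
- by apply: inner_sub; rewrite divr_gt0// layer_rad_gt0.
- move=> k x; apply: contra_neqP => nx; apply: big1 => j _.
  apply/eqP/negPn/negP; rewrite /psi mulf_eq0 negb_or => /andP[/zeta_supp xi _].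
  apply: nx; apply: inner_le xi; rewrite ler_pM2r ?invr_gt0//.
  by apply: layer_rad_le; rewrite -ltnS.
move=> x; have [_ k01 _] := cutoff_props n r0; have /andP[k0 k1] := k01 x.
have z1 : \sum_(j < N.+1) zj j x <= 1.
  apply: le_trans (sum_zeta_le U r0 N x) _.
  by rewrite mulr_ile1// indicE; case: (_ \in _).
apply: (@le_trans _ _ (\sum_k \sum_(j < N.+1) zj j x * T j (phi k) x ^+ 2)).
  apply: ler_sum => k _.
  exact: (sqr_convex (fun j : 'I_N.+1 => T j (phi k) x) (fun j => zeta_ge0 U r0 j x) z1).
rewrite exchange_big/=; apply: le_trans z1; apply: ler_sum => j _.
rewrite -mulr_sumr ler_piMr ?zeta_ge0//.
exact: (moll_sqr_sum x (dl_gt0 j) tphi phi1).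
Qed.

Let kapU_bound x : `|cutoff r0 x * \1_U x| <= 1 :> R.
Proof.
have [_ k01 _] := cutoff_props n r0; have /andP[k0 k1] := k01 x.
rewrite normrM (ger0_norm k0) mulr_ile1// indicE; case: (_ \in _); rewrite ?normr0 ?normr1//.
Qed.

Let locG k : L1loc_rV (fun x => `|G x ord0 k|).
Proof.
move=> r; have := L1_norm (weak_grad_loc fG k r).
congr L1; apply/funext => x; rewrite normrM ger0_norm// indicE//.
Qed.

Let L1_kapG k : L1 (fun x => (cutoff r0 x * \1_U x) * `|G x ord0 k|).
Proof.
have [[c s] _ _] := cutoff_props n r0.
apply: (L1M_loc _ kapU_bound _ (locG k) (r := r0 + 1)).
  by apply: measurable_funM; [exact: C1_measurable c|exact: measurable_indic].
by move=> x; rewrite mulf_eq0 negb_or => /andP[/s].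
Qed.

Let L1_zG j k : L1 (fun x => zj j x * `|G x ord0 k|).
Proof.
have t := zeta_test U r0 j; have [B B0 [bz _]] := test_bounded t.
exact: (L1M_loc (C1_measurable t.1) bz t.2 (locG k)).
Qed.

Let sum_zG k : \sum_(j < N.+1) intR (fun x => zj j x * `|G x ord0 k|) <=
  intR (fun x => (cutoff r0 x * \1_U x) * `|G x ord0 k|).
Proof.
rewrite -(@intR_sum _ _ _ _ (fun (j : 'I_N.+1) x => zj j x * `|G x ord0 k|)); last first.
  by move=> j; exact: L1_zG.
apply: le_intR => [||x]; first by apply: L1_sum => j; exact: L1_zG.
  exact: L1_kapG.
by rewrite -mulr_suml ler_wpM2r// sum_zeta_le.
Qed.

Let zG j k := intR (fun x => zj j x * `|G x ord0 k|).
Let wphi j k := intR (fun x => grad_term f U r0 g j k x * phi k x).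
Let Aint j k := intR (fun x => g x * (dpsi j k k x * f x + psi j k x * G x ord0 k)).

Let L1_A j k : L1 (fun x => g x * (dpsi j k k x * f x + psi j k x * G x ord0 k)).
Proof.
have [_ _ h _ _] := hdl j.
by have [err [_ + _ _ _]] := mollified_piece fL1 fG mg gM (zeta_test U r0 j) (tphi k) (@phi1k k)
  (dl_gt0 j) k (ltW (om_part_gt0 G r0 tau0 j)) (zeta_ge0 U r0 j) h.
Qed.

Let term_le j k : intR (fun x => T j (gzj j) x * wdiv f G (phi k) (dphi k) k x) <=
  Aint j k + tau_part tau j - wphi j k + M * zG j k
  + Cdrho R n * (M * (\sum_i zG j i + om_part G r0 tau j * box_grad_mass G r0)).
Proof.
have [d0 _ h hw _] := hdl j.
have [err [eb iA iB iC ->]] := mollified_piece fL1 fG mg gM (zeta_test U r0 j) (tphi k) (@phi1k k)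
  (dl_gt0 j) k (ltW (om_part_gt0 G r0 tau0 j)) (zeta_ge0 U r0 j) h.
have iphi := test_L1 (tphi k).
have [[cphi sphi]] := tphi k.
have iw := L1_grad_term fL1 U r0 mg gM j k.
have iwphi : L1 (fun x => grad_term f U r0 g j k x * phi k x).
  rewrite (_ : (fun x => _) = (fun x => phi k x * grad_term f U r0 g j k x)).
    exact: (L1M (C1_measurable (tphi k).1) (@phi1k k)).
  by apply/funext => x; rewrite mulrC.
have hB : wphi j k - tau_part tau j <=
    intR (fun x => g x * f x * dzeta U r0 j k x * T j (phi k) x).
  have [i1 i2 adj] := conv_rho_adjoint d0 iphi iw.
  rewrite -[X in _ <= X]adj.
  have [i3 i4] := hw k.
  have i5 : L1 (fun x => phi k x * (T j (grad_term f U r0 g j k) x - grad_term f U r0 g j k x)).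
    exact: (L1M (C1_measurable (tphi k).1) (@phi1k k)).
  have -> : intR (fun x => T j (grad_term f U r0 g j k) x * phi k x) = wphi j k +
      intR (fun x => phi k x * (T j (grad_term f U r0 g j k) x - grad_term f U r0 g j k x)).
    by rewrite -intRD//; apply: eq_intR => x; ring.
  rewrite lerD2l; suff : `|intR (fun x => phi k x * (T j (grad_term f U r0 g j k) x - grad_term f U r0 g j k x))|
      <= tau_part tau j by rewrite ler_norml => /andP[].
  apply: le_trans i4; apply: norm_intR_le => //; first exact: L1_norm.
  by move=> x; rewrite normrM ler_piMl.
have hC : - intR (fun x => g x * (psi j k x * G x ord0 k)) <= M * zG j k.
  rewrite /zG -intRZ; last exact: L1_zG.
  rewrite -intRN//; apply: le_intR; [exact: L1N|exact: (L1Z M (L1_zG j k))|].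
  move=> x; apply: le_trans (ler_norm _) _; rewrite normrN normrM; apply: ler_pM => //.
  rewrite normrM ler_wpM2r// normrM (ger0_norm (zeta_ge0 _ _ _ _)) ler_piMr ?zeta_ge0//.
  by apply: (conv_rho_norm d0 iphi) => z _.
have hE : err <= Cdrho R n * (M * (\sum_i zG j i + om_part G r0 tau j * box_grad_mass G r0)).
  apply: le_trans (ler_norm _) (le_trans eb _); rewrite ler_wpM2l ?(ltW (Cdrho_gt0 R n))//.
  rewrite /box_grad_mass mulr_sumr -big_split/= mulr_sumr; apply: ler_sum => i _.
  have i1 : L1 (fun x => \1_(@cube R n (r0 + 1 + 1)) x * `|G x ord0 i|) by exact: locG.
  rewrite /zG -intRZ// -intRD; [|exact: L1_zG|exact: L1Z].
  rewrite -intRZ; last by apply: L1D; [exact: L1_zG|exact: L1Z].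
  rewrite le_eqVlt; apply/orP; left; apply/eqP; apply: eq_intR => x; rewrite /envelope; ring.
move: hB hC hE; rewrite /Aint; lra.
Qed.

Let dkap_bounded : exists2 B, 0 <= B & forall k x, `|dcutoff (n := n) r0 k x| <= B.
Proof.
have [t _ _] := cutoff_props n r0; have [B B0 [_ bd]] := test_bounded t.
by exists B.
Qed.

Let sum_wphi k : - (M * intR (fun x => f x * `|dcutoff r0 k x|)) <= \sum_(j < N.+1) wphi j k.
Proof.
have iwphi j : L1 (fun x => grad_term f U r0 g j k x * phi k x).
  rewrite (_ : (fun x => _) = (fun x => phi k x * grad_term f U r0 g j k x)).
    by apply: (L1M (C1_measurable (tphi k).1) (@phi1k k)); exact: L1_grad_term.
  by apply/funext => x; rewrite mulrC.
have [t _ _] := cutoff_props n r0; have [B B0 bd] := dkap_bounded.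
have ik : L1 (fun x => f x * `|dcutoff r0 k x|).
  rewrite (_ : (fun x => _) = (fun x => `|dcutoff r0 k x| * f x)); last first.
    by apply/funext => x; rewrite mulrC.
  apply: (@L1M _ _ B) => //; last by move=> x; rewrite normr_id.
  by apply: measurableT_comp => //; exact: C1_dmeasurable t.1.
rewrite /wphi -(@intR_sum _ _ _ _ (fun (j : 'I_N.+1) x => grad_term f U r0 g j k x * phi k x))//.
rewrite -intRZ// -intRN; last exact: L1Z.
apply: le_intR; [by apply: L1N; exact: L1Z|by apply: L1_sum|move=> x].
have -> : \sum_(j < N.+1) grad_term f U r0 g j k x * phi k x = g x * (f x * dcutoff r0 k x) * phi k x.
  have [->|/phiN xi] := eqVneq (phi k x) 0.
    by rewrite mulr0 big1// => j _; rewrite mulr0.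
  rewrite -mulr_suml -(sum_dzeta_inner r0 k xi) mulr_sumr mulr_sumr; congr (_ * _).
  by apply: eq_bigr => j _; rewrite /grad_term mulrA.
apply: lerNnormlW; rewrite -mulrA !normrM (ger0_norm (f0 x)); apply: ler_pM => //.
  by rewrite !mulr_ge0.
by rewrite ler_piMr// mulr_ge0.
Qed.

(** The identities of [mollified_piece] are summed over the layers and the coordinates; the four
resulting sums are bounded by V, by the mollification errors and the loss of the cutoff, by
M grad_mass, and by the commutator estimate.  The support condition on phi makes the sum of
the derivatives of the zeta_j telescope on it. *)
Lemma approx_variation :
  intR (fun x => approx N x * \sum_k (dphi k k x * f x + phi k x * G x ord0 k)) <=
  V + n%:R * tau + M * cutoff_loss + M * grad_mass + n%:R * (Cdrho R n * (M * (grad_mass + tau))).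
Proof.
have iL k := L1_wdiv fL1 fG (tphi k) k.
have iTL j k : L1 (fun x => T j (gzj j) x * wdiv f G (phi k) (dphi k) k x).
  by have [] := conv_rho_adjoint (dl_gt0 j) (iL k) (igz j).
have -> : intR (fun x => approx N x * \sum_k (dphi k k x * f x + phi k x * G x ord0 k)) =
    \sum_(j < N.+1) \sum_k intR (fun x => T j (gzj j) x * wdiv f G (phi k) (dphi k) k x).
  rewrite (eq_bigr (fun j : 'I_N.+1 => intR (fun x => \sum_k T j (gzj j) x * wdiv f G (phi k) (dphi k) k x))).
    rewrite -(@intR_sum _ _ _ _ (fun (j : 'I_N.+1) x => \sum_k T j (gzj j) x * wdiv f G (phi k) (dphi k) k x)).
      by apply: eq_intR => x; rewrite mulr_suml; apply: eq_bigr => j _; rewrite mulr_sumr.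
    by move=> j; exact: L1_sum.
  by move=> j _; rewrite intR_sum.
apply: (@le_trans _ _ (\sum_(j < N.+1) \sum_k (Aint j k + tau_part tau j - wphi j k + M * zG j k
  + Cdrho R n * (M * (\sum_i zG j i + om_part G r0 tau j * box_grad_mass G r0))))).
  by apply: ler_sum => j _; apply: ler_sum => k _; exact: term_le.
have -> : \sum_(j < N.+1) \sum_k (Aint j k + tau_part tau j - wphi j k + M * zG j k
  + Cdrho R n * (M * (\sum_i zG j i + om_part G r0 tau j * box_grad_mass G r0))) =
  \sum_(j < N.+1) \sum_k Aint j k + n%:R * (\sum_(j < N.+1) tau_part tau j)
  - \sum_k \sum_(j < N.+1) wphi j k + M * (\sum_k \sum_(j < N.+1) zG j k)
  + n%:R * (Cdrho R n * (M * (\sum_k \sum_(j < N.+1) zG j k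
     + \sum_(j < N.+1) om_part G r0 tau j * box_grad_mass G r0))).
  rewrite [\sum_k \sum_(j < N.+1) wphi j k]exchange_big/=.
  rewrite [\sum_k \sum_(j < N.+1) zG j k]exchange_big/= -big_split/=.
  rewrite !mulr_sumr -sumrN -!big_split/=; apply: eq_bigr => j _.
  rewrite !big_split/= sumrN !sumr_const card_ord -[\sum_(i < n) M * zG j i]mulr_sumr.
  rewrite -[tau_part tau j *+ n]mulr_natl -[(Cdrho R n * _) *+ n]mulr_natl.
  move: (\sum_k Aint j k) (\sum_k wphi j k) (\sum_k zG j k) (tau_part tau j)
    (om_part G r0 tau j * box_grad_mass G r0) (Cdrho R n) (n%:R : R) => a b c d e p q; ring.
have hA : \sum_(j < N.+1) \sum_k Aint j k <= V.
  apply: le_trans sum_psi_le; rewrite le_eqVlt; apply/orP; left; apply/eqP.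
  rewrite (eq_bigr (fun j : 'I_N.+1 => intR (fun x => \sum_k g x * (dpsi j k k x * f x + psi j k x * G x ord0 k)))); last first.
    by move=> j _; rewrite intR_sum.
  rewrite -(@intR_sum _ _ _ _ (fun (j : 'I_N.+1) x => \sum_k g x * (dpsi j k k x * f x + psi j k x * G x ord0 k))); last first.
    by move=> j; exact: L1_sum.
  apply: eq_intR => x; rewrite exchange_big/= mulr_sumr; apply: eq_bigr => k _.
  by rewrite -mulr_sumr big_split/= -!mulr_suml.
have hz : \sum_k \sum_(j < N.+1) zG j k <= grad_mass.
  by apply: ler_sum => k _; exact: sum_zG.
have ht : n%:R * (\sum_(j < N.+1) tau_part tau j) <= n%:R * tau.
  by rewrite ler_wpM2l// sum_tau_part.
have hw : - \sum_k \sum_(j < N.+1) wphi j k <= M * cutoff_loss.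
  by rewrite -sumrN /cutoff_loss mulr_sumr; apply: ler_sum => k _; rewrite lerNl.
have hom : \sum_(j < N.+1) om_part G r0 tau j * box_grad_mass G r0 <= tau.
  by apply: le_trans (sum_tau_part tau0 N.+1); apply: ler_sum => j _; exact: om_part_mass.
have hM : M * (\sum_k \sum_(j < N.+1) zG j k) <= M * grad_mass by rewrite ler_wpM2l.
have hC : n%:R * (Cdrho R n * (M * (\sum_k \sum_(j < N.+1) zG j k
     + \sum_(j < N.+1) om_part G r0 tau j * box_grad_mass G r0))) <= n%:R * (Cdrho R n * (M * (grad_mass + tau))).
  by rewrite ler_wpM2l// ler_wpM2l ?(ltW (Cdrho_gt0 R n))// ler_wpM2l// lerD.
move: hA ht hw hM hC; lra.
Qed.

End approximant.

(** * Vector fields, essential bounds and densities *)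

Section vector_tests.
Context (R : realType) (n : nat).
Local Notation E := 'rV[R]_n.

Lemma continuous_row (m : nat) (psi : 'I_m -> E -> R) : (forall k, continuous (psi k)) ->
  continuous (fun x : E => \row_k psi k x).
Proof.
move=> cpsi x; apply/(@cvgrPdist_le _ _ _ (nbhs x)) => e e0.
have : \forall y \near nbhs x, forall k, `|psi k x - psi k y| <= e.
  apply: filter_forall => k.
  by have /(@cvgrPdist_le _ _ _ (nbhs x))/(_ _ e0) := cpsi k x.
apply: filterS => y h; apply: norm_le_coord; first exact: ltW.
by move=> k; rewrite !mxE.
Qed.

Lemma continuous_component (m : nat) (phi : E -> 'rV[R]_m) k : continuous phi ->
  continuous (fun x : E => phi x ord0 k).
Proof.
move=> cphi x; apply: (continuous_comp (f := phi) (g := fun v : 'rV[R]_m => v ord0 k)).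
  exact: cphi.
exact: coord_continuous.
Qed.

Lemma is_derive_row (m : nat) (psi dpsi : 'I_m -> E -> R) x v :
  (forall k, is_derive x v (psi k) (dpsi k x)) ->
  is_derive x v (fun x : E => \row_k psi k x) (\row_k dpsi k x).
Proof.
move=> h.
have d : derivable (fun x : E => \row_k psi k x) x v.
  apply/derivable_mxP => i j.
  rewrite (_ : (fun x : E => (\row_k psi k x) i j) = psi j); first by case: (h j).
  by apply/funext => y; rewrite mxE.
apply: DeriveDef => //; rewrite derive_mx//; apply/matrixP => i j; rewrite !mxE.
rewrite (_ : (fun x : E => (\row_k psi k x) i j) = psi j); first by case: (h j).
by apply/funext => y; rewrite mxE.
Qed.

(** Fields with test components, from the scalar to the vector-valued notion. *)
Lemma tests_C1c (U C : set E) r (psi : 'I_n -> E -> R) dpsi :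
  (forall k, test r (psi k) (dpsi k)) -> closed C -> C `<=` U ->
  (forall k x, psi k x != 0 -> C x) ->
  C1c U (fun x : E => \row_k psi k x) /\
  forall x, divergence (fun x : E => \row_k psi k x) x = \sum_k dpsi k k x.
Proof.
move=> t cC CU sC.
have cpsi k : continuous (psi k) by case: (t k) => -[].
have dE i x : is_derive x (ebase i) (fun x : E => \row_k psi k x) (\row_k dpsi k i x).
  by apply: (is_derive_row (dpsi := fun k => dpsi k i)) => k; case: (t k) => -[_ _ d] _; exact: d.
have dE' i : 'D_(ebase i) (fun x : E => \row_k psi k x) = (fun x => \row_k dpsi k i x).
  by apply/funext => x; case: (dE i x).
split; last first.
  move=> x; apply: eq_bigr => i _; have [_ ->] := dE i x; by rewrite mxE.
have nz x : \row_k psi k x != 0 -> exists k, psi k x != 0.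
  move=> /eqP h; apply: contrapT => nk; apply: h; apply/rowP => k; rewrite !mxE.
  by apply/eqP/negPn/negP => h; apply: nk; exists k.
have sub : closure [set x : E | \row_k psi k x != 0] `<=` cube r `&` C.
  have cl : closed (cube r `&` C) by apply: closedI => //; exact: closed_cube.
  rewrite ((closure_id _).1 cl); apply: closureS => x /= /nz[k kx].
  by split; [exact: ((t k).2 x)|exact: sC kx].
split.
- split; first by move=> x _; exact: continuous_row.
  move=> i; split; first by move=> x _; case: (dE i x).
  rewrite dE'; split => // x _; apply: continuous_row => k.
  by case: (t k) => -[].
- apply: (subclosed_compact (@closed_closure _ _) (@compact_cube R n r)).
  by apply: subset_trans sub _; exact: subIsetl.
- by apply: subset_trans sub _; apply: subset_trans CU; exact: subIsetr.
Qed.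

(** Conversely, components of compactly supported fields are test functions. *)
Lemma C1c_tests (U : set E) (phi : E -> E) : C1c U phi -> exists r,
  (forall k, test r (fun x => phi x ord0 k) (fun i x => 'D_(ebase i) phi x ord0 k)).
Proof.
move=> [[cphi dphi] /compact_bounded[M [_ hM]] _].
exists (`|M| + 1) => k; split.
  split=> [|i|i x].
  - by apply: continuous_component => x; exact: cphi.
  - apply: continuous_component => x; have [_ [c _]] := dphi i; exact: c.
  - have [d _] := dphi i; have dx := d x Logic.I.
    have /derivable_mxP/(_ ord0 k) dk := dx.
    apply: DeriveDef => //.
    by rewrite (derive_mx dx) mxE.
move=> x kx i; apply: le_trans (coord_le_norm _ _) _.
apply: hM; first by rewrite (le_lt_trans (ler_norm _))// ltrDl.
apply: subset_closure => /=; apply: contra_neq kx => ->; by rewrite mxE.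
Qed.

Lemma Ck_add (u v : E -> R) k : Ck k setT u -> Ck k setT v ->
  Ck k setT (fun x => u x + v x).
Proof.
elim: k u v => [|k IH] u v [cu du] [cv dv].
  by split => // x Ax; exact: continuousD (cu x Ax) (cv x Ax).
split; first by move=> x Ax; exact: continuousD (cu x Ax) (cv x Ax).
move=> i; have [du1 du2] := du i; have [dv1 dv2] := dv i.
split; first by move=> x Ax; exact: derivableD (du1 x Ax) (dv1 x Ax).
rewrite (_ : 'D_(ebase i) (fun x => u x + v x) =
  (fun x => 'D_(ebase i) u x + 'D_(ebase i) v x)); first exact: IH.
by apply/funext => x; rewrite -deriveD//; [exact: du1|exact: dv1].
Qed.

Lemma Ck_zero k : Ck k setT (fun _ : E => 0 : R).
Proof.
elim: k => [|k IH]; split => //; try by move=> x _; exact: cst_continuous.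
move=> i; split; first by move=> x _; exact: derivable_cst.
rewrite (_ : 'D_(ebase i) (fun=> 0) = (fun=> 0)) //.
by apply/funext => x; exact: (derive_cst (0 : R)).
Qed.

Lemma Ck_sum I (s : seq I) (u : I -> E -> R) k : (forall j, Ck k setT (u j)) ->
  Ck k setT (fun x => \sum_(j <- s) u j x).
Proof.
move=> cu; elim: s => [|j s IH].
  have -> : (fun x : E => \sum_(j <- [::]) u j x) = (fun=> 0).
    by apply/funext => x; rewrite big_nil.
  exact: Ck_zero.
have -> : (fun x : E => \sum_(j <- j :: s) u j x) = (fun x => u j x + \sum_(j <- s) u j x).
  by apply/funext => x; rewrite big_cons.
exact: Ck_add.
Qed.

Lemma near_eq_continuous (u h : E -> R) x : (\forall y \near x, u y = h y) ->
  {for x, continuous u} -> {for x, continuous h}.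
Proof.
move=> uh cu; have hx := nbhs_singleton uh.
have c : u @ x --> h x by rewrite -hx; exact: cu.
exact: (cvg_trans (near_eq_cvg uh) c).
Qed.

(** Differentiability is local; it is applied to the locally finite sum defining the
approximation. *)
Lemma Ck_local (U : set E) k (h : E -> R) :
  (forall x, U x -> exists2 u, Ck k setT u & \forall y \near x, u y = h y) -> Ck k U h.
Proof.
elim: k h => [|k IH] h loc.
  split => // x Ux; have [u [cu _] uh] := loc x Ux.
  exact: near_eq_continuous uh (cu x Logic.I).
split.
  move=> x Ux; have [u [cu _] uh] := loc x Ux.
  exact: near_eq_continuous uh (cu x Logic.I).
move=> i; split.
  move=> x Ux; have [u [_ du] uh] := loc x Ux; have [d _] := du i.
  exact: near_eq_derivable uh (d x Logic.I).
apply: IH => x Ux; have [u [_ du] uh] := loc x Ux; have [d cdu] := du i.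
exists ('D_(ebase i) u) => //.
have := near_join uh; apply: filterS => y uhy; exact: near_eq_derive uhy.
Qed.

Lemma cube_ball_measure (x : E) r : 0 < r ->
  exists2 A : set E, measurable A & (0 < lebesgue_rV R n A)%E /\ (forall y, A y -> `|y - x| < r).
Proof.
move=> r0; have r2 : 0 < r / 2 by rewrite divr_gt0.
exists [set y | forall i, `[x ord0 i - r / 2, x ord0 i + r / 2]%classic (y ord0 i)].
  apply: (measurable_rV_box (A := fun i => `[x ord0 i - r / 2, x ord0 i + r / 2]%classic)).
  by move=> i; exact: measurable_itv.
split.
  rewrite (lebesgue_rV_box (A := fun i => `[x ord0 i - r / 2, x ord0 i + r / 2]%classic)); last first.
    by move=> i; exact: measurable_itv.
  rewrite (eq_bigr (fun=> r%:E)); last first.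
    move=> i _; rewrite lebesgue_measure_itv/= lte_fin ifT; last by lra.
    by rewrite -EFinD; congr (_%:E); lra.
  by rewrite prodEFin lte_fin prodr_const exprn_gt0.
move=> y yx; apply: (@le_lt_trans _ _ (r / 2)); last by lra.
apply: norm_le_coord; first exact: ltW.
move=> i; have := yx i; rewrite /= in_itv/= !mxE => /andP[h1 h2].
by rewrite ler_norml; apply/andP; split; lra.
Qed.

(** A nonempty open set has positive measure. *)
Lemma ae_le_everywhere (h : E -> R) (b : R) : continuous h ->
  {ae lebesgue_rV R n, forall x, h x <= b} -> forall x, h x <= b.
Proof.
move=> ch [N [mN N0 subN]] x; rewrite leNgt; apply/negP => bx.
have /nbhs_ballP[e /= e0 he] : nbhs x (h @^-1` [set t | b < t]).
  by apply: ch; exact: lt_nbhsr.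
have [A mA [A0 Ae]] := cube_ball_measure x e0.
have AN : A `<=` N.
  move=> y Ay; apply: subN => /=; apply/negP; rewrite -ltNge.
  by apply: he; rewrite mx_norm_ball/= distrC; exact: Ae.
have : (lebesgue_rV R n A <= lebesgue_rV R n N)%E by apply: le_measure; rewrite ?inE.
by rewrite N0 leNgt A0.
Qed.

End vector_tests.

Section essential_bound.
Context (R : realType) (n : nat).
Local Notation E := 'rV[R]_n.
Local Notation leb := (lebesgue_rV R n).
Implicit Types (U : set E) (h : E -> R).

Lemma leb_setT_gt0 : (0 < leb [set: E])%E.
Proof.
have [A mA [A0 _]] := cube_ball_measure (0 : E) ltr01.
by apply: lt_le_trans A0 _; apply: le_measure; rewrite ?inE.
Qed.

(** The measure is nonzero, so that the norm is the essential supremum. *)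
Lemma normLinfE U h : normLinf U h = ess_sup leb (abse \o (EFin \o (h \_ U))).
Proof. by rewrite /normLinf unlock leb_setT_gt0. Qed.

Lemma normLinf_le U h (y : R) : 0 <= y -> (forall x, U x -> `|h x| <= y) ->
  (normLinf U h <= y%:E)%E.
Proof.
move=> y0 hy; rewrite normLinfE; apply/ess_supP; apply: aeW => x /=.
rewrite patchE; case: ifPn => [/set_mem Ux|_]; first by rewrite lee_fin hy.
by rewrite /= normr0 lee_fin.
Qed.

Lemma normLinf_ae U h : {ae leb, forall x, U x -> (`|h x|%:E <= normLinf U h)%E}.
Proof.
have := ess_sup_ge leb (abse \o (EFin \o (h \_ U))); rewrite -normLinfE.
apply: filterS => x /= + Ux; by rewrite patchE mem_set.
Qed.

Lemma normLinf_ge0 U h : (0 <= normLinf U h)%E.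
Proof. exact: Lnorm_ge0. Qed.

End essential_bound.

Section density.
Context (R : realType) (n : nat).
Local Notation E := 'rV[R]_n.
Local Notation leb := (lebesgue_rV R n).
Variables (mu : {measure set E -> \bar R}) (f : E -> R).
Hypothesis fL1 : L1 f.
Hypothesis f0 : forall x, 0 <= f x.
Hypothesis muf : forall A, measurable A -> mu A = (\int[leb]_(x in A) (f x)%:E)%E.

Import HBNNSimple.

Lemma density_indic (A : set E) : measurable A -> L1 (fun x => \1_A x * f x) /\
  mu A = (intR (fun x => \1_A x * f x))%:E.
Proof.
move=> mA; have i : L1 (fun x => \1_A x * f x).
  apply: (@L1M _ _ 1 (\1_A)) => [|x|//]; first exact: measurable_indic.
  by rewrite indicE; case: (_ \in _); rewrite ?normr0 ?normr1.
split=> //; rewrite muf// integral_mkcond -L1_EFin//; apply: eq_integral => x _.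
by rewrite patchE indicE; case: (x \in A); rewrite ?mul1r ?mul0r.
Qed.

Lemma density_nnsfun (h : {nnsfun E >-> R}) : L1 (fun x => h x * f x) /\
  (\int[mu]_x (h x)%:E)%E = (intR (fun x => h x * f x))%:E.
Proof.
have mh y : measurable (h @^-1` [set y]) by exact: measurable_sfunP.
have i y : L1 (fun x => y * (\1_(h @^-1` [set y]) x * f x)).
  by apply: L1Z; exact: (density_indic (mh y)).1.
have hE x : h x * f x = \sum_(y <- finmap.enum_fset (fset_set (range h)))
    y * (\1_(h @^-1` [set y]) x * f x).
  rewrite {1}fimfunE fsbig_finite//=.
  by rewrite mulr_suml; apply: eq_bigr => y _; rewrite mulrA.
split.
  rewrite (_ : (fun x => _) = (fun x => \sum_(y <- finmap.enum_fset (fset_set (range h)))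
    y * (\1_(h @^-1` [set y]) x * f x))); first exact: L1_sum.
  by apply/funext => x.
rewrite integralT_nnsfun sintegralE fsbig_finite//=.
rewrite (eq_intR hE) intR_sum// -sumEFin; apply: eq_bigr => y _.
by rewrite intRZ ?(density_indic (mh y)).2 ?EFinM//; exact: (density_indic (mh y)).1.
Qed.

(** From the measure of sets to integrals of bounded functions: simple functions, then monotone
convergence on one side and dominated convergence on the other. *)
Lemma density_integral (B : R) (u : E -> R) : measurable_fun setT u ->
  (forall x, 0 <= u x) -> (forall x, u x <= B) -> L1 (fun x => u x * f x) /\
  (\int[mu]_x (u x)%:E)%E = (intR (fun x => u x * f x))%:E.
Proof.
move=> mu_ u0 uB.
have B0 : 0 <= B by apply: le_trans (uB 0).
have muE : measurable_fun setT (EFin \o u) by exact/measurable_EFinP.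
pose h := nnsfun_approx measurableT muE.
have hu x : (h m x)%:E @[m --> \oo] --> (u x)%:E.
  by apply: cvg_nnsfun_approx => // y _; rewrite lee_fin.
have hu' x : h m x @[m --> \oo] --> u x by move: (hu x) => /fine_cvg.
have hle m x : h m x <= u x.
  have nd : nondecreasing_seq (fun m => h m x).
    by move=> a b ab; exact/lefP/nd_nnsfun_approx.
  have := nondecreasing_cvgn_le nd (cvgP _ (hu' x)) m; by rewrite (cvg_lim _ (hu' x)).
have iBf : L1 (fun x => B * f x) by exact: L1Z.
have [iu cu] : L1 (fun x => u x * f x) /\
    intR (fun x => h m x * f x) @[m --> \oo] --> intR (fun x => u x * f x).
  apply: (cvg_intR _ _ iBf) => [m|x|m x].
  - by apply: measurable_funM => //; exact: L1_measurable.
  - by apply: cvgMr_tmp; exact: hu'.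
  - by rewrite ger0_norm ?mulr_ge0// ler_wpM2r// (le_trans (hle m x)).
split=> //.
have c1 : (\int[mu]_x (h m x)%:E)%E @[m --> \oo] --> (\int[mu]_x (u x)%:E)%E.
  have := @cvg_monotone_convergence _ _ _ mu setT measurableT (fun m x => (h m x)%:E).
  rewrite (eq_integral (fun x => (u x)%:E)); last first.
    by move=> x _; apply/cvg_lim => //; exact: hu.
  apply.
  - by move=> m; exact/measurable_EFinP.
  - by move=> m x _; rewrite lee_fin.
  - by move=> x _ a b ab; rewrite lee_fin; exact/lefP/nd_nnsfun_approx.
have c2 : (\int[mu]_x (h m x)%:E)%E @[m --> \oo] --> (intR (fun x => u x * f x))%:E.
  rewrite (_ : (fun m => _) = (fun m => (intR (fun x => h m x * f x))%:E)).
    by apply: cvg_EFin => //; exact: nearW.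
  by apply/funext => m; exact: (density_nnsfun (h m)).2.
by apply: cvg_unique c1 c2.
Qed.

End density.

(** * Approximation with a given accuracy *)

Section enorm.
Context (R : realType) (n : nat).
Local Notation E := 'rV[R]_n.

Lemma coord_le_enorm (v : E) k : `|v ord0 k| <= enorm v.
Proof.
rewrite /enorm -sqrtr_sqr ler_sqrt ?sumr_ge0//; last by move=> i _; exact: sqr_ge0.
by rewrite (bigD1 k)//= lerDl sumr_ge0// => i _; exact: sqr_ge0.
Qed.

Lemma enorm_le1 (v : E) : (enorm v <= 1) = (\sum_k v ord0 k ^+ 2 <= 1).
Proof.
rewrite /enorm -[X in _ <= X]sqrtr1 ler_sqrt//.
Qed.

Lemma L1loc_measurable (w : E -> R) : L1loc_rV w -> measurable_fun setT w.
Proof.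
move=> lw; apply: (@measurable_fun_cvg _ _ _ setT (fun (k : nat) x => \1_(@cube R n k%:R) x * w x)).
  by move=> k; exact: L1_measurable (lw _).
move=> x _; rewrite -[X in _ --> X](mul1r (w x)); apply: cvgMr_tmp; exact: cvg_1cube.
Qed.

Lemma measurable_enorm (G : E -> E) : (forall k, measurable_fun setT (fun x => G x ord0 k)) ->
  measurable_fun setT (fun x => enorm (G x)).
Proof.
move=> mG; pose q (x : E) := \sum_(k < n) G x ord0 k ^+ 2.
rewrite (_ : (fun x => _) = Num.sqrt \o q)//.
apply: measurableT_comp.
  by apply: continuous_measurable_fun; exact: sqrt_continuous.
by apply: measurable_sum => k; apply: measurable_funX; exact: mG.
Qed.

Lemma continuous_enorm2 (phi : E -> E) : continuous phi ->
  continuous (fun x => \sum_k phi x ord0 k ^+ 2).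
Proof.
move=> cphi.
have cs (s : seq 'I_n) : continuous (fun x => \sum_(k <- s) phi x ord0 k ^+ 2).
  elim: s => [|k s IH] x.
    have -> : (fun x : E => \sum_(k <- [::]) phi x ord0 k ^+ 2) = cst 0.
      by apply/funext => y; rewrite big_nil.
    exact: cst_continuous.
  have -> : (fun x : E => \sum_(k <- k :: s) phi x ord0 k ^+ 2) =
      (fun x => phi x ord0 k * phi x ord0 k + \sum_(k <- s) phi x ord0 k ^+ 2).
    by apply/funext => y; rewrite big_cons expr2.
  have c1 : continuous (fun y => phi y ord0 k) by exact: continuous_component.
  exact: (continuousD (continuousM (c1 x) (c1 x)) (IH x)).
exact: cs.
Qed.

End enorm.

Section smooth_approximation.
Context (R : realType) (n : nat).
Local Notation E := 'rV[R]_n.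
Local Notation leb := (lebesgue_rV R n).
Variables (f : E -> R) (G : E -> E).
Hypothesis fL1 : L1 f.
Hypothesis f0 : forall x, 0 <= f x.
Hypothesis fG : is_weak_grad f G.
Variable U : set E.
Hypothesis oU : open U.
Variables (M : R) (g : E -> R).
Hypotheses (mg : measurable_fun setT g) (gM : forall x, `|g x| <= M).
Variable V : R.
Hypothesis hV : forall (psi : 'I_n -> E -> R) (dpsi : 'I_n -> 'I_n -> E -> R) r (C : set E),
  (forall k, test r (psi k) (dpsi k)) -> closed C -> C `<=` U ->
  (forall k x, psi k x != 0 -> C x) -> (forall x, \sum_k psi k x ^+ 2 <= 1) ->
  intR (fun x => g x * \sum_k (dpsi k k x * f x + psi k x * G x ord0 k)) <= V.

Let M0 : 0 <= M. Proof. exact: le_trans (gM 0). Qed.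
Let mU : measurable U. Proof. exact: open_measurable_rV. Qed.

(** The derivative of the cutoff is bounded uniformly in r0 and vanishes on the cube of radius
r0 - 2. *)
Lemma cutoff_loss_small tau : 0 < tau -> exists2 r, 0 < r & forall r0, r + 2 <= r0 -> cutoff_loss f r0 <= tau.
Proof.
move=> tau0; have [B B0 bB] := @dsmooth_indic_bound R n 1 ltr01.
have nB : 0 < n%:R * B + 1 by rewrite ltr_wpDl// mulr_ge0.
have [r rp hr] := L1_tail fL1 (divr_gt0 tau0 nB).
exists r => // r0 r0r.
have [t _ _] := cutoff_props n r0.
have mc : measurable_fun setT (fun x : E => 1 - \1_(@cube R n (r0 - 2)) x : R).
  by apply: measurable_funB => //; exact: measurable_1cube.
have it : L1 (fun x => (1 - \1_(@cube R n (r0 - 2)) x) * `|f x|).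
  apply: (@L1M _ _ 1) => //; last exact: L1_norm.
  by move=> x; rewrite indicE; case: (_ \in _); rewrite ?subrr ?normr0 ?subr0 ?normr1.
have bd (k : 'I_n) (x : E) : `|dcutoff r0 k x| <= B.
  exact: (bB (@cube R n r0) r0 x k (@measurable_cube R n r0) (@subset_refl _ _)).
apply: (@le_trans _ _ (\sum_(k < n) B * intR (fun x => (1 - \1_(@cube R n (r0 - 2)) x) * `|f x|))).
  apply: ler_sum => k _; rewrite -intRZ//.
  have ik : L1 (fun x => f x * `|dcutoff r0 k x|).
    rewrite (_ : (fun x => _) = (fun x => `|dcutoff r0 k x| * f x)); last first.
      by apply/funext => x; rewrite mulrC.
    apply: (@L1M _ _ B) => //; last by move=> x; rewrite normr_id.
    by apply: measurableT_comp => //; exact: C1_dmeasurable t.1.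
  apply: le_intR => //; first exact: L1Z.
  move=> x; rewrite (ger0_norm (f0 x)) indicE; case: (boolP (x \in _)) => [/set_mem xr|_].
    rewrite dcutoff_eq0 ?normr0 ?subrr ?mulr0 ?mul0r ?mulr0//.
    apply: (@le_lt_trans _ _ (r0 - 2)); last by lra.
    by apply/cubeE => //; lra.
  by rewrite subr0 mul1r mulrC ler_wpM2r.
rewrite sumr_const card_ord -[leLHS]mulr_natl mulrA.
have hs : intR (fun x => (1 - \1_(@cube R n (r0 - 2)) x) * `|f x|) <= tau / (n%:R * B + 1).
  by apply: hr; lra.
apply: (@le_trans _ _ ((n%:R * B + 1) * (tau / (n%:R * B + 1)))).
  apply: ler_pM => //; first by rewrite mulr_ge0.
    by apply: intR_ge0 => x; rewrite mulr_ge0// indicE; case: (_ \in _); rewrite ?subrr ?subr0.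
  by rewrite lerDl.
by rewrite mulrC divfK// gt_eqF.
Qed.

Lemma layer_rad_small r : 0 < r -> exists N, layer_rad R N <= r.
Proof.
move=> rp; have [k _ /(_ k (leqnn k)) kP] := near_infty_natSinv_lt (PosNum rp).
exists k; apply: le_trans (ltW kP); rewrite /layer_rad exprVn lef_pV2 ?posrE ?exprn_gt0//.
rewrite -natrX ler_nat; elim: k {kP} => [|k IH]; first by rewrite expn0.
by rewrite expnS mulSn -addn1; apply: leq_add IH _; rewrite muln_gt0 expn_gt0.
Qed.

Lemma inner_exists x : U x -> exists N, inner U (4 * layer_rad R N) x.
Proof.
move=> Ux; have /nbhs_ballP[e /= e0 eU] := open_nbhs_nbhs (conj oU Ux).
have [N Nr] := layer_rad_small (divr_gt0 e0 (ltr0n R 4)).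
have N4 : 4 * layer_rad R N <= e by lra.
exists N; apply: (inner_le N4).
move=> y xy; apply: eU; rewrite mx_norm_ball /ball_/= distrC; exact: xy.
Qed.

(** Each component is bounded by the Euclidean length, whence the factor n. *)
Lemma grad_mass_le r0 : ((grad_mass G U r0)%:E <= n%:R%:E * \int[leb]_(x in U) (enorm (G x))%:E)%E.
Proof.
have locG k : L1loc_rV (fun x => `|G x ord0 k|).
  move=> r; have := L1_norm (weak_grad_loc fG k r).
  congr L1; apply/funext => x; rewrite normrM ger0_norm// indicE//.
have mG k : measurable_fun setT (fun x => G x ord0 k).
  exact: L1loc_measurable (weak_grad_loc fG k).
have [[c s] k01 _] := cutoff_props n r0.
have ik k : L1 (fun x => (cutoff r0 x * \1_U x) * `|G x ord0 k|).
  apply: (@L1M_loc _ _ 1 (r0 + 1)); last exact: locG.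
  - by apply: measurable_funM; [exact: C1_measurable c|exact: measurable_indic].
  - move=> x; have /andP[k0 k1] := k01 x; rewrite normrM (ger0_norm k0) mulr_ile1//.
    by rewrite indicE; case: (_ \in _); rewrite ?normr0 ?normr1.
  - by move=> x; rewrite mulf_eq0 negb_or => /andP[/s].
rewrite /grad_mass -sumEFin.
apply: (@le_trans _ _ (\sum_(k < n) \int[leb]_(x in U) (enorm (G x))%:E)%E); last first.
  have cst_sum m (a : \bar R) : iter m (adde a) 0%E = (a *+ m)%E.
    by elim: m => // m IH; rewrite iterS IH muleS.
  by rewrite big_const_ord mule_natl cst_sum.
apply: lee_sum => k _; rewrite -L1_EFin// [leRHS]integral_mkcond.
apply: ge0_le_integral => //.
- by move=> x _; rewrite lee_fin mulr_ge0// mulr_ge0//; have /andP[] := k01 x.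
- by apply/measurable_EFinP; exact: L1_measurable.
- apply/(measurable_restrictT _ mU); apply: measurable_funTS; apply/measurable_EFinP.
  exact: measurable_enorm.
move=> x _; rewrite patchE indicE; case: ifP => [_|_]; last by rewrite mulr0 mul0r.
have /andP[k0 k1] := k01 x.
rewrite lee_fin mulr1; apply: le_trans (coord_le_enorm (G x) k).
by rewrite ler_piMl.
Qed.

Lemma approx_smooth r0 dl N k : Ck k setT (approx U r0 g dl N).
Proof.
apply: Ck_sum => j.
by apply: Ck_conv; exact: (L1_gzj U r0 mg gM).
Qed.

(** The limit h of the partial sums.  The real J stands for the integral of the gradient on the part
of U cut off near infinity, and keeps the bound finite even when the integral on U is infinite.
The function kp is the cutoff, equal to 1 on larger and larger cubes as e goes to 0. *)
Lemma smooth_approximation (e : R) : 0 < e -> exists (h : E -> R) (J : R) (kp : E -> R), [/\ smooth U h /\ measurable_fun U h,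
  forall x, U x -> `|h x| <= M * (1 + e),
  (forall phi : E -> E, C1c U phi -> (forall x, \sum_k phi x ord0 k ^+ 2 <= 1) ->
    (\int[leb]_(x in U) (h x * (divergence phi x * f x +
      \sum_k phi x ord0 k * G x ord0 k))%:E <=
      (V + e + (1 + n%:R * Cdrho R n) * M * J)%:E)%E) /\
    (J%:E <= n%:R%:E * \int[leb]_(x in U) (enorm (G x))%:E)%E,
  [/\ measurable_fun setT kp, (forall x, 0 <= kp x <= 1) &
      forall x, cube e^-1 x -> kp x = 1] &
  L1 (fun x => \1_U x * `|h x - g x * kp x| * f x) /\
    intR (fun x => \1_U x * `|h x - g x * kp x| * f x) <= e].
Proof.
move=> e0.
(* the errors add up to at most tau (K - 1), so that tau K = e suffices; K >= 1 also gives tau <= e *)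
pose K := n%:R + M + n%:R * Cdrho R n * M + 1.
have C0 : 0 < Cdrho R n := Cdrho_gt0 R n.
have n0 : 0 <= n%:R :> R by [].
have nC0 : 0 <= n%:R * Cdrho R n * M by rewrite !mulr_ge0// ltW.
have K1 : 1 <= K by rewrite /K lerDr addr_ge0// addr_ge0.
have K0 : 0 < K := lt_le_trans ltr01 K1.
pose tau := e / K.
have tau0 : 0 < tau by rewrite divr_gt0.
have tauK : tau * K = e by rewrite divfK// gt_eqF.
have taue : tau <= e by rewrite -tauK ler_peMr// ltW.
have [rt rt0 htail] := cutoff_loss_small tau0.
have ei0 : 0 < e^-1 by rewrite invr_gt0.
(* so that r0 - 1 >= 1 / e, and the cutoff loss is at most tau *)
pose r0 := e^-1 + rt + 2.
have r0t : rt + 2 <= r0 by rewrite /r0; lra.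
have [dl hdl] := choice (good_scale_exists G fL1 f0 U r0 mg gM tau0).
have dl0 j : 0 < dl j by case: (hdl j).
pose A N := approx U r0 g dl N.
have mA N : measurable_fun setT (A N).
  by apply: measurable_sum => j; apply: measurable_conv_rho (dl0 j) _; exact: L1_gzj mg gM j.
have bA N x : `|A N x| <= M * (1 + tau) by exact: (approx_bound mg gM tau0 hdl).
have sA N N' x : (N <= N')%N -> inner U (2 * layer_rad R N) x -> A N' x = A N x.
  exact: (approx_stable mg gM hdl).
pose h x := lim (A N x @[N --> \oo]).
have nA N x : inner U (2 * layer_rad R N) x -> \forall N' \near \oo, A N' x = A N x.
  by move=> xi; exists N => // N' /= NN'; exact: sA.
have hA N x : inner U (2 * layer_rad R N) x -> h x = A N x.
  by move=> xi; apply: lim_near_cst => //; exact: nA.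
have iU x : U x -> exists N, inner U (2 * layer_rad R N) x.
  move=> Ux; have [N xi] := inner_exists Ux; exists N; apply: inner_le xi.
  by have := layer_rad_gt0 R N; lra.
have cA x : U x -> A N x @[N --> \oo] --> h x.
  by move=> /iU[N xi]; rewrite (hA _ _ xi); apply: cvg_near_cst; exact: nA.
have [tk k01 k1] := cutoff_props n r0.
exists h, (grad_mass G U r0), (cutoff r0); split.
- split.
    move=> k; apply: Ck_local => x Ux; have [N xi] := inner_exists Ux.
    exists (A N); first exact: approx_smooth.
    have N0 := layer_rad_gt0 R N.
    apply/nbhs_ballP; exists (2 * layer_rad R N) => /=; first by rewrite mulr_gt0.
    move=> y; rewrite mx_norm_ball /ball_/= distrC => xy.
    rewrite (hA N)//; have := inner_shift xi (ltW xy).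
    rewrite [x + _]addrC subrK; apply: inner_le; lra.
  apply: (measurable_fun_cvg (h := A)) => // m; exact: measurable_funTS.
- move=> x Ux; have [N xi] := iU x Ux; rewrite (hA _ _ xi).
  by apply: le_trans (bA N x) _; rewrite ler_wpM2l// lerD2l.
- split; last exact: grad_mass_le.
  move=> phi cphi phi1; have [rp tphi] := C1c_tests cphi.
  have [_ cK KU] := cphi.
  set S := closure _ in cK KU.
  have [r rr Sr] := compact_inner oU cK KU.
  have r2 : 0 < r / 2 by rewrite divr_gt0.
  have [N Nr] := layer_rad_small r2.
  have SN : S `<=` inner U (2 * layer_rad R N).
    by move=> x /Sr; apply: inner_le; lra.
  have phi0 x k : ~ S x -> phi x ord0 k = 0.
    move=> nS; have : phi x = 0; last by move=> ->; rewrite mxE.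
    apply/eqP/negPn/negP => px; apply: nS; exact: subset_closure.
  have dphi0 x k i : ~ S x -> 'D_(ebase i) phi x ord0 k = 0.
    move=> nS; have [c _] := tphi k.
    apply: (C1_locally_cst (O := ~` S) (c := 0) i c) => //.
      by apply: closed_openC; exact: closed_closure.
    by move=> y /(phi0 y k).
  (* X vanishes outside S, and on S the approximation is the partial sum of index N *)
  pose X x := \sum_k ('D_(ebase k) phi x ord0 k * f x + phi x ord0 k * G x ord0 k).
  have iX : L1 X by apply: L1_sum => k; exact: (L1_wdiv fL1 fG (tphi k) k).
  have iAX : L1 (fun x => A N x * X x) by exact: (L1M (mA N) (bA N) iX).
  have -> : (\int[leb]_(x in U) (h x * (divergence phi x * f x +
      \sum_k phi x ord0 k * G x ord0 k))%:E = (intR (fun x => A N x * X x))%:E)%E.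
    rewrite integral_mkcond -L1_EFin//; apply: eq_integral => x _; rewrite patchE.
    have -> : divergence phi x * f x + \sum_k phi x ord0 k * G x ord0 k = X x.
      by rewrite /X big_split/= /divergence mulr_suml.
    have [Sx|nSx] := pselect (S x).
      by rewrite mem_set ?(hA N)//; [exact: SN|exact: KU].
    have -> : X x = 0 by apply: big1 => k _; rewrite phi0// dphi0// !mul0r addr0.
    by rewrite !mulr0 if_same.
  rewrite lee_fin; have phiN k x : phi x ord0 k != 0 -> inner U (2 * layer_rad R N) x.
    move=> px; apply: SN; apply: contrapT => /(phi0 x k) p0; by rewrite p0 eqxx in px.
  apply: le_trans (approx_variation fL1 f0 fG mg gM tau0 hdl hV tphi phi1 phiN mU) _.
  have ht : M * cutoff_loss f r0 <= M * tau by rewrite ler_wpM2l// htail.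
  have : tau * K = n%:R * tau + M * tau + n%:R * Cdrho R n * M * tau + tau.
    by rewrite /K; ring.
  rewrite tauK.
  have -> : n%:R * (Cdrho R n * (M * (grad_mass G U r0 + tau))) =
    n%:R * Cdrho R n * M * grad_mass G U r0 + n%:R * Cdrho R n * M * tau by ring.
  have -> : (1 + n%:R * Cdrho R n) * M * grad_mass G U r0 =
    M * grad_mass G U r0 + n%:R * Cdrho R n * M * grad_mass G U r0 by ring.
  lra.
- split=> // [|x xe]; first exact: C1_measurable tk.1.
  apply: k1 => i; apply: le_trans (xe i) _; rewrite /r0; lra.
(* the errors of the partial sums, restricted to the sets where these are final *)
pose I N x : R := \1_(inner U (2 * layer_rad R N)) x.
pose B N x := `|A N x - g x * (chi U r0 N x * cutoff r0 x)| * f x.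
have iB N : L1 (B N) /\ intR (B N) <= tau by exact: (approx_error fL1 f0 mg gM tau0 hdl).
have mI N : measurable_fun setT (I N) by apply: measurable_indic; exact: measurable_inner.
have bI N x : `|I N x| <= 1.
  by rewrite /I indicE; case: (_ \in _); rewrite ?normr0 ?normr1.
have iIB N : L1 (fun x => I N x * B N x) by exact: (L1M (mI N) (bI N) (iB N).1).
have IBE N x : I N x * B N x = I N x * (`|h x - g x * cutoff r0 x| * f x).
  rewrite /I indicE; case: (boolP (x \in _)) => [/set_mem xi|_]; last by rewrite !mul0r.
  rewrite /B (chi_cutoff_inner r0 (N := N)) ?(hA N)//.
  by apply: inner_le xi; have := layer_rad_gt0 R N; lra.
have cIB x : (I N x * B N x) @[N --> \oo] --> \1_U x * `|h x - g x * cutoff r0 x| * f x.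
  apply: cvg_near_cst; have [Ux|nU] := pselect (U x).
    have [N xi] := iU x Ux; exists N => // N' /= NN'; rewrite IBE mulrA.
    rewrite /I !indicE !mem_set//; apply: inner_le xi.
    by rewrite ler_wpM2l//; exact: layer_rad_le.
  apply: nearW => N; rewrite IBE /I !indicE !memNset ?mul0r//.
  by apply: contra_not nU; apply: inner_sub; rewrite mulr_gt0// layer_rad_gt0.
have bIB N x : `|I N x * B N x| <= (M * (1 + tau) + M) * f x.
  rewrite normrM -[leRHS]mul1r; apply: ler_pM => //.
  rewrite /B normrM normr_id (ger0_norm (f0 x)) ler_wpM2r//.
  apply: le_trans (ler_normB _ _) _; rewrite lerD// normrM -[leRHS]mulr1; apply: ler_pM => //.
  have [_ c01 _ _] := chi_props U r0 N; have /andP[c0 c1] := c01 x.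
  have /andP[k0 k1'] := k01 x.
  by rewrite ger0_norm ?mulr_ge0// mulr_ile1.
have iH : L1 (fun x => (M * (1 + tau) + M) * f x) by exact: L1Z.
have [i c] := cvg_intR (fun N => L1_measurable (iIB N)) cIB iH bIB.
split=> //; apply: (cvgr_to_le c); apply: nearW => N; apply: (le_trans _ taue).
apply: le_trans (iB N).2; apply: le_intR => //; first exact: (iB N).1.
move=> x; rewrite -[leRHS]mul1r ler_wpM2r//; first by rewrite mulr_ge0.
exact: le_trans (ler_norm _) (bI N x).
Qed.

End smooth_approximation.

(** * The weighted variation and the theorem *)

Section weighted.
Context (R : realType) (n : nat).
Local Notation E := 'rV[R]_n.
Local Notation leb := (lebesgue_rV R n).
Variables (f : E -> R) (U : set E).
Hypothesis fL1 : L1 f.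
Hypothesis oU : open U.

Let mU : measurable U. Proof. exact: open_measurable_rV. Qed.

(** An element of L^oo(U) may exceed its norm on a null set, whereas the mollification estimates need
a bound everywhere. *)
Lemma bounded_representative (g : E -> R) : Linf U g -> exists (g' : E -> R) (M : R),
  [/\ measurable_fun setT g', forall x, `|g' x| <= M, normLinf U g = M%:E &
      {ae leb, forall x, U x -> g x = g' x}].
Proof.
move=> [mg goo]; have N0 := normLinf_ge0 U g.
have NE : normLinf U g = (fine (normLinf U g))%:E by rewrite fineK// ge0_fin_numE.
pose M := fine (normLinf U g).
have M0 : 0 <= M by exact: fine_ge0.
pose w := g \_ U.
have mw : measurable_fun setT w by apply/(measurable_restrictT g mU).
pose A : set E := [set x | `|w x| <= M].
have mA : measurable A.
  have mn : measurable_fun setT (fun x => `|w x|) by exact: measurableT_comp.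
  have -> : A = setT `&` (fun x => `|w x|) @^-1` `]-oo, M]%classic.
    by rewrite setTI; apply/seteqP; split => x /=; rewrite in_itv.
  exact: mn.
exists (fun x => \1_A x * w x), M; split => //.
- by apply: measurable_funM => //; exact: measurable_indic.
- move=> x; rewrite indicE; case: (boolP (x \in A)) => [/set_mem xA|_].
    by rewrite mul1r.
  by rewrite mul0r normr0.
have := normLinf_ae U g; apply: filterS => x h Ux.
have wg : w x = g x by rewrite /w patchE mem_set.
rewrite indicE mem_set ?mul1r ?wg// /A /= wg -lee_fin -NE; exact: h.
Qed.

Variable G : E -> E.
Hypothesis fG : is_weak_grad f G.
Hypothesis wG : weak_grad f = G.

(** Test fields are competitors in the definition of the weighted variation. *)
Lemma test_variation_le (g g' : E -> R) (M : R) : measurable_fun U g ->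
  measurable_fun setT g' -> (forall x, `|g' x| <= M) ->
  {ae leb, forall x, U x -> g x = g' x} ->
  forall (psi : 'I_n -> E -> R) (dpsi : 'I_n -> 'I_n -> E -> R) r (C : set E),
  (forall k, test r (psi k) (dpsi k)) -> closed C -> C `<=` U ->
  (forall k x, psi k x != 0 -> C x) -> (forall x, \sum_k psi k x ^+ 2 <= 1) ->
  ((intR (fun x => g' x * \sum_k (dpsi k k x * f x + psi k x * G x ord0 k)))%:E <=
    BVnorm f U g)%E.
Proof.
move=> mg mg' gM gg' psi dpsi r C t cC CU sC psi1.
pose X x := \sum_k (dpsi k k x * f x + psi k x * G x ord0 k).
have iX : L1 X by apply: L1_sum => k; exact: (L1_wdiv fL1 fG (t k) k).
have mX : measurable_fun U X by apply: measurable_funTS; exact: L1_measurable.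
have X0 x : ~ U x -> X x = 0.
  move=> nU; have nC : ~ C x by apply: contra_not nU => /CU.
  apply: big1 => k _; have [c _] := t k.
  have p0 y : ~ C y -> psi k y = 0.
    by move=> nCy; apply/eqP/negPn/negP => /sC.
  rewrite p0// (C1_locally_cst (O := ~` C) (c := 0) k c) ?mul0r ?addr0//.
  exact: closed_openC.
have [cphi dphi] := tests_C1c t cC CU sC.
apply: ereal_sup_ubound => /=; exists (fun x : E => \row_k psi k x).
  split=> //; apply: normLinf_le => // x _.
  rewrite ger0_norm ?sqrtr_ge0// enorm_le1; apply: le_trans (psi1 x).
  by apply: ler_sum => k _; rewrite mxE.
rewrite wG -L1_EFin; last exact: (L1M mg' gM iX).
have -> : (\int[leb]_x (g' x * X x)%:E = \int[leb]_(x in U) (g' x * X x)%:E)%E.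
  rewrite [RHS]integral_mkcond; apply: eq_integral => x _; rewrite patchE.
  by case: ifPn => // /negP; rewrite inE => /X0 ->; rewrite mulr0.
have -> : (\int[leb]_(x in U) (g x * (divergence (fun x : E => \row_k psi k x) x * f x +
    \sum_(i < n) (\row_k psi k x) ord0 i * G x ord0 i))%:E =
    \int[leb]_(x in U) (g x * X x)%:E)%E.
  apply: eq_integral => x _; rewrite dphi /X big_split/= mulr_suml.
  by congr (_ * (_ + _))%:E; apply: eq_bigr => k _; rewrite mxE.
apply: ae_eq_integral => //.
- by apply/measurable_EFinP; apply: measurable_funM.
- by apply/measurable_EFinP; apply: measurable_funM => //; exact: measurable_funTS.
by apply: filterS gg' => x h Ux /=; rewrite h.
Qed.

(** The competitors are continuous, so that an almost everywhere bound of their length holds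
everywhere. *)
Lemma BVnorm_le (h : E -> R) (B : \bar R) :
  (forall phi : E -> E, C1c U phi -> (forall x, \sum_k phi x ord0 k ^+ 2 <= 1) ->
    (\int[leb]_(x in U) (h x * (divergence phi x * f x +
      \sum_k phi x ord0 k * G x ord0 k))%:E <= B)%E) ->
  (BVnorm f U h <= B)%E.
Proof.
move=> hB; apply: ge_ereal_sup => _ [phi [cphi phi1] <-]; rewrite wG; apply: hB => //.
have [[cp _] _ sU] := cphi.
have cp' : continuous phi by move=> x; exact: cp.
apply: ae_le_everywhere; first exact: continuous_enorm2.
apply: filterS (normLinf_ae U (fun x => enorm (phi x))) => x hx.
rewrite -enorm_le1; have [Ux|nU] := pselect (U x).
  by have := le_trans (hx Ux) phi1; rewrite lee_fin ger0_norm ?sqrtr_ge0.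
have -> : phi x = 0.
  apply/eqP/negPn/negP => px; apply: nU; apply: sU; exact: subset_closure.
by rewrite enorm_le1 big1// => k _; rewrite mxE expr0n.
Qed.

End weighted.

Section weighted_convergence.
Context (R : realType) (n : nat).
Local Notation E := 'rV[R]_n.
Local Notation leb := (lebesgue_rV R n).
Variables (mu : {measure set E -> \bar R}) (f : E -> R).
Hypothesis fL1 : L1 f.
Hypothesis f0 : forall x, 0 <= f x.
Hypothesis muf : forall A, measurable A -> mu A = (\int[leb]_(x in A) (f x)%:E)%E.

(** The measure is absolutely continuous with respect to Lebesgue measure. *)
Lemma density_ae (P : set E) : {ae leb, forall x, P x} -> {ae mu, forall x, P x}.
Proof.
move=> [N [mN N0 PN]]; exists N; split => //; rewrite muf//.
apply: null_set_integral => //; apply: measurable_funTS; apply/measurable_EFinP.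
exact: L1_measurable.
Qed.

Lemma density_finite (A : set E) : measurable A -> (mu A < +oo)%E.
Proof.
move=> mA; apply: (@le_lt_trans _ _ (mu setT)); first by apply: le_measure; rewrite ?inE.
by rewrite muf// L1_EFin// ltry.
Qed.

(** On a set K contained in a cube the cutoff kp e is 1 as soon as 1 / e exceeds the radius, and then
the integral on K is at most e. *)
Lemma cvg_L1_of_bound (U K : set E) (g g' : E -> R) (h : R -> E -> R) (kp : R -> E -> R) M r :
  measurable K -> K `<=` U -> K `<=` cube r -> measurable_fun U g -> measurable U ->
  measurable_fun setT g' -> (forall x, `|g' x| <= M) ->
  {ae leb, forall x, U x -> g x = g' x} ->
  (forall e, 0 < e -> [/\ measurable_fun U (h e), forall x, U x -> `|h e x| <= M * (1 + e),
    forall x, cube e^-1 x -> kp e x = 1 &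
    L1 (fun x => \1_U x * `|h e x - g' x * kp e x| * f x) /\
    intR (fun x => \1_U x * `|h e x - g' x * kp e x| * f x) <= e]) ->
  cvg_L1 mu K h g.
Proof.
move=> mK KU Kr mg mU mg' gM gg' hh.
have mgK : measurable_fun K g by exact: measurable_funS mg.
have mg'K : measurable_fun K g' by exact: measurable_funTS.
have mhK e : 0 < e -> measurable_fun K (h e).
  by move=> /hh[+ _ _ _]; exact: measurable_funS.
have ggm : {ae mu, forall x, K x -> g x = g' x}.
  apply: density_ae; apply: filterS gg' => x H /KU; exact: H.
have bint (u : E -> R) B : measurable_fun K u -> (forall x, K x -> `|u x| <= B) ->
    mu.-integrable K (EFin \o u).
  move=> mu_ uB; apply: measurable_bounded_integrable => //; first exact: density_finite.
  exists B; split; first exact: num_real.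
  by move=> b Bb x Kx; apply: le_trans (uB x Kx) (ltW Bb).
have ig' : mu.-integrable K (EFin \o g') by apply: (bint _ M).
split.
- move=> e e0; have [_ b _ _] := hh e e0.
  by apply: (bint _ (M * (1 + e))); [exact: mhK|move=> x /KU; exact: b].
- apply/integrableP; split; first exact/measurable_EFinP.
  have /integrableP[_] := ig'; congr (_ < _)%E; apply: ae_eq_integral => //.
  + by apply: measurableT_comp => //; exact/measurable_EFinP.
  + by apply: measurableT_comp => //; exact/measurable_EFinP.
  by apply: filterS ggm => x H Kx /=; rewrite H.
apply: (@squeeze_cvge _ _ _ _ (fun=> 0%E) _ (fun e => e%:E)).
- have r1 : 0 < (`|r| + 1)^-1 by rewrite invr_gt0 ltr_wpDl.
  near=> e.
  have e0 : 0 < e by near: e; exact: nbhs_right_gt.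
  have er : r <= e^-1.
    apply: (@le_trans _ _ (`|r| + 1)); first by rewrite (le_trans (ler_norm _))// lerDl.
    rewrite -[leLHS]invrK lef_pV2 ?posrE//; apply: ltW; near: e; exact: nbhs_right_lt.
  rewrite integral_ge0//=.
  have [_ b k1 [i ie]] := hh e e0.
  have mhe := mhK e e0.
  pose u x := \1_K x * `|h e x - g' x|.
  have uE : EFin \o u = (fun x => `|h e x - g' x|%:E) \_ K.
    by apply/funext => x; rewrite /u patchE /= indicE; case: (x \in K); rewrite ?mul1r ?mul0r.
  have mu_ : measurable_fun setT u.
    apply/measurable_EFinP; rewrite uE; apply/(measurable_restrictT _ mK).
    by apply/measurable_EFinP; apply: measurableT_comp => //; exact: measurable_funB.
  have u0 x : 0 <= u x by rewrite mulr_ge0// indicE.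
  have M0 : 0 <= M by apply: le_trans (gM 0).
  have uB x : u x <= M * (1 + e) + M.
    rewrite /u indicE; case: (boolP (x \in K)) => [/set_mem/KU Ux|_].
      by rewrite mul1r; apply: le_trans (ler_normB _ _) _; rewrite lerD// b.
    by rewrite mul0r addr_ge0// mulr_ge0// addr_ge0// ltW.
  have [iu uI] := density_integral fL1 f0 muf mu_ u0 uB.
  have -> : (\int[mu]_(x in K) `|h e x - g x|%:E = (intR (fun x => u x * f x))%:E)%E.
    rewrite -uI; rewrite -[RHS]/(\int[mu]_x (EFin \o u) x)%E uE -integral_mkcond.
    apply: ae_eq_integral => //.
    + by apply/measurable_EFinP; apply: measurableT_comp => //; exact: measurable_funB.
    + by apply/measurable_EFinP; apply: measurableT_comp => //; exact: measurable_funB.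
    by apply: filterS ggm => x H Kx /=; rewrite H.
  rewrite lee_fin; apply: le_trans ie; apply: le_intR => // x.
  rewrite ler_wpM2r// /u !indicE; case: (boolP (x \in K)) => [/set_mem Kx|_].
    rewrite mem_set; last exact: KU.
    by rewrite k1 ?mulr1// => j; apply: le_trans (Kr x Kx j) er.
  by rewrite mul0r mulr_ge0.
- exact: cvg_cst.
apply: cvg_EFin; first exact: nearW.
by apply: cvg_at_right_filter; exact: cvg_id.
Unshelve. all: by end_near. Qed.

End weighted_convergence.

Theorem lemma2p4 (R : realType) (n : nat) (hn : (0 < n)%N) :
  exists2 C : R, 0 < C &
  forall (mu : {measure set 'rV[R]_n -> \bar R}) (f : 'rV[R]_n -> R)
    (U : set 'rV[R]_n) (g : 'rV[R]_n -> R),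
  in_W mu f -> open U -> BV f U g -> Linf U g ->
  exists g_ : R -> 'rV[R]_n -> R,
  [/\ forall e, 0 < e -> smooth U (g_ e) /\ BV f U (g_ e),
      cvg_L1loc mu U g_ g,
      forall e, 0 < e ->
        (normLinf U (g_ e) <= normLinf U g * (1 + 2 * e)%:E)%E,
      (limf_esup (fun e => BVnorm f U (g_ e)) 0^'+ <=
       BVnorm f U g + C%:E * normLinf U g *
         \int[lebesgue_rV R n]_(x in U) (enorm (weak_grad f x))%:E)%E &
      bounded_set U -> cvg_L1 mu U g_ g].
Proof.
have C0 := Cdrho_gt0 R n.
pose c := 1 + n%:R * Cdrho R n.
have c0 : 0 < c by rewrite ltr_wpDr// mulr_ge0// ltW.
exists (n%:R * c); first by rewrite mulr_gt0// ltr0n.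
move=> mu f U g [muf f0 fL1 [_ exG] _] oU [mg gBV] gLi.
have mU := open_measurable_rV oU.
have fG : is_weak_grad f (weak_grad f).
  by rewrite /weak_grad; case: exG => G hG; exact: (@xgetPex _ (fun=> 0) [set G | is_weak_grad f G] (ex_intro _ G hG)).
have [g' [M [mg' gM ME gg']]] := bounded_representative oU gLi.
have M0 : 0 <= M by apply: le_trans (gM 0).
have tv := test_variation_le fL1 oU fG erefl mg mg' gM gg'.
(* the zero field is a competitor *)
have V0 : (0 <= BVnorm f U g)%E.
  have t0 (k : 'I_n) : test 0 (fun _ : 'rV[R]_n => 0) (fun _ _ => 0).
    by split; [exact: C1_0|move=> x; rewrite eqxx].
  have h0 x : \sum_k (0 * f x + 0 * weak_grad f x ord0 k) = 0.
    by rewrite big1// => k _; rewrite !mul0r addr0.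
  have := @tv (fun _ _ => 0) (fun _ _ _ => 0) 0 set0 t0 (@closed0 _) (@sub0set _ _).
  rewrite (eq_intR (w := fun=> 0)) ?intR0; last by move=> x; rewrite h0 mulr0.
  apply; first by move=> k x; rewrite eqxx.
  by move=> x; rewrite big1// => k _; rewrite expr0n.
have VE : BVnorm f U g = (fine (BVnorm f U g))%:E by rewrite fineK// ge0_fin_numE.
set V := fine _ in VE.
rewrite VE ME in tv *.
pose I := (\int[lebesgue_rV R n]_(x in U) (enorm (weak_grad f x))%:E)%E.
have I0 : (0 <= I)%E by apply: integral_ge0 => x _; rewrite lee_fin sqrtr_ge0.
have scale := smooth_approximation fL1 f0 fG oU mg' gM tv.
have /choice[a ha] (e : R) : exists a : ('rV[R]_n -> R) * R * ('rV[R]_n -> R), 0 < e ->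
    [/\ smooth U a.1.1 /\ measurable_fun U a.1.1,
      forall x, U x -> `|a.1.1 x| <= M * (1 + e),
      (BVnorm f U a.1.1 <= (V + e + c * M * a.1.2)%:E)%E /\ (a.1.2%:E <= n%:R%:E * I)%E,
      forall x, cube e^-1 x -> a.2 x = 1 &
      L1 (fun x => \1_U x * `|a.1.1 x - g' x * a.2 x| * f x) /\
        intR (fun x => \1_U x * `|a.1.1 x - g' x * a.2 x| * f x) <= e].
  have [e0|ne0] := pselect (0 < e); last by exists (fun=> 0, 0, fun=> 0).
  have [h [J [kp [hs hM [hV hJ] [_ _ hk] hI]]]] := scale e e0.
  exists (h, J, kp) => _; split => //; split => //.
  exact: BVnorm_le hV.
pose g_ e := (a e).1.1.
have cvgK (K : set 'rV[R]_n) : measurable K -> bounded_set K -> K `<=` U -> cvg_L1 mu K g_ g.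
  move=> mK [r [_ Kr]] KU.
  apply: (@cvg_L1_of_bound _ _ mu f fL1 f0 muf U K g g' g_ (fun e => (a e).2) M (`|r| + 1)) => //.
    move=> x Kx i; apply: le_trans (coord_le_norm _ _) _; apply: (Kr _ _ x Kx).
    by rewrite (le_lt_trans (ler_norm _))// ltrDl.
  by move=> e e0; have [[_ ?] ? _ ? ?] := ha e e0.
exists g_; split.
- move=> e e0; have [[hs hm] _ [hB _] _ _] := ha e e0.
  by split=> //; split=> //; apply: le_lt_trans hB _; exact: ltry.
- move=> K cK KU; apply: cvgK => //; last exact: compact_bounded.
  rewrite -[K]setCK; apply: measurableC; apply: open_measurable_rV; apply: closed_openC.
  by apply: compact_closed => //; exact: norm_hausdorff.
- move=> e e0; have [_ hM _ _ _] := ha e e0.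
  apply: (@le_trans _ _ (M * (1 + e))%:E).
    by apply: normLinf_le => //; rewrite mulr_ge0// addr_ge0// ltW.
  by rewrite -EFinM lee_fin ler_wpM2l//; lra.
- apply/lee_addgt0Pr => t t0.
  apply: (@le_trans _ _ (ereal_sup ((fun e => BVnorm f U (g_ e)) @` `]0, t[%classic))).
    apply: ereal_inf_lbound; exists `]0, t[%classic => //.
    by apply: filterS2 (nbhs_right_gt 0) (nbhs_right_lt t0) => e e0 et; rewrite /= in_itv/= e0.
  apply: ge_ereal_sup => _ [e /= + <-]; rewrite in_itv/= => /andP[e0 et].
  have [_ _ [hB hJ] _ _] := ha e e0.
  apply: le_trans hB _.
  have -> : ((V + e + c * M * (a e).1.2)%:E =
      V%:E + (c * M)%:E * (a e).1.2%:E + e%:E)%E.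
    by rewrite -EFinM -!EFinD; congr (_%:E); ring.
  have -> : ((n%:R * c)%:E * M%:E = (c * M)%:E * n%:R%:E :> \bar R)%E.
    by rewrite -!EFinM; congr (_%:E); ring.
  rewrite -muleA; apply: leeD; last by rewrite lee_fin ltW.
  by apply: leeD => //; apply: lee_wpmul2l => //; rewrite lee_fin mulr_ge0// ltW.
by move=> bU; exact: cvgK.
Qed.
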